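(* Let $\gamma:[a,b]\to\mathbb{C}$ ($a<b$) be a simple analytic curve and $k\in\{0,1,2,\dots\}\cup\{\infty\}$. Then each of the classes $U_2(\gamma^*,k)$, $U_3(\gamma^*,k)$, $U_4(\gamma^*,k)$, $U_5(\gamma^*,k)$ is a dense $G_\delta$ subset of $C^k(\gamma^* )$.
   Context: A simple curve $\gamma:[a,b]\to\mathbb{C}$ is analytic if there are an open set $V\subset\mathbb{C}$ with $[a,b]\subset V$ and an injective holomorphic $F:V\to\mathbb{C}$ with $F|_{[a,b]}=\gamma$; fix such $V,F$. $\gamma^*=\gamma([a,b])$. Let $K(\gamma,+)=F(V\cap\{\operatorname{Im}z>0\})$, $K(\gamma,-)=F(V\cap\{\operatorname{Im}z<0\})$. $C^k(\gamma^* )$ is the space of $u:\gamma^*\to\mathbb{C}$ with $u\circ\gamma$ $k$ times continuously differentiable on $[a,b]$, with seminorms $\sup_{t\in[a,b]}|(u\circ\gamma)^{(l)}(t)|$, integers $0\le l\le k$. $U_2(\gamma^*,k)$: the $u\in C^k(\gamma^* )$ for which there are no open connected $W$ with $W\cap\gamma^*\neq\emptyset$ and continuous $\lambda:\gamma^*\cup(W\cap K(\gamma,+))\to\mathbb{C}$ holomorphic on $W\cap K(\gamma,+)$ with $\lambda=u$ on $W\cap\gamma^*$. $U_3(\gamma^*,k)$: the same with $K(\gamma,-)$. $U_4(\gamma^*,k)=U_2(\gamma^*,k)\cap U_3(\gamma^*,k)$. $U_5(\gamma^*,k)$: the $u\in C^k(\gamma^* )$ for which there exist no $z_0\in\gamma^*$,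 $r>0$ and holomorphic $f$ on the open disk $D(z_0,r)$ with $f=u$ on $D(z_0,r)\cap\gamma^*$. *)

(* Defs.v *)
From Stdlib Require Import Reals Lra.
Open Scope R_scope.

Definition CC : Type := (R * R)%type.
Definition Cre (z : CC) : R := fst z.
Definition Cim (z : CC) : R := snd z.
Definition Cof (x : R) : CC := (x, 0).
Definition Cadd (z w : CC) : CC := (fst z + fst w, snd z + snd w).
Definition Csub (z w : CC) : CC := (fst z - fst w, snd z - snd w).
Definition Cmul (z w : CC) : CC :=
  (fst z * fst w - snd z * snd w, fst z * snd w + snd z * fst w).
Definition Cnorm (z : CC) : R := sqrt (fst z * fst z + snd z * snd z).

Definition Copen (U : CC -> Prop) : Prop :=
  forall z, U z -> exists r, 0 < r /\ forall w, Cnorm (Csub w z) < r -> U w.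

Definition Cconnected (W : CC -> Prop) : Prop :=
  exists z0, W z0 /\
  ~ (exists A B : CC -> Prop, Copen A /\ Copen B /\
       (forall z, W z -> A z \/ B z) /\
       (forall z, W z -> A z -> B z -> False) /\
       (exists z, W z /\ A z) /\ (exists z, W z /\ B z)).

Definition disk (z0 : CC) (r : R) (z : CC) : Prop := Cnorm (Csub z z0) < r.

Definition holo_on (U : CC -> Prop) (f : CC -> CC) : Prop :=
  forall z, U z -> exists l : CC, forall eps, 0 < eps -> exists delta, 0 < delta /\
    forall h, Cnorm h < delta -> U (Cadd z h) ->
      Cnorm (Csub (Csub (f (Cadd z h)) (f z)) (Cmul l h)) <= eps * Cnorm h.

Definition cont_on (D : CC -> Prop) (f : CC -> CC) : Prop :=
  forall z, D z -> forall eps, 0 < eps -> exists delta, 0 < delta /\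
    forall w, D w -> Cnorm (Csub w z) < delta -> Cnorm (Csub (f w) (f z)) < eps.

Definition analytic_curve_data (a b : R) (gamma : R -> CC) (V : CC -> Prop) (F : CC -> CC) : Prop :=
  a < b /\ Copen V /\ (forall t, a <= t <= b -> V (Cof t)) /\ holo_on V F /\
  (forall z w, V z -> V w -> F z = F w -> z = w) /\
  (forall t, a <= t <= b -> F (Cof t) = gamma t) /\
  (forall s t, a <= s <= b -> a <= t <= b -> gamma s = gamma t -> s = t).

Definition curve_img (a b : R) (gamma : R -> CC) (z : CC) : Prop :=
  exists t, a <= t <= b /\ gamma t = z.

Definition Kplus (V : CC -> Prop) (F : CC -> CC) (z : CC) : Prop :=
  exists w, V w /\ Cim w > 0 /\ F w = z.
Definition Kminus (V : CC -> Prop) (F : CC -> CC) (z : CC) : Prop :=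
  exists w, V w /\ Cim w < 0 /\ F w = z.

Inductive kreg : Type := kfin (n : nat) | kinf.
Definition le_k (l : nat) (k : kreg) : Prop :=
  match k with kfin n => (l <= n)%nat | kinf => True end.

Definition has_deriv_ab (a b : R) (g g' : R -> CC) : Prop :=
  forall t, a <= t <= b -> forall eps, 0 < eps -> exists delta, 0 < delta /\
    forall s, a <= s <= b -> Rabs (s - t) < delta ->
      Cnorm (Csub (Csub (g s) (g t)) (Cmul (Cof (s - t)) (g' t))) <= eps * Rabs (s - t).

Definition cont_ab (a b : R) (g : R -> CC) : Prop :=
  forall t, a <= t <= b -> forall eps, 0 < eps -> exists delta, 0 < delta /\
    forall s, a <= s <= b -> Rabs (s - t) < delta -> Cnorm (Csub (g s) (g t)) < eps.

Definition Ck_tower (a b : R) (k : kreg) (g : R -> CC) (D : nat -> R -> CC) : Prop :=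
  (forall t, a <= t <= b -> D 0%nat t = g t) /\
  (forall l, le_k (S l) k -> has_deriv_ab a b (D l) (D (S l))) /\
  (forall l, le_k l k -> cont_ab a b (D l)).

(* u : gamma^star -> CC, represented by a total function CC -> CC (values off gamma^* irrelevant) *)
Definition Ck_curve (a b : R) (gamma : R -> CC) (k : kreg) (u : CC -> CC) : Prop :=
  exists D, Ck_tower a b k (fun t => u (gamma t)) D.

Definition Ck_near (a b : R) (gamma : R -> CC) (k : kreg) (N : nat) (eps : R) (u v : CC -> CC) : Prop :=
  exists D, Ck_tower a b k (fun t => Csub (v (gamma t)) (u (gamma t))) D /\
    forall l, (l <= N)%nat -> forall t, a <= t <= b -> Cnorm (D l t) <= eps.

(* open sets of the Frechet topology of CC^k(gamma^star) given by the seminorms *)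
Definition Ck_open (a b : R) (gamma : R -> CC) (k : kreg) (O : (CC -> CC) -> Prop) : Prop :=
  forall u, Ck_curve a b gamma k u -> O u ->
    exists N eps, le_k N k /\ 0 < eps /\
      forall v, Ck_curve a b gamma k v -> Ck_near a b gamma k N eps u v -> O v.

Definition Ck_dense (a b : R) (gamma : R -> CC) (k : kreg) (S : (CC -> CC) -> Prop) : Prop :=
  forall O, Ck_open a b gamma k O ->
    (exists u, Ck_curve a b gamma k u /\ O u) -> exists v, S v /\ O v.

Definition Ck_Gdelta (a b : R) (gamma : R -> CC) (k : kreg) (S : (CC -> CC) -> Prop) : Prop :=
  (forall u, S u -> Ck_curve a b gamma k u) /\
  exists O : nat -> (CC -> CC) -> Prop, (forall n, Ck_open a b gamma k (O n)) /\
    forall u, Ck_curve a b gamma k u -> (S u <-> forall n, O n u).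

Definition dense_Gdelta a b gamma k S := Ck_dense a b gamma k S /\ Ck_Gdelta a b gamma k S.

Definition extends_to_side (a b : R) (gamma : R -> CC) (K : CC -> Prop) (u : CC -> CC) : Prop :=
  exists W : CC -> Prop, Copen W /\ Cconnected W /\
    (exists z, W z /\ curve_img a b gamma z) /\
    exists lam : CC -> CC,
      cont_on (fun z => curve_img a b gamma z \/ (W z /\ K z)) lam /\
      holo_on (fun z => W z /\ K z) lam /\
      (forall z, W z -> curve_img a b gamma z -> lam z = u z).

Definition U2 a b gamma V F k (u : CC -> CC) : Prop :=
  Ck_curve a b gamma k u /\ ~ extends_to_side a b gamma (Kplus V F) u.
Definition U3 a b gamma V F k (u : CC -> CC) : Prop :=
  Ck_curve a b gamma k u /\ ~ extends_to_side a b gamma (Kminus V F) u.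
Definition U4 a b gamma V F k (u : CC -> CC) : Prop :=
  U2 a b gamma V F k u /\ U3 a b gamma V F k u.
Definition U5 a b gamma k (u : CC -> CC) : Prop :=
  Ck_curve a b gamma k u /\
  ~ (exists z0 r f, curve_img a b gamma z0 /\ 0 < r /\ holo_on (disk z0 r) f /\
       forall z, disk z0 r z -> curve_img a b gamma z -> f z = u z).

(* Main.v *)
(** The complement of each class is a countable union, over discs D centred at a countable
    dense set of points of the curve and over bounds M, of the sets of u that extend to D (or
    to its part on one side of the curve) with modulus at most M. In the parameter plane a
    two-constants estimate shows that extensions bounded by M depend uniformly continuously on
    their values on the curve, so that, by Weierstrass' theorem, every uniform limit of
    functions of such a set still extends to a smaller disc. Hence the complements of the
    closures of these sets give the G_delta property.

    For the density of U_4 (which is contained in the other classes) no completeness is needed: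
    if h is smooth and extends to no side anywhere, then on each disc at most one of the
    functions u + e h extends, so that all but countably many e give elements of U_4. One
    can take h(gamma(t)) = sum_n exp(-2^n) cos(4^n t): a one-sided extension would, by a
    contour shift, make the integrals of h(gamma(t)) exp(-N (t - t1)^2) cos(N t) decay
    exponentially in N, but for N = 4^n they are of size at least exp(-sqrt N) / sqrt N.

    All complex analysis is derived from Goursat's theorem for rectangles. Functions given on
    a closed rectangle are extended to the plane by clamping the coordinates, which preserves
    continuity, so that all integrals exist. *)
Require Import Defs.
From Stdlib Require Import Reals Lra Lia Psatz ClassicalEpsilon Cantor
  FunctionalExtensionality PropExtensionality.
From Coquelicot Require Import Coquelicot.
Open Scope R_scope.

(** * Complex differentiability *)

(** Fixing the bound M takes the place of a normal-family argument: two extensions are compared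
    directly, so approximating extensions are uniformly Cauchy near a curve point and no subsequence
    is extracted. The price is a smaller disc, which is harmless since the classes forbid extensions
    to every disc. The numbers 2^n and 4^n give amplitude exp(-sqrt N) at frequency N = 4^n. This
    decays faster than every power of N, so a single h is smooth and serves every k, and slower than
    every exp(-c N), the decay that an extension would force. Each amplitude is the square of the
    preceding one, so higher terms cannot hide the peak at N, while the lower frequencies are at
    most N/4. Both sides of the curve are reduced to the upper half-plane by z -> t1 + z and z -> t1
    - z. The second map is holomorphic but reverses the parameter, hence the choice of an even h.
    The maximum principle is proved for continuous functions that may fail to be holomorphic at
    isolated points. Difference quotients are such functions, and this yields derivative bounds and
    Weierstrass' theorem without Cauchy's formula. *)

Definition ccont_at (f : C -> C) (z : C) : Prop :=
  forall eps, 0 < eps -> exists delta, 0 < delta /\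
    forall w, Cmod (w - z) < delta -> Cmod (f w - f z) < eps.

Definition ccont (f : C -> C) : Prop := forall z, ccont_at f z.

Definition cdiff_at (f : C -> C) (z l : C) : Prop :=
  forall eps, 0 < eps -> exists delta, 0 < delta /\
    forall h, Cmod h < delta -> Cmod (f (z + h) - f z - l * h)%C <= eps * Cmod h.

Definition holo_at (f : C -> C) (z : C) : Prop := exists l, cdiff_at f z l.

Lemma choice {A B : Type} (P : A -> B -> Prop) :
  (forall x, exists y, P x y) -> exists f, forall x, P x (f x).
Proof.
  intros H; exists (fun x => proj1_sig (constructive_indefinite_description _ (H x))).
  intros x; apply proj2_sig.
Qed.

Lemma Cnorm_Cmod (z : C) : Cnorm z = Cmod z.
Proof. unfold Cnorm, Cmod; f_equal; ring. Qed.

Lemma Cmod_sub_sym (z w : C) : Cmod (z - w) = Cmod (w - z).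
Proof. rewrite <- Cmod_opp; f_equal; ring. Qed.

Lemma Cminus_diag (z : C) : (z - z)%C = RtoC 0.
Proof. ring. Qed.

Lemma fst_le_Cmod (z : C) : Rabs (fst z) <= Cmod z.
Proof. exact (Rle_trans _ _ _ (Rmax_l _ _) (Rmax_Cmod z)). Qed.

Lemma snd_le_Cmod (z : C) : Rabs (snd z) <= Cmod z.
Proof. exact (Rle_trans _ _ _ (Rmax_r _ _) (Rmax_Cmod z)). Qed.

Lemma Cmod_le_sum (z : C) : Cmod z <= Rabs (fst z) + Rabs (snd z).
Proof.
  destruct z as [x y]; unfold Cmod; simpl.
  pose proof (Rabs_pos x); pose proof (Rabs_pos y).
  apply Rsqr_incr_0_var; [|lra].
  rewrite Rsqr_sqrt by nra.
  unfold Rsqr.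
  pose proof (Rsqr_abs x); pose proof (Rsqr_abs y); unfold Rsqr in *; nra.
Qed.

Lemma Cmod_sub_triangle (x y z : C) : Cmod (x - z) <= Cmod (x - y) + Cmod (y - z).
Proof. replace (x - z)%C with ((x - y) + (y - z))%C by ring; apply Cmod_triangle. Qed.

Lemma Cmod_triangle_sub (x y : C) : Cmod (x - y) <= Cmod x + Cmod y.
Proof.
  replace (x - y)%C with (x + (- y))%C by ring.
  rewrite <- (Cmod_opp y); apply Cmod_triangle.
Qed.

Lemma Cmod_le_sub (x y : C) : Cmod x <= Cmod (x - y) + Cmod y.
Proof. replace x with ((x - y) + y)%C at 1 by ring; apply Cmod_triangle. Qed.

Lemma Cmod_zero_eq (z w : C) : Cmod (z - w) <= 0 -> z = w.
Proof.
  intros H; assert (E : (z - w)%C = 0).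
  { apply Cmod_eq_0; pose proof (Cmod_ge_0 (z - w)); lra. }
  replace z with ((z - w) + w)%C by ring; rewrite E; ring.
Qed.

Lemma cdiff_ccont f z l : cdiff_at f z l -> ccont_at f z.
Proof.
  intros H eps He.
  destruct (H 1 Rlt_0_1) as (d & Hd & HH).
  pose proof (Cmod_ge_0 l).
  exists (Rmin d (eps / (2 + Cmod l))); split.
  { apply Rmin_pos; [lra|]; apply Rdiv_lt_0_compat; lra. }
  intros w Hw.
  assert (H1 := Rlt_le_trans _ _ _ Hw (Rmin_l _ _)).
  assert (H2 := Rlt_le_trans _ _ _ Hw (Rmin_r _ _)).
  specialize (HH _ H1).
  replace (z + (w - z))%C with w in HH by ring.
  replace (f w - f z)%C with ((f w - f z - l * (w - z)) + l * (w - z))%C by ring.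
  eapply Rle_lt_trans; [apply Cmod_triangle|].
  rewrite (Cmod_mult l).
  apply (Rmult_lt_compat_r (2 + Cmod l)) in H2; [|lra].
  unfold Rdiv in H2; rewrite Rmult_assoc, Rinv_l, Rmult_1_r in H2 by lra.
  pose proof (Cmod_ge_0 (w - z)). nra.
Qed.

Lemma holo_ccont f z : holo_at f z -> ccont_at f z.
Proof. intros [l H]; exact (cdiff_ccont _ _ _ H). Qed.

Lemma ccont_at_const c z : ccont_at (fun _ => c) z.
Proof.
  intros eps He; exists 1; split; [lra|]; intros w _.
  replace (c - c)%C with (RtoC 0) by ring; rewrite Cmod_0; exact He.
Qed.

Lemma ccont_at_id z : ccont_at (fun w => w) z.
Proof. intros eps He; exists eps; split; auto. Qed.

Lemma ccont_at_plus f g z : ccont_at f z -> ccont_at g z -> ccont_at (fun w => f w + g w)%C z.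
Proof.
  intros Hf Hg eps He.
  destruct (Hf (eps / 2)) as (d1 & Hd1 & H1); [lra|].
  destruct (Hg (eps / 2)) as (d2 & Hd2 & H2); [lra|].
  exists (Rmin d1 d2); split; [now apply Rmin_pos|]; intros w Hw.
  specialize (H1 w (Rlt_le_trans _ _ _ Hw (Rmin_l _ _))).
  specialize (H2 w (Rlt_le_trans _ _ _ Hw (Rmin_r _ _))).
  replace (f w + g w - (f z + g z))%C with ((f w - f z) + (g w - g z))%C by ring.
  eapply Rle_lt_trans; [apply Cmod_triangle|]; lra.
Qed.

Lemma ccont_at_mult f g z : ccont_at f z -> ccont_at g z -> ccont_at (fun w => f w * g w)%C z.
Proof.
  intros Hf Hg eps He.
  pose proof (Cmod_ge_0 (f z)) as Pf; pose proof (Cmod_ge_0 (g z)) as Pg.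
  set (K := 1 + Cmod (f z) + Cmod (g z)).
  assert (HK : 0 < K) by (unfold K; lra).
  assert (HeK : 0 < Rmin 1 (eps / (2 * K))).
  { apply Rmin_pos; [lra|]; apply Rdiv_lt_0_compat; lra. }
  destruct (Hf _ HeK) as (d1 & Hd1 & H1).
  destruct (Hg _ HeK) as (d2 & Hd2 & H2).
  exists (Rmin d1 d2); split; [now apply Rmin_pos|]; intros w Hw.
  specialize (H1 w (Rlt_le_trans _ _ _ Hw (Rmin_l _ _))).
  specialize (H2 w (Rlt_le_trans _ _ _ Hw (Rmin_r _ _))).
  replace (f w * g w - f z * g z)%C
    with ((f w - f z) * (g w - g z) + ((f w - f z) * g z + f z * (g w - g z)))%C by ring.
  eapply Rle_lt_trans; [apply Cmod_triangle|].
  eapply Rle_lt_trans; [apply Rplus_le_compat_l, Cmod_triangle|].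
  rewrite !Cmod_mult.
  set (m := Rmin 1 (eps / (2 * K))) in *.
  assert (Hm1 : m <= 1) by apply Rmin_l.
  assert (Hm2 : m * K <= eps / 2).
  { assert (m <= eps / (2 * K)) by apply Rmin_r.
    apply (Rmult_le_compat_r K) in H; [|lra].
    replace (eps / (2 * K) * K) with (eps / 2) in H by (field; lra); exact H. }
  pose proof (Cmod_ge_0 (f w - f z)); pose proof (Cmod_ge_0 (g w - g z)).
  assert (Cmod (f w - f z) * Cmod (g w - g z) <= m * 1)
    by (apply Rmult_le_compat; lra).
  assert (Cmod (f w - f z) * Cmod (g z) <= m * Cmod (g z))
    by (apply Rmult_le_compat_r; lra).
  assert (Cmod (f z) * Cmod (g w - g z) <= Cmod (f z) * m)
    by (apply Rmult_le_compat_l; lra).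
  unfold K in Hm2; lra.
Qed.

Lemma ccont_at_opp f z : ccont_at f z -> ccont_at (fun w => - f w)%C z.
Proof.
  intros Hf eps He; destruct (Hf _ He) as (d & Hd & H).
  exists d; split; auto; intros w Hw.
  replace (- f w - - f z)%C with (- (f w - f z))%C by ring.
  rewrite Cmod_opp; auto.
Qed.

Lemma ccont_at_minus f g z : ccont_at f z -> ccont_at g z -> ccont_at (fun w => f w - g w)%C z.
Proof. intros Hf Hg; apply ccont_at_plus; auto; now apply ccont_at_opp. Qed.

Lemma ccont_at_comp f g z : ccont_at g z -> ccont_at f (g z) -> ccont_at (fun w => f (g w)) z.
Proof.
  intros Hg Hf eps He.
  destruct (Hf _ He) as (d & Hd & H).
  destruct (Hg _ Hd) as (d' & Hd' & H').
  exists d'; split; auto.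
Qed.

Lemma Cmod_pos_neq (z : C) : z <> RtoC 0 -> 0 < Cmod z.
Proof. apply Cmod_gt_0. Qed.

Lemma ccont_at_inv z : z <> RtoC 0 -> ccont_at Cinv z.
Proof.
  intros Hz eps He.
  pose proof (Cmod_pos_neq _ Hz) as P.
  exists (Rmin (Cmod z / 2) (eps * (Cmod z * Cmod z) / 2)); split.
  { apply Rmin_pos; [lra|]. apply Rdiv_lt_0_compat; [|lra]. apply Rmult_lt_0_compat; nra. }
  intros w Hw.
  assert (H1 := Rlt_le_trans _ _ _ Hw (Rmin_l _ _)).
  assert (H2 := Rlt_le_trans _ _ _ Hw (Rmin_r _ _)).
  assert (Hw' : Cmod z / 2 < Cmod w).
  { pose proof (Cmod_le_sub z w). rewrite Cmod_sub_sym in H. lra. }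
  assert (Hw0 : w <> RtoC 0) by (apply Cmod_gt_0; lra).
  replace (/ w - / z)%C with ((z - w) / (w * z))%C by (field; auto).
  rewrite Cmod_div, Cmod_mult by (now apply Cmult_neq_0).
  rewrite Cmod_sub_sym.
  apply (Rmult_lt_reg_r (Cmod w * Cmod z)); [nra|].
  unfold Rdiv; rewrite Rmult_assoc, Rinv_l, Rmult_1_r by nra.
  eapply Rlt_le_trans; [exact H2|].
  assert (eps * (Cmod z / 2 * Cmod z) <= eps * (Cmod w * Cmod z)).
  { apply Rmult_le_compat_l; [lra|]; apply Rmult_le_compat_r; lra. }
  lra.
Qed.

Lemma cdiff_const c z : cdiff_at (fun _ => c) z 0.
Proof.
  intros eps He; exists 1; split; [lra|]; intros h _.
  replace (c - c - 0 * h)%C with (RtoC 0) by ring; rewrite Cmod_0.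
  pose proof (Cmod_ge_0 h); nra.
Qed.

Lemma cdiff_id z : cdiff_at (fun w => w) z 1.
Proof.
  intros eps He; exists 1; split; [lra|]; intros h _.
  replace (z + h - z - 1 * h)%C with (RtoC 0) by ring; rewrite Cmod_0.
  pose proof (Cmod_ge_0 h); nra.
Qed.

Lemma cdiff_plus f g z l m :
  cdiff_at f z l -> cdiff_at g z m -> cdiff_at (fun w => f w + g w)%C z (l + m).
Proof.
  intros Hf Hg eps He.
  destruct (Hf (eps / 2)) as (d1 & Hd1 & H1); [lra|].
  destruct (Hg (eps / 2)) as (d2 & Hd2 & H2); [lra|].
  exists (Rmin d1 d2); split; [now apply Rmin_pos|]; intros w Hw.
  specialize (H1 w (Rlt_le_trans _ _ _ Hw (Rmin_l _ _))).
  specialize (H2 w (Rlt_le_trans _ _ _ Hw (Rmin_r _ _))).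
  replace (f (z + w)%C + g (z + w)%C - (f z + g z) - (l + m) * w)%C
    with ((f (z + w)%C - f z - l * w) + (g (z + w)%C - g z - m * w))%C by ring.
  eapply Rle_trans; [apply Cmod_triangle|]; lra.
Qed.

Lemma cdiff_comp f g z l m :
  cdiff_at g z m -> cdiff_at f (g z) l -> cdiff_at (fun w => f (g w)) z (l * m).
Proof.
  intros Hg Hf eps He.
  pose proof (Cmod_ge_0 l) as Pl; pose proof (Cmod_ge_0 m) as Pm.
  set (e1 := eps / (2 * (Cmod m + 1))).
  assert (He1 : 0 < e1) by (apply Rdiv_lt_0_compat; lra).
  set (e2 := Rmin 1 (eps / (2 * (Cmod l + 1)))).
  assert (He2 : 0 < e2) by (apply Rmin_pos; [lra|]; apply Rdiv_lt_0_compat; lra).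
  destruct (Hf _ He1) as (d1 & Hd1 & H1).
  destruct (Hg _ He2) as (d2 & Hd2 & H2).
  destruct (cdiff_ccont _ _ _ Hg _ Hd1) as (d3 & Hd3 & H3).
  exists (Rmin d2 d3); split; [now apply Rmin_pos|]; intros h Hh.
  specialize (H2 h (Rlt_le_trans _ _ _ Hh (Rmin_l _ _))).
  assert (Hh3 := Rlt_le_trans _ _ _ Hh (Rmin_r _ _)).
  assert (K3 : Cmod (g (z + h)%C - g z) < d1).
  { apply H3; replace (z + h - z)%C with h by ring; exact Hh3. }
  specialize (H1 _ K3).
  replace (g z + (g (z + h)%C - g z))%C with (g (z + h)%C) in H1 by ring.
  set (k := (g (z + h)%C - g z)%C) in *.
  replace (f (g (z + h)%C) - f (g z) - l * m * h)%C
    with ((f (g (z + h)%C) - f (g z) - l * k) + l * (k - m * h))%C by ring.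
  eapply Rle_trans; [apply Cmod_triangle|]; rewrite (Cmod_mult l).
  pose proof (Cmod_ge_0 h) as Ph.
  assert (Kk : Cmod k <= (Cmod m + 1) * Cmod h).
  { replace k with ((k - m * h) + m * h)%C by ring.
    eapply Rle_trans; [apply Cmod_triangle|]; rewrite Cmod_mult.
    assert (e2 <= 1) by apply Rmin_l.
    assert (e2 * Cmod h <= 1 * Cmod h) by (apply Rmult_le_compat_r; lra).
    fold k in H2; lra. }
  assert (A1 : Cmod (f (g (z + h)%C) - f (g z) - l * k) <= eps / 2 * Cmod h).
  { eapply Rle_trans; [exact H1|].
    eapply Rle_trans; [apply Rmult_le_compat_l; [lra|exact Kk]|].
    right; unfold e1; field; lra. }
  assert (A2 : Cmod l * Cmod (k - m * h) <= eps / 2 * Cmod h).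
  { assert (e2 <= eps / (2 * (Cmod l + 1))) by apply Rmin_r.
    eapply Rle_trans; [apply Rmult_le_compat_l; [lra|exact H2]|].
    assert ((Cmod l + 1) * (e2 * Cmod h) <= eps / 2 * Cmod h).
    { eapply Rle_trans.
      - apply Rmult_le_compat_l; [lra|]. apply Rmult_le_compat_r; [lra|exact H].
      - right; field; lra. }
    assert (0 <= e2 * Cmod h) by nra. nra. }
  lra.
Qed.

Lemma cdiff_ext f g z l :
  (exists d, 0 < d /\ forall w, Cmod (w - z) < d -> f w = g w) ->
  cdiff_at f z l -> cdiff_at g z l.
Proof.
  intros (d & Hd & E) H eps He.
  destruct (H eps He) as (d' & Hd' & H').
  exists (Rmin d d'); split; [now apply Rmin_pos|]; intros h Hh.
  assert (H1 := Rlt_le_trans _ _ _ Hh (Rmin_l _ _)).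
  assert (H2 := Rlt_le_trans _ _ _ Hh (Rmin_r _ _)).
  rewrite <- !E; [auto| |].
  - replace (z - z)%C with (RtoC 0) by ring; rewrite Cmod_0; auto.
  - replace (z + h - z)%C with h by ring; auto.
Qed.

Lemma cdiff_sq z : cdiff_at (fun w => w * w)%C z (z + z).
Proof.
  intros eps He; exists eps; split; auto; intros h Hh.
  replace ((z + h) * (z + h) - z * z - (z + z) * h)%C with (h * h)%C by ring.
  rewrite Cmod_mult; pose proof (Cmod_ge_0 h); nra.
Qed.

Lemma cdiff_scal c f z l : cdiff_at f z l -> cdiff_at (fun w => c * f w)%C z (c * l).
Proof.
  intros H; apply (cdiff_comp (fun w => c * w)%C f); auto.
  intros eps He; exists 1; split; [lra|]; intros h _.
  replace (c * (f z + h) - c * f z - c * h)%C with (RtoC 0) by ring; rewrite Cmod_0.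
  pose proof (Cmod_ge_0 h); nra.
Qed.

(* Polarization reduces products to squares. *)
Lemma cdiff_mult f g z l m :
  cdiff_at f z l -> cdiff_at g z m ->
  cdiff_at (fun w => f w * g w)%C z (l * g z + f z * m).
Proof.
  intros Hf Hg.
  assert (Hs : cdiff_at (fun w => (f w + g w) * (f w + g w))%C z _)
    by exact (cdiff_comp (fun w => w * w)%C _ _ _ _ (cdiff_plus _ _ _ _ _ Hf Hg) (cdiff_sq _)).
  assert (Hd : cdiff_at (fun w => (f w + (-1) * g w) * (f w + (-1) * g w))%C z _)
    by exact (cdiff_comp (fun w => w * w)%C _ _ _ _
                (cdiff_plus _ _ _ _ _ Hf (cdiff_scal (-1) _ _ _ Hg)) (cdiff_sq _)).
  assert (H := cdiff_plus _ _ _ _ _ (cdiff_scal (/4) _ _ _ Hs) (cdiff_scal (-/4) _ _ _ Hd)).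
  simpl in H.
  match type of H with cdiff_at _ _ ?L =>
    replace (l * g z + f z * m)%C with L by (field; intros E; injection E; lra) end.
  revert H; apply cdiff_ext.
  exists 1; split; [lra|]; intros w _; simpl; field; intros E; injection E; lra.
Qed.

Lemma cdiff_inv z : z <> RtoC 0 -> cdiff_at Cinv z (- (/ z * / z)).
Proof.
  intros Hz eps He.
  pose proof (Cmod_pos_neq _ Hz) as P.
  set (e := eps * Cmod z).
  assert (He' : 0 < e) by (unfold e; nra).
  destruct (ccont_at_inv z Hz e He') as (d & Hd & H).
  exists (Rmin d (Cmod z / 2)); split; [apply Rmin_pos; lra|]; intros h Hh.
  assert (H1 := Rlt_le_trans _ _ _ Hh (Rmin_l _ _)).
  assert (H2 := Rlt_le_trans _ _ _ Hh (Rmin_r _ _)).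
  assert (Hw : Cmod z / 2 < Cmod (z + h)).
  { pose proof (Cmod_le_sub z (-h)%C). rewrite Cmod_opp in H0.
    replace (z - - h)%C with (z + h)%C in H0 by ring; lra. }
  assert (Hw0 : (z + h)%C <> RtoC 0) by (apply Cmod_gt_0; lra).
  replace (/ (z + h) - / z - - (/ z * / z) * h)%C
    with (- ((/ (z + h) - / z) * (h / z)))%C by (field; auto).
  rewrite Cmod_opp, Cmod_mult, Cmod_div by auto.
  specialize (H (z + h)%C). replace (z + h - z)%C with h in H by ring.
  specialize (H H1).
  apply Rle_trans with (e * (Cmod h / Cmod z)).
  - apply Rmult_le_compat_r; [|lra].
    apply Rmult_le_pos; [apply Cmod_ge_0|]; left; now apply Rinv_0_lt_compat.
  - right; unfold e; field; lra.
Qed.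

Lemma holo_ext f g z :
  (exists d, 0 < d /\ forall w, Cmod (w - z) < d -> f w = g w) -> holo_at f z -> holo_at g z.
Proof. intros E [l H]; exists l; revert H; apply cdiff_ext; auto. Qed.

Lemma holo_const c z : holo_at (fun _ => c) z.
Proof. eexists; apply cdiff_const. Qed.

Lemma holo_id z : holo_at (fun w => w) z.
Proof. eexists; apply cdiff_id. Qed.

Lemma holo_plus f g z : holo_at f z -> holo_at g z -> holo_at (fun w => f w + g w)%C z.
Proof. intros [l Hl] [m Hm]; eexists; apply cdiff_plus; eauto. Qed.

Lemma holo_mult f g z : holo_at f z -> holo_at g z -> holo_at (fun w => f w * g w)%C z.
Proof. intros [l Hl] [m Hm]; eexists; apply cdiff_mult; eauto. Qed.

Lemma holo_minus f g z : holo_at f z -> holo_at g z -> holo_at (fun w => f w - g w)%C z.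
Proof.
  intros Hf Hg; apply (holo_ext (fun w => f w + (-1) * g w)%C).
  - exists 1; split; [lra|]; intros; ring.
  - apply holo_plus; auto; apply holo_mult; auto; apply holo_const.
Qed.

Lemma holo_comp f g z : holo_at g z -> holo_at f (g z) -> holo_at (fun w => f (g w)) z.
Proof. intros [l Hl] [m Hm]; eexists; apply (cdiff_comp f g); eauto. Qed.

Lemma holo_inv f z : holo_at f z -> f z <> RtoC 0 -> holo_at (fun w => / f w)%C z.
Proof. intros Hf Hz; apply (holo_comp Cinv f); auto; eexists; now apply cdiff_inv. Qed.

(** * Bisection and Goursat's theorem *)

(** The last quarter is returned untested: if [P] fails on the whole rectangle and holds on the
    other three quarters, it must fail there. *)
Definition bad_quarter (A B : R) (P : R -> R -> R -> Prop) (q : R * R) (s : R) : R * R :=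
  let (x, y) := q in
  if excluded_middle_informative (P x y (s / 2)) then
    if excluded_middle_informative (P (x + A * (s / 2)) y (s / 2)) then
      if excluded_middle_informative (P x (y + B * (s / 2)) (s / 2)) then
        (x + A * (s / 2), y + B * (s / 2))
      else (x, y + B * (s / 2))
    else (x + A * (s / 2), y)
  else (x, y).

Fixpoint bad_corner (A B : R) (P : R -> R -> R -> Prop) (q : R * R) (n : nat) : R * R :=
  match n with
  | O => q
  | S m => bad_quarter A B P (bad_corner A B P q m) ((/ 2) ^ m)
  end.

(* Equalities between integrals are typed in Coquelicot's R_CompleteNormedModule, which [ring]
   does not recognise. *)
Ltac Rring := lazymatch goal with |- @eq _ ?a ?b => change (@eq R a b) end; ring.

Lemma half_pow_pos n : 0 < (/ 2) ^ n.
Proof. apply pow_lt; lra. Qed.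

Lemma half_pow_small eps : 0 < eps -> exists n, (/ 2) ^ n < eps.
Proof.
  intros He; destruct (pow_lt_1_zero (/ 2)) with (y := eps) as [n Hn]; auto.
  - rewrite Rabs_pos_eq; lra.
  - exists n; specialize (Hn n (le_n n)).
    rewrite Rabs_pos_eq in Hn; auto; left; apply half_pow_pos.
Qed.

(** A compactness principle shared by Goursat's theorem and the existence of maxima: otherwise
    nested failing rectangles shrink to a point, where the local hypothesis is contradicted. A
    rectangle is given by its lower left corner and a scale s, with sides A s and B s, so quartering
    halves s and keeps the shape. *)
Lemma bisection (A B : R) (P : R -> R -> R -> Prop) x0 y0 :
  0 < A -> 0 < B ->
  (forall x y s, 0 < s -> P x y (s / 2) -> P (x + A * (s / 2)) y (s / 2) ->
     P x (y + B * (s / 2)) (s / 2) -> P (x + A * (s / 2)) (y + B * (s / 2)) (s / 2) ->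
     P x y s) ->
  (forall u v, x0 <= u <= x0 + A -> y0 <= v <= y0 + B ->
     exists delta, 0 < delta /\ forall x y s, 0 < s < delta ->
       x <= u <= x + A * s -> y <= v <= y + B * s -> P x y s) ->
  P x0 y0 1.
Proof.
  intros HA HB Hsub Hloc.
  apply NNPP; intros Hbad.
  set (q := bad_corner A B P (x0, y0)).
  set (s := fun n => (/ 2) ^ n).
  assert (Hq : forall n, ~ P (fst (q n)) (snd (q n)) (s n)).
  { induction n as [|n IH]; [exact Hbad|].
    unfold q, s in *; simpl.
    replace (/ 2 * (/ 2) ^ n) with ((/ 2) ^ n / 2) by field.
    destruct (bad_corner A B P (x0, y0) n) as [x y]; simpl in *.
    repeat (destruct excluded_middle_informative; simpl; auto).
    intros H; apply IH, Hsub; auto; apply half_pow_pos. }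
  assert (Hstep : forall n, fst (q n) <= fst (q (S n)) /\
     fst (q (S n)) + A * s (S n) <= fst (q n) + A * s n /\
     snd (q n) <= snd (q (S n)) /\
     snd (q (S n)) + B * s (S n) <= snd (q n) + B * s n).
  { intros n; unfold q, s; simpl.
    pose proof (half_pow_pos n).
    assert (0 < A * (/ 2) ^ n) by now apply Rmult_lt_0_compat.
    assert (0 < B * (/ 2) ^ n) by now apply Rmult_lt_0_compat.
    destruct (bad_corner A B P (x0, y0) n) as [x y]; simpl.
    repeat (destruct excluded_middle_informative; simpl); lra. }
  assert (Hmono : forall n m, (n <= m)%nat -> fst (q n) <= fst (q m) /\
     fst (q m) + A * s m <= fst (q n) + A * s n /\
     snd (q n) <= snd (q m) /\
     snd (q m) + B * s m <= snd (q n) + B * s n).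
  { intros n m Hnm; induction Hnm as [|m Hnm IH]; [lra|].
    specialize (Hstep m); lra. }
  assert (Hs : forall n, 0 < s n) by (intros; apply half_pow_pos).
  assert (HAs : forall n, 0 < A * s n) by (intros; now apply Rmult_lt_0_compat).
  assert (HBs : forall n, 0 < B * s n) by (intros; now apply Rmult_lt_0_compat).
  assert (Hlt1 : forall n m, fst (q n) <= fst (q m) + A * s m).
  { intros n m; destruct (Nat.le_ge_cases n m) as [H|H]; destruct (Hmono _ _ H);
      pose proof (HAs m); pose proof (HAs n); lra. }
  assert (Hlt2 : forall n m, snd (q n) <= snd (q m) + B * s m).
  { intros n m; destruct (Nat.le_ge_cases n m) as [H|H]; destruct (Hmono _ _ H) as (_&_&?&?);
      pose proof (HBs m); pose proof (HBs n); lra. }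
  destruct (completeness (fun r => exists n, r = fst (q n))) as [u [Hu1 Hu2]].
  { exists (fst (q O) + A * s O); intros r [n ->]; apply Hlt1. }
  { exists (fst (q O)), O; reflexivity. }
  destruct (completeness (fun r => exists n, r = snd (q n))) as [v [Hv1 Hv2]].
  { exists (snd (q O) + B * s O); intros r [n ->]; apply Hlt2. }
  { exists (snd (q O)), O; reflexivity. }
  assert (Hu : forall n, fst (q n) <= u <= fst (q n) + A * s n).
  { intros n; split; [apply Hu1; now exists n|].
    apply Hu2; intros r [m ->]; apply Hlt1. }
  assert (Hv : forall n, snd (q n) <= v <= snd (q n) + B * s n).
  { intros n; split; [apply Hv1; now exists n|].
    apply Hv2; intros r [m ->]; apply Hlt2. }
  destruct (Hloc u v) as (d & Hd & HH).
  { specialize (Hu O); unfold s in Hu; simpl in Hu; lra. }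
  { specialize (Hv O); unfold s in Hv; simpl in Hv; lra. }
  destruct (half_pow_small d Hd) as [n Hn].
  apply (Hq n), HH; auto.
Qed.

Definition in_rect (x0 x1 y0 y1 : R) (z : C) : Prop := x0 <= fst z <= x1 /\ y0 <= snd z <= y1.

Lemma rect_diam (x y a b : R) (z w : C) :
  in_rect x (x + a) y (y + b) z -> in_rect x (x + a) y (y + b) w -> Cmod (z - w) <= a + b.
Proof.
  intros [H1 H2] [H3 H4]; eapply Rle_trans; [apply Cmod_le_sum|]; simpl.
  apply Rplus_le_compat; apply Rabs_le; lra.
Qed.

Definition rcont_at (u : C -> R) (z : C) : Prop :=
  forall eps, 0 < eps -> exists delta, 0 < delta /\
    forall w, Cmod (w - z) < delta -> Rabs (u w - u z) < eps.

(** If no maximum is attained, each point of K is strictly beaten by one fixed point of K on a whole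
    neighbourhood, and a point off K has a neighbourhood free of K. Bisection makes one point of K
    beat all of K strictly, itself included. *)
Lemma max_attained (K : C -> Prop) (u : C -> R) x0 x1 y0 y1 :
  x0 < x1 -> y0 < y1 ->
  (forall z, K z -> in_rect x0 x1 y0 y1 z) ->
  Copen (fun z => ~ K z) ->
  (exists z, K z) ->
  (forall z, K z -> rcont_at u z) ->
  exists z, K z /\ forall w, K w -> u w <= u z.
Proof.
  intros Hx Hy Hin Hcl [k0 Hk0] Hc.
  apply NNPP; intros Hno.
  assert (Hno' : forall z, K z -> exists w, K w /\ u z < u w).
  { intros z Hz; apply NNPP; intros H; apply Hno; exists z; split; auto.
    intros w Hw; apply Rnot_lt_le; intros L; apply H; now exists w. }
  assert (HP : exists z, K z /\ forall w, K w ->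
    in_rect x0 (x0 + (x1 - x0) * 1) y0 (y0 + (y1 - y0) * 1) w -> u w < u z).
  { apply (bisection (x1 - x0) (y1 - y0)
      (fun x y s => exists z, K z /\ forall w, K w ->
        in_rect x (x + (x1 - x0) * s) y (y + (y1 - y0) * s) w -> u w < u z)); try lra.
    - intros x y s Hs (z1 & K1 & H1) (z2 & K2 & H2) (z3 & K3 & H3) (z4 & K4 & H4).
      assert (E : exists z, K z /\ u z1 <= u z /\ u z2 <= u z /\ u z3 <= u z /\ u z4 <= u z).
      { assert (two : forall a b, K a -> K b -> exists z, K z /\ u a <= u z /\ u b <= u z).
        { intros a b Ha Hb; destruct (Rle_dec (u a) (u b));
            [exists b|exists a]; repeat split; auto; lra. }
        destruct (two z1 z2 K1 K2) as (a & Ka & ?); destruct (two z3 z4 K3 K4) as (b & Kb & ?).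
        destruct (two a b Ka Kb) as (z & Kz & ?); exists z; repeat split; auto; lra. }
      destruct E as (z & Kz & L1 & L2 & L3 & L4); exists z; split; auto.
      intros w Kw [Hw1 Hw2].
      destruct (Rle_dec (fst w) (x + (x1 - x0) * (s / 2)));
      destruct (Rle_dec (snd w) (y + (y1 - y0) * (s / 2))).
      + eapply Rlt_le_trans; [apply H1|]; auto; split; lra.
      + eapply Rlt_le_trans; [apply H3|]; auto; split; lra.
      + eapply Rlt_le_trans; [apply H2|]; auto; split; lra.
      + eapply Rlt_le_trans; [apply H4|]; auto; split; lra.
    - intros a b Ha Hb.
      assert (small : forall d, 0 < d -> exists d', 0 < d' /\ forall x y s, 0 < s < d' ->
        x <= a <= x + (x1 - x0) * s -> y <= b <= y + (y1 - y0) * s ->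
        forall w, in_rect x (x + (x1 - x0) * s) y (y + (y1 - y0) * s) w ->
        Cmod (w - (a, b)) < d).
      { intros d Hd; exists (d / ((x1 - x0) + (y1 - y0))).
        split; [apply Rdiv_lt_0_compat; lra|].
        intros x y s [Hs1 Hs2] H1 H2 w Hw.
        eapply Rle_lt_trans; [apply (rect_diam x y ((x1 - x0) * s) ((y1 - y0) * s)); auto; split; auto|].
        apply (Rmult_lt_compat_r ((x1 - x0) + (y1 - y0))) in Hs2; [|lra].
        unfold Rdiv in Hs2; rewrite Rmult_assoc, Rinv_l in Hs2; lra. }
      destruct (classic (K (a, b))) as [Kz|Kz].
      + destruct (Hno' _ Kz) as (z' & Kz' & L).
        destruct (Hc _ Kz (u z' - u (a, b))) as (d & Hd & H); [lra|].
        destruct (small d Hd) as (d' & Hd' & H').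
        exists d'; split; auto; intros x y s Hs H1 H2; exists z'; split; auto.
        intros w Kw Hw; specialize (H w (H' _ _ _ Hs H1 H2 _ Hw)).
        apply Rabs_def2 in H; lra.
      + destruct (Hcl _ Kz) as (d & Hd & H).
        destruct (small d Hd) as (d' & Hd' & H').
        exists d'; split; auto; intros x y s Hs H1 H2; exists k0; split; auto.
        intros w Kw Hw; exfalso; apply (H w); auto.
        specialize (H' _ _ _ Hs H1 H2 _ Hw).
        rewrite Cnorm_Cmod; exact H'. }
  destruct HP as (z & Kz & H).
  specialize (H z Kz); apply Hin in Kz as Hz; unfold in_rect in *.
  apply (Rlt_irrefl (u z)), H; lra.
Qed.

(* The contour integral of P dx + Q dy along the boundary of a rectangle. *)
Definition contour (P Q : R -> R -> R) (x0 x1 y0 y1 : R) : R :=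
  RInt (fun t => P t y0 - P t y1) x0 x1 + RInt (fun t => Q x1 t - Q x0 t) y0 y1.

Definition cont2 (P : R -> R -> R) : Prop := forall x y, continuity_2d_pt P x y.

Lemma cont2_h P y x : cont2 P -> continuous (fun t => P t y) x.
Proof.
  intros H; apply continuity_pt_filterlim, continuity_pt_locally; intros eps.
  destruct (H x y eps) as [d Hd]; exists d; intros w Hw; apply Hd; auto.
  rewrite Rminus_diag, Rabs_R0; apply cond_pos.
Qed.

Lemma cont2_v P x y : cont2 P -> continuous (fun t => P x t) y.
Proof.
  intros H; apply continuity_pt_filterlim, continuity_pt_locally; intros eps.
  destruct (H x y eps) as [d Hd]; exists d; intros w Hw; apply Hd; auto.
  rewrite Rminus_diag, Rabs_R0; apply cond_pos.
Qed.

Lemma ex_RInt_cont (f : R -> R) a b : (forall x, continuous f x) -> ex_RInt f a b.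
Proof. intros H; apply (ex_RInt_continuous (V := R_CompleteNormedModule)); auto. Qed.

Lemma RInt_split (f : R -> R) a b c :
  (forall x, continuous f x) -> RInt f a c = RInt f a b + RInt f b c.
Proof.
  intros H; symmetry; apply (RInt_Chasles (V := R_CompleteNormedModule));
    now apply ex_RInt_cont.
Qed.

Lemma RInt_minus_R (f g : R -> R) a b :
  (forall x, continuous f x) -> (forall x, continuous g x) ->
  RInt (fun x => f x - g x) a b = RInt f a b - RInt g a b.
Proof.
  intros Hf Hg; apply (RInt_minus (V := R_CompleteNormedModule)); now apply ex_RInt_cont.
Qed.

Lemma contour_split P Q x0 x1 y0 y1 xm ym :
  cont2 P -> cont2 Q ->
  contour P Q x0 x1 y0 y1 =
    contour P Q x0 xm y0 ym + contour P Q xm x1 y0 ym +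
    contour P Q x0 xm ym y1 + contour P Q xm x1 ym y1.
Proof.
  intros HP HQ; unfold contour.
  assert (Ch := fun y x => cont2_h P y x HP); assert (Cv := fun y x => cont2_v Q y x HQ).
  rewrite !RInt_minus_R by auto.
  rewrite (RInt_split (fun t => P t y0) x0 xm x1), (RInt_split (fun t => P t y1) x0 xm x1),
    (RInt_split (Q x0) y0 ym y1), (RInt_split (Q x1) y0 ym y1) by auto.
  ring.
Qed.

(* The matrix of partial derivatives of (P, Q) at (x, y) is symmetric: the form P dx + Q dy is closed. *)
Definition closed_at (P Q : R -> R -> R) (x y : R) : Prop :=
  exists p1 p q2, forall eps, 0 < eps -> exists delta, 0 < delta /\ forall h k,
    Rabs h + Rabs k < delta ->
    Rabs (P (x + h) (y + k) - P x y - p1 * h - p * k) <= eps * (Rabs h + Rabs k) /\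
    Rabs (Q (x + h) (y + k) - Q x y - p * h - q2 * k) <= eps * (Rabs h + Rabs k).

Lemma RInt_bound (f : R -> R) a b M :
  a <= b -> (forall x, continuous f x) -> (forall t, a <= t <= b -> Rabs (f t) <= M) ->
  Rabs (RInt f a b) <= (b - a) * M.
Proof. intros; apply abs_RInt_le_const; auto; now apply ex_RInt_cont. Qed.

Lemma RInt_const_R (a b c : R) : RInt (fun _ => c) a b = (b - a) * c.
Proof. apply (RInt_const (V := R_CompleteNormedModule)). Qed.

(** The affine part of the form contributes p (A s)(B s) with opposite signs from the two pairs of
    sides, because the mixed coefficient p is common to P and Q. What remains is the
    differentiability error integrated over sides of length O(s). *)
Lemma goursat_small P Q u v A B :
  0 < A -> 0 < B -> cont2 P -> cont2 Q -> closed_at P Q u v ->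
  forall eps, 0 < eps -> exists delta, 0 < delta /\ forall x y s, 0 < s < delta ->
    x <= u <= x + A * s -> y <= v <= y + B * s ->
    Rabs (contour P Q x (x + A * s) y (y + B * s)) <= eps * s ^ 2.
Proof.
  intros HA HB HP HQ (p1 & p & q2 & Hd) eps He.
  (* The four sides contribute at most 2 (A s + B s) times the pointwise error e (A + B) s, which
     this choice turns into eps s^2. *)
  set (e := eps / (2 * (A + B) ^ 2)).
  assert (He' : 0 < e) by (apply Rdiv_lt_0_compat; nra).
  destruct (Hd e He') as (d & Hd0 & HH).
  exists (d / (A + B)); split; [apply Rdiv_lt_0_compat; lra|].
  intros x y s [Hs1 Hs2] Hu Hv.
  apply (Rmult_lt_compat_r (A + B)) in Hs2; [|lra].
  unfold Rdiv in Hs2; rewrite Rmult_assoc, Rinv_l, Rmult_1_r in Hs2 by lra.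
  assert (HAs : 0 < A * s) by now apply Rmult_lt_0_compat.
  assert (HBs : 0 < B * s) by now apply Rmult_lt_0_compat.
  assert (Hpt : forall a b, x <= a <= x + A * s -> y <= b <= y + B * s ->
    Rabs (P a b - P u v - p1 * (a - u) - p * (b - v)) <= e * ((A + B) * s) /\
    Rabs (Q a b - Q u v - p * (a - u) - q2 * (b - v)) <= e * ((A + B) * s)).
  { intros a b Ha Hb.
    assert (Rabs (a - u) <= A * s) by (apply Rabs_le; lra).
    assert (Rabs (b - v) <= B * s) by (apply Rabs_le; lra).
    destruct (HH (a - u) (b - v)) as [K1 K2]; [nra|].
    replace (u + (a - u)) with a in * by ring; replace (v + (b - v)) with b in * by ring.
    assert (e * (Rabs (a - u) + Rabs (b - v)) <= e * ((A + B) * s))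
      by (apply Rmult_le_compat_l; lra).
    split; lra. }
  unfold contour.
  assert (E1 : Rabs (RInt (fun t => P t y - P t (y + B * s)) x (x + A * s) + p * (B * s) * (A * s))
                <= A * s * (2 * (e * ((A + B) * s)))).
  { replace (RInt (fun t => P t y - P t (y + B * s)) x (x + A * s) + p * (B * s) * (A * s))
      with (RInt (fun t => (P t y - P t (y + B * s)) - (- (p * (B * s)))) x (x + A * s)).
    - replace (A * s * _) with ((x + A * s - x) * (2 * (e * ((A + B) * s)))) by ring.
      apply RInt_bound; [lra| |].
      + intros t; apply (continuous_minus (V := R_NormedModule));
          [apply (continuous_minus (V := R_NormedModule)); now apply cont2_h|apply continuous_const].
      + intros t Ht.
        destruct (Hpt t y) as [K1 _]; try lra.
        destruct (Hpt t (y + B * s)) as [K2 _]; try lra.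
        apply Rabs_le_between in K1; apply Rabs_le_between in K2.
        apply Rabs_le; lra.
    - rewrite (RInt_minus_R _ (fun _ => _)); [rewrite RInt_const_R; Rring| |].
      + intros t; apply (continuous_minus (V := R_NormedModule)); now apply cont2_h.
      + intros t; apply continuous_const. }
  assert (E2 : Rabs (RInt (fun t => Q (x + A * s) t - Q x t) y (y + B * s) - p * (A * s) * (B * s))
                <= B * s * (2 * (e * ((A + B) * s)))).
  { replace (RInt (fun t => Q (x + A * s) t - Q x t) y (y + B * s) - p * (A * s) * (B * s))
      with (RInt (fun t => (Q (x + A * s) t - Q x t) - (p * (A * s))) y (y + B * s)).
    - replace (B * s * _) with ((y + B * s - y) * (2 * (e * ((A + B) * s)))) by ring.
      apply RInt_bound; [lra| |].
      + intros t; apply (continuous_minus (V := R_NormedModule));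
          [apply (continuous_minus (V := R_NormedModule)); now apply cont2_v|apply continuous_const].
      + intros t Ht.
        destruct (Hpt (x + A * s) t) as [_ K1]; try lra.
        destruct (Hpt x t) as [_ K2]; try lra.
        apply Rabs_le_between in K1; apply Rabs_le_between in K2.
        apply Rabs_le; lra.
    - rewrite (RInt_minus_R _ (fun _ => _)); [rewrite RInt_const_R; Rring| |].
      + intros t; apply (continuous_minus (V := R_NormedModule)); now apply cont2_v.
      + intros t; apply continuous_const. }
  assert (E3 : A * s * (2 * (e * ((A + B) * s))) + B * s * (2 * (e * ((A + B) * s))) = eps * s ^ 2).
  { unfold e; field; lra. }
  apply Rabs_le_between in E1; apply Rabs_le_between in E2; apply Rabs_le; lra.
Qed.

(** The bound eps s^2 survives quartering because 4 (s/2)^2 = s^2, and it holds locally at every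
    point; bisection gives it at scale 1 for every eps. *)
Lemma goursat P Q x0 x1 y0 y1 :
  x0 < x1 -> y0 < y1 -> cont2 P -> cont2 Q ->
  (forall x y, x0 <= x <= x1 -> y0 <= y <= y1 -> closed_at P Q x y) ->
  contour P Q x0 x1 y0 y1 = 0.
Proof.
  intros Hx Hy HP HQ Hcl.
  assert (H : forall eps, 0 < eps -> Rabs (contour P Q x0 x1 y0 y1) <= eps).
  { intros eps He.
    assert (K : Rabs (contour P Q x0 (x0 + (x1 - x0) * 1) y0 (y0 + (y1 - y0) * 1)) <= eps * 1 ^ 2).
    { apply (bisection (x1 - x0) (y1 - y0)
        (fun x y s => Rabs (contour P Q x (x + (x1 - x0) * s) y (y + (y1 - y0) * s)) <= eps * s ^ 2));
        try lra.
      - intros x y s Hs H1 H2 H3 H4.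
        rewrite (contour_split P Q _ _ _ _ (x + (x1 - x0) * (s / 2)) (y + (y1 - y0) * (s / 2)))
          by auto.
        replace (x + (x1 - x0) * (s / 2) + (x1 - x0) * (s / 2)) with (x + (x1 - x0) * s) in * by field.
        replace (y + (y1 - y0) * (s / 2) + (y1 - y0) * (s / 2)) with (y + (y1 - y0) * s) in * by field.
        replace (eps * s ^ 2) with (eps * (s / 2) ^ 2 + eps * (s / 2) ^ 2 + eps * (s / 2) ^ 2
          + eps * (s / 2) ^ 2) by field.
        do 3 (eapply Rle_trans; [apply Rabs_triang|apply Rplus_le_compat; [|assumption]]).
        exact H1.
      - intros u v Hu Hv; apply goursat_small; auto; try lra; apply Hcl; lra. }
    replace (x0 + (x1 - x0) * 1) with x1 in K by ring.
    replace (y0 + (y1 - y0) * 1) with y1 in K by ring. lra. }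
  apply Rabs_eq_0, Rle_antisym; [|apply Rabs_pos].
  apply le_epsilon; intros eps He; rewrite Rplus_0_l; auto.
Qed.

(** * The maximum principle *)

Lemma ccont_fst f : ccont f -> cont2 (fun x y => fst (f (x, y))).
Proof.
  intros Hf x y eps; destruct (Hf (x, y) (eps) (cond_pos eps)) as (d & Hd & H).
  assert (Hd2 : 0 < d / 2) by lra.
  exists (mkposreal _ Hd2); intros u v Hu Hv; simpl in Hu, Hv.
  eapply Rle_lt_trans; [exact (fst_le_Cmod (f (u, v) - f (x, y))%C)|].
  apply H; eapply Rle_lt_trans; [apply Cmod_le_sum|]; simpl; unfold Rminus in *; lra.
Qed.

Lemma ccont_snd f : ccont f -> cont2 (fun x y => snd (f (x, y))).
Proof.
  intros Hf x y eps; destruct (Hf (x, y) (eps) (cond_pos eps)) as (d & Hd & H).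
  assert (Hd2 : 0 < d / 2) by lra.
  exists (mkposreal _ Hd2); intros u v Hu Hv; simpl in Hu, Hv.
  eapply Rle_lt_trans; [exact (snd_le_Cmod (f (u, v) - f (x, y))%C)|].
  apply H; eapply Rle_lt_trans; [apply Cmod_le_sum|]; simpl; unfold Rminus in *; lra.
Qed.

(* Im (f dz) = Im f dx + Re f dy; the Cauchy-Riemann equations say that it is closed. *)
Lemma holo_closed_at f x y :
  holo_at f (x, y) -> closed_at (fun a b => snd (f (a, b))) (fun a b => fst (f (a, b))) x y.
Proof.
  intros [[l1 l2] Hl]; exists l2, l1, (- l2); intros eps He.
  destruct (Hl eps He) as (d & Hd & H); exists d; split; auto.
  intros h k Hhk.
  assert (Hm := Cmod_le_sum (h, k)); simpl in Hm.
  specialize (H (h, k)).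
  assert (K : Cmod (h, k) < d) by lra.
  specialize (H K).
  change ((x, y) + (h, k))%C with (x + h, y + k) in H.
  assert (eps * Cmod (h, k) <= eps * (Rabs h + Rabs k)) by (apply Rmult_le_compat_l; lra).
  pose proof (fst_le_Cmod (f (x + h, y + k)%R - f (x, y) - (l1, l2) * (h, k))%C) as K1.
  pose proof (snd_le_Cmod (f (x + h, y + k)%R - f (x, y) - (l1, l2) * (h, k))%C) as K2.
  simpl in K1, K2; split.
  - replace (_ - _ - _ - _) with
      (snd (f (x + h, y + k)) + - snd (f (x, y)) + - (l1 * k + l2 * h)) by ring; lra.
  - replace (_ - _ - _ - _) with
      (fst (f (x + h, y + k)) + - fst (f (x, y)) + - (l1 * h - l2 * k)) by ring; lra.
Qed.

Definition cexp (z : C) : C := (exp (fst z) * cos (snd z), exp (fst z) * sin (snd z)).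

Lemma cexp_plus z w : cexp (z + w) = (cexp z * cexp w)%C.
Proof.
  unfold cexp, Cmult; simpl; rewrite exp_plus, cos_plus, sin_plus; apply injective_projections; simpl; ring.
Qed.

Lemma Cmod_cexp z : Cmod (cexp z) = exp (fst z).
Proof.
  unfold Cmod, cexp; simpl.
  transitivity (sqrt (Rsqr (exp (fst z)))); [f_equal|apply sqrt_Rsqr; left; apply exp_pos].
  pose proof (sin2_cos2 (snd z)); unfold Rsqr in *.
  transitivity (exp (fst z) * exp (fst z) *
    (sin (snd z) * sin (snd z) + cos (snd z) * cos (snd z))); [ring|]; rewrite H; ring.
Qed.

Lemma cexp_0 : cexp 0 = 1.
Proof. apply injective_projections; simpl; rewrite exp_0, ?cos_0, ?sin_0; ring. Qed.

Lemma derivable_pt_lim_0 f l : derivable_pt_lim f 0 l ->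
  forall eps, 0 < eps -> exists delta, 0 < delta /\
    forall x, Rabs x < delta -> Rabs (f x - f 0 - l * x) <= eps * Rabs x.
Proof.
  intros H eps He; destruct (H eps He) as [d Hd]; exists d; split; [apply cond_pos|].
  intros x Hx; destruct (Req_dec x 0) as [->|Hx0].
  - replace (f 0 - f 0 - l * 0) with 0 by ring; rewrite Rabs_R0; lra.
  - specialize (Hd x Hx0 Hx); rewrite Rplus_0_l in Hd.
    replace (f x - f 0 - l * x) with (((f x - f 0) / x - l) * x) by (field; auto).
    rewrite Rabs_mult; apply Rmult_le_compat_r; [apply Rabs_pos|lra].
Qed.

Lemma cdiff_cexp_0 : cdiff_at cexp 0 1.
Proof.
  intros eps He.
  (* The second bound 1 yields |exp x - 1| <= 2 h, which is needed for the imaginary part. *)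
  destruct (derivable_pt_lim_0 _ _ (derivable_pt_lim_exp 0) (Rmin (eps / 8) 1))
    as (d1 & Hd1 & H1); [apply Rmin_pos; lra|].
  destruct (derivable_pt_lim_0 _ _ (derivable_pt_lim_cos 0) (eps / 8)) as (d2 & Hd2 & H2); [lra|].
  destruct (derivable_pt_lim_0 _ _ (derivable_pt_lim_sin 0) (eps / 8)) as (d3 & Hd3 & H3); [lra|].
  exists (Rmin (Rmin d1 d2) (Rmin d3 (Rmin 1 (eps / 8)))); split.
  { repeat apply Rmin_pos; lra. }
  intros [x y] Hh.
  pose proof (fst_le_Cmod (x, y)) as Lx; pose proof (snd_le_Cmod (x, y)) as Ly; simpl in Lx, Ly.
  set (h := Cmod (x, y)) in *.
  assert (Q1 := Rmin_l (Rmin d1 d2) (Rmin d3 (Rmin 1 (eps / 8)))).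
  assert (Q2 := Rmin_r (Rmin d1 d2) (Rmin d3 (Rmin 1 (eps / 8)))).
  assert (Q3 := Rmin_l d1 d2); assert (Q4 := Rmin_r d1 d2).
  assert (Q5 := Rmin_l d3 (Rmin 1 (eps / 8))); assert (Q6 := Rmin_r d3 (Rmin 1 (eps / 8))).
  assert (Q7 := Rmin_l 1 (eps / 8)); assert (Q8 := Rmin_r 1 (eps / 8)).
  assert (Q9 := Rmin_l (eps / 8) 1); assert (Q10 := Rmin_r (eps / 8) 1).
  specialize (H1 x ltac:(lra)); specialize (H2 y ltac:(lra)); specialize (H3 y ltac:(lra)).
  rewrite exp_0 in H1; rewrite cos_0, sin_0 in H2; rewrite sin_0, cos_0 in H3.
  pose proof (Rabs_pos x); pose proof (Rabs_pos y).
  set (m := Rmin (eps / 8) 1) in *.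
  assert (B1 : Rabs (exp x - 1 - 1 * x) <= eps / 8 * h /\ Rabs (exp x - 1 - 1 * x) <= h).
  { split; eapply Rle_trans; try exact H1; nra. }
  assert (B2 : Rabs (cos y - 1) <= eps / 8 * h).
  { replace (cos y - 1) with (cos y - 1 - - 0 * y) by ring; nra. }
  assert (B3 : Rabs (sin y - y) <= eps / 8 * h).
  { replace (sin y - y) with (sin y - 0 - 1 * y) by ring; nra. }
  replace (0 + (x, y))%C with (x, y)
    by (unfold Cplus, RtoC; simpl; f_equal; ring).
  rewrite cexp_0; unfold cexp; simpl.
  eapply Rle_trans; [apply Cmod_le_sum|]; simpl.
  destruct B1 as [B1 B1'].
  assert (C1 : Rabs (cos y) <= 1) by (apply Rabs_le; pose proof (COS_bound y); lra).
  assert (C2 : Rabs (sin y) <= h + eps / 8 * h).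
  { replace (sin y) with (y + (sin y - y)) by ring.
    eapply Rle_trans; [apply Rabs_triang|]; lra. }
  assert (X1 : Rabs (exp x * cos y + - (1) + - (1 * x - 0 * y)) <= 3 * eps / 8 * h).
  { replace (exp x * cos y + - (1) + - (1 * x - 0 * y))
      with ((exp x - 1 - 1 * x) * cos y + (1 + x) * (cos y - 1)) by ring.
    eapply Rle_trans; [apply Rabs_triang|]; rewrite !Rabs_mult.
    assert (Rabs (1 + x) <= 2).
    { eapply Rle_trans; [apply Rabs_triang|]; rewrite Rabs_R1; lra. }
    pose proof (Rabs_pos (exp x - 1 - 1 * x)); pose proof (Rabs_pos (cos y - 1)).
    pose proof (Rabs_pos (1 + x)).
    assert (Rabs (exp x - 1 - 1 * x) * Rabs (cos y) <= eps / 8 * h * 1)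
      by (apply Rmult_le_compat; auto; apply Rabs_pos).
    assert (Rabs (1 + x) * Rabs (cos y - 1) <= 2 * (eps / 8 * h)) by (apply Rmult_le_compat; auto).
    lra. }
  assert (X2 : Rabs (exp x * sin y + - 0 + - (1 * y + 0 * x)) <= 5 * eps / 8 * h).
  { replace (exp x * sin y + - 0 + - (1 * y + 0 * x))
      with ((exp x - 1) * sin y + (sin y - y)) by ring.
    eapply Rle_trans; [apply Rabs_triang|]; rewrite !Rabs_mult.
    assert (E1 : Rabs (exp x - 1) <= 2 * h).
    { replace (exp x - 1) with (exp x - 1 - 1 * x + x) by ring.
      eapply Rle_trans; [apply Rabs_triang|]; lra. }
    assert (0 <= h) by lra.
    assert (E2 : Rabs (exp x - 1) * Rabs (sin y) <= 2 * h * Rabs (sin y))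
      by (apply Rmult_le_compat_r; auto; apply Rabs_pos).
    assert (E3 : Rabs (sin y) <= eps / 4) by nra.
    assert (2 * h * Rabs (sin y) <= 2 * h * (eps / 4)) by (apply Rmult_le_compat_l; lra).
    lra. }
  lra.
Qed.

Lemma holo_cexp z : holo_at cexp z.
Proof.
  apply (holo_ext (fun w => cexp z * cexp (w - z))%C).
  - exists 1; split; [lra|]; intros w _; rewrite <- cexp_plus; f_equal; ring.
  - apply holo_mult; [apply holo_const|].
    apply (holo_comp cexp); [apply holo_minus; [apply holo_id|apply holo_const]|].
    replace (z - z)%C with (RtoC 0) by ring; exists 1; apply cdiff_cexp_0.
Qed.

Lemma cexp_2PI x : cexp (x, 2 * PI) = cexp (x, 0).
Proof. unfold cexp; simpl; rewrite cos_2PI, sin_2PI, cos_0, sin_0; reflexivity. Qed.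

(* The substitution z = c + e^w turns the punctured disc into a half-plane strip of
   height 2 PI, on which Goursat applies to f(c + e^w). *)
Lemma mean_value f c d :
  ccont f -> (forall z, 0 < Cmod (z - c) < d -> holo_at f z) ->
  forall r, 0 < r < d ->
  RInt (fun t => fst (f (c + cexp (ln r, t))%C)) 0 (2 * PI) = 2 * PI * fst (f c).
Proof.
  intros Hf Hh r [Hr Hrd].
  pose proof PI_RGT_0 as HPI.
  set (g := fun w => f (c + cexp w)%C).
  assert (Hg : ccont g).
  { intros w; apply (ccont_at_comp f); [|apply Hf].
    apply holo_ccont, holo_plus; [apply holo_const|apply holo_cexp]. }
  assert (Hhg : forall w, fst w <= ln r -> holo_at g w).
  { intros w Hw; apply (holo_comp f); [apply holo_plus; [apply holo_const|apply holo_cexp]|].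
    apply Hh; replace (c + cexp w - c)%C with (cexp w) by ring; rewrite Cmod_cexp.
    split; [apply exp_pos|]. eapply Rle_lt_trans; [|exact Hrd].
    rewrite <- (exp_ln r) at 1 by auto.
    destruct (Req_dec (fst w) (ln r)) as [->|N]; [lra|left; apply exp_increasing; lra]. }
  (* By periodicity the horizontal sides of the strip cancel, so the mean over a circle does not
     depend on its radius. The radius then tends to 0, where only continuity at c is used. *)
  assert (Hc : forall a, a < ln r ->
    RInt (fun t => fst (g (ln r, t))) 0 (2 * PI) = RInt (fun t => fst (g (a, t))) 0 (2 * PI)).
  { intros a Ha.
    assert (G := goursat (fun x y => snd (g (x, y))) (fun x y => fst (g (x, y))) a (ln r) 0 (2 * PI)).
    unfold contour in G.
    rewrite (RInt_ext _ (fun _ => 0)), RInt_const_R, RInt_minus_R in G.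
    - assert (E : a < ln r) by auto; specialize (G E ltac:(lra) (ccont_snd _ Hg) (ccont_fst _ Hg)).
      enough (X : forall x y, a <= x <= ln r -> 0 <= y <= 2 * PI ->
        closed_at (fun x y => snd (g (x, y))) (fun x y => fst (g (x, y))) x y)
        by (specialize (G X); lra).
      intros x y Hx _; apply holo_closed_at, Hhg; simpl; lra.
    - intros; apply (cont2_v (fun x y => fst (g (x, y)))), ccont_fst, Hg.
    - intros; apply (cont2_v (fun x y => fst (g (x, y)))), ccont_fst, Hg.
    - intros x _; unfold g; rewrite cexp_2PI; Rring. }
  change (RInt (fun t => fst (g (ln r, t))) 0 (2 * PI) = 2 * PI * fst (f c)).
  apply Rminus_diag_uniq, Rabs_eq_0, Rle_antisym; [|apply Rabs_pos].
  apply le_epsilon; intros eps He; rewrite Rplus_0_l.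
  destruct (Hf c (eps / (2 * PI))) as (d' & Hd' & H); [apply Rdiv_lt_0_compat; lra|].
  assert (Hm : 0 < Rmin d' r / 2) by (assert (0 < Rmin d' r) by (apply Rmin_pos; auto); lra).
  assert (Hm1 : Rmin d' r / 2 < d') by (pose proof (Rmin_l d' r); lra).
  assert (Hm2 : Rmin d' r / 2 < r) by (pose proof (Rmin_r d' r); lra).
  rewrite (Hc (ln (Rmin d' r / 2))) by (apply ln_increasing; auto).
  set (a := ln (Rmin d' r / 2)).
  assert (Ca : forall x, continuous (fun t => fst (g (a, t))) x)
    by (intros; apply (cont2_v (fun x y => fst (g (x, y)))), ccont_fst, Hg).
  replace (2 * PI * fst (f c)) with (RInt (fun _ : R => fst (f c)) 0 (2 * PI))
    by (rewrite RInt_const_R; Rring).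
  rewrite <- RInt_minus_R; auto; [|intros; apply continuous_const].
  replace eps with ((2 * PI - 0) * (eps / (2 * PI))) by (field; lra).
  apply RInt_bound; [lra| |].
  - intros; apply (continuous_minus (V := R_NormedModule)); [auto|apply continuous_const].
  - intros t _; left.
    eapply Rle_lt_trans; [exact (fst_le_Cmod (g (a, t) - f c)%C)|].
    apply H; replace (c + cexp (a, t) - c)%C with (cexp (a, t)) by ring.
    rewrite Cmod_cexp; simpl; unfold a; rewrite exp_ln; auto.
Qed.

Definition on_border (x0 x1 y0 y1 : R) (z : C) : Prop :=
  in_rect x0 x1 y0 y1 z /\ (fst z = x0 \/ fst z = x1 \/ snd z = y0 \/ snd z = y1).

Lemma in_rect_closed x0 x1 y0 y1 : Copen (fun z => ~ in_rect x0 x1 y0 y1 z).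
Proof.
  intros z Hz.
  assert (H : fst z < x0 \/ x1 < fst z \/ snd z < y0 \/ y1 < snd z).
  { apply NNPP; intros N; apply Hz; unfold in_rect; lra. }
  assert (K : forall w, Rabs (fst w - fst z) <= Cmod (w - z) /\ Rabs (snd w - snd z) <= Cmod (w - z))
    by (intros w; split; [exact (fst_le_Cmod (w - z)%C)|exact (snd_le_Cmod (w - z)%C)]).
  destruct H as [H|[H|[H|H]]];
    [exists (x0 - fst z)|exists (fst z - x1)|exists (y0 - snd z)|exists (snd z - y1)];
    (split; [lra|]; intros w Hw [W1 W2]; rewrite Cnorm_Cmod in Hw;
     change (Csub w z) with (w - z)%C in Hw; destruct (K w) as [K1 K2];
     apply Rabs_le_between in K1; apply Rabs_le_between in K2; lra).
Qed.

Lemma Cmod_reverse_triangle (a b : C) : Rabs (Cmod a - Cmod b) <= Cmod (a - b).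
Proof.
  pose proof (Cmod_le_sub a b); pose proof (Cmod_le_sub b a).
  rewrite (Cmod_sub_sym b a) in H0; apply Rabs_le; lra.
Qed.

Lemma Cmod2 (z : C) : Cmod z ^ 2 = fst z ^ 2 + snd z ^ 2.
Proof. exact (Cmod2_alt z). Qed.

Lemma rcont_Cmod2 f z : ccont_at f z -> rcont_at (fun w => Cmod (f w) ^ 2) z.
Proof.
  intros Hf eps He.
  set (m := Rmin 1 (eps / (2 * Cmod (f z) + 2))).
  pose proof (Cmod_ge_0 (f z)).
  assert (Hm : 0 < m) by (apply Rmin_pos; [lra|]; apply Rdiv_lt_0_compat; lra).
  destruct (Hf _ Hm) as (d & Hd & HH); exists d; split; auto; intros w Hw.
  specialize (HH w Hw).
  pose proof (Cmod_reverse_triangle (f w) (f z)).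
  assert (m <= 1) by apply Rmin_l.
  assert (Hm2 : m <= eps / (2 * Cmod (f z) + 2)) by apply Rmin_r.
  apply (Rmult_le_compat_r (2 * Cmod (f z) + 2)) in Hm2; [|lra].
  unfold Rdiv in Hm2; rewrite Rmult_assoc, Rinv_l, Rmult_1_r in Hm2 by lra.
  replace (Cmod (f w) ^ 2 - Cmod (f z) ^ 2)
    with ((Cmod (f w) - Cmod (f z)) * (Cmod (f w) - Cmod (f z) + 2 * Cmod (f z))) by ring.
  rewrite Rabs_mult.
  assert (Rabs (Cmod (f w) - Cmod (f z) + 2 * Cmod (f z)) <= 1 + 2 * Cmod (f z)).
  { eapply Rle_trans; [apply Rabs_triang|]; rewrite (Rabs_pos_eq (2 * _)); lra. }
  pose proof (Rabs_pos (Cmod (f w) - Cmod (f z))).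
  apply Rle_lt_trans with (m * (1 + 2 * Cmod (f z))); [|lra].
  apply Rmult_le_compat; try lra; apply Rabs_pos.
Qed.

(* A maximum of |f|^2 + e |z|^2 inside the rectangle would contradict the mean value property
   of conj(f(z0)) f(z) + e conj(z0) z at z0. *)
Lemma max_principle f x0 x1 y0 y1 m :
  x0 < x1 -> y0 < y1 -> ccont f ->
  (forall z, x0 < fst z < x1 -> y0 < snd z < y1 ->
     exists d, 0 < d /\ forall w, 0 < Cmod (w - z) < d -> holo_at f w) ->
  (forall z, on_border x0 x1 y0 y1 z -> Cmod (f z) <= m) ->
  forall z, in_rect x0 x1 y0 y1 z -> Cmod (f z) <= m.
Proof.
  intros Hx Hy Hf Hh Hb.
  assert (Key : forall e, 0 < e -> exists z0, on_border x0 x1 y0 y1 z0 /\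
    forall z, in_rect x0 x1 y0 y1 z ->
      Cmod (f z) ^ 2 + e * Cmod z ^ 2 <= Cmod (f z0) ^ 2 + e * Cmod z0 ^ 2).
  { intros e He.
    destruct (max_attained (in_rect x0 x1 y0 y1) (fun z => Cmod (f z) ^ 2 + e * Cmod z ^ 2)
      x0 x1 y0 y1) as (z0 & K0 & Hmax); auto.
    { apply in_rect_closed. }
    { exists (x0, y0); split; simpl; lra. }
    { intros z _ eps Heps.
      destruct (rcont_Cmod2 f z (Hf z) (eps / 2)) as (d1 & Hd1 & H1); [lra|].
      destruct (rcont_Cmod2 (fun w => w) z (ccont_at_id z) (eps / (2 * e))) as (d2 & Hd2 & H2);
        [apply Rdiv_lt_0_compat; lra|].
      exists (Rmin d1 d2); split; [now apply Rmin_pos|]; intros w Hw.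
      specialize (H1 w (Rlt_le_trans _ _ _ Hw (Rmin_l _ _))).
      specialize (H2 w (Rlt_le_trans _ _ _ Hw (Rmin_r _ _))).
      replace (Cmod (f w) ^ 2 + e * Cmod w ^ 2 - (Cmod (f z) ^ 2 + e * Cmod z ^ 2))
        with ((Cmod (f w) ^ 2 - Cmod (f z) ^ 2) + e * (Cmod w ^ 2 - Cmod z ^ 2)) by ring.
      eapply Rle_lt_trans; [apply Rabs_triang|].
      rewrite (Rabs_mult e), (Rabs_pos_eq e) by lra.
      apply (Rmult_lt_compat_l e) in H2; [|lra].
      replace (e * (eps / (2 * e))) with (eps / 2) in H2 by (field; lra). lra. }
    exists z0; split; auto; split; auto.
    apply NNPP; intros N.
    assert (I1 : x0 < fst z0 < x1) by (destruct K0; lra).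
    assert (I2 : y0 < snd z0 < y1) by (destruct K0; lra).
    destruct (Hh z0 I1 I2) as (d & Hd & Hol).
    set (r := Rmin d (Rmin (Rmin (fst z0 - x0) (x1 - fst z0)) (Rmin (snd z0 - y0) (y1 - snd z0))) / 2).
    assert (Hr : 0 < r) by (unfold r; apply Rdiv_lt_0_compat; [|lra]; repeat apply Rmin_pos; lra).
    assert (Hr2 : 2 * r = Rmin d (Rmin (Rmin (fst z0 - x0) (x1 - fst z0)) (Rmin (snd z0 - y0) (y1 - snd z0))))
      by (unfold r; field).
    assert (R0 : r < d /\ r <= fst z0 - x0 /\ r <= x1 - fst z0 /\ r <= snd z0 - y0 /\ r <= y1 - snd z0).
    { revert Hr2; unfold Rmin; repeat destruct Rle_dec; lra. }
    set (g := fun w => (Cconj (f z0) * f w + RtoC e * Cconj z0 * w)%C).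
    assert (Hg : ccont g).
    { intros w; apply ccont_at_plus; apply ccont_at_mult;
        auto using ccont_at_const, ccont_at_id. }
    assert (MV := mean_value g z0 d Hg).
    specialize (MV ltac:(intros w Hw; apply holo_plus; apply holo_mult;
      auto using holo_const, holo_id) r ltac:(lra)).
    pose proof PI_RGT_0 as HPI.
    (* From 2 Re(conj(p) q) = |p|^2 + |q|^2 - |p - q|^2, applied to the values of f and to the
       points themselves, maximality at z0 gives Re g <= Re g(z0) - e r^2 / 2 on the circle. The e
       |z|^2 term thus makes the loss strict. *)
    assert (L : RInt (fun t => fst (g (z0 + cexp (ln r, t))%C)) 0 (2 * PI)
                <= RInt (fun _ : R => fst (g z0) - e * r ^ 2 / 2) 0 (2 * PI)).
    { apply RInt_le; [lra| | |].
      - apply ex_RInt_cont; intros t.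
        apply (cont2_v (fun x y => fst (g (z0 + cexp (x, y))%C))).
        apply (ccont_fst (fun w => g (z0 + cexp w)%C)).
        intros w; apply (ccont_at_comp g); [|apply Hg].
        apply holo_ccont, holo_plus; [apply holo_const|apply holo_cexp].
      - apply ex_RInt_cont; intros; apply continuous_const.
      - intros t _.
        set (k := cexp (ln r, t)).
        assert (Hk : Cmod k = r) by (unfold k; rewrite Cmod_cexp; simpl; now rewrite exp_ln).
        assert (K1 : Rabs (fst k) <= r) by (rewrite <- Hk; apply fst_le_Cmod).
        assert (K2 : Rabs (snd k) <= r) by (rewrite <- Hk; apply snd_le_Cmod).
        apply Rabs_le_between in K1; apply Rabs_le_between in K2.
        clearbody k.
        assert (Hin : in_rect x0 x1 y0 y1 (z0 + k)%C) by (split; simpl; lra).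
        specialize (Hmax _ Hin); cbv beta in Hmax.
        assert (Hk2 : fst k ^ 2 + snd k ^ 2 = r ^ 2) by (rewrite <- Hk; symmetry; apply Cmod2).
        rewrite !Cmod2 in Hmax.
        unfold g; simpl; simpl in Hmax, Hk2.
        set (a := fst (f (z0 + k)%C)) in *; set (b := snd (f (z0 + k)%C)) in *.
        set (a0 := fst (f z0)) in *; set (b0 := snd (f z0)) in *.
        pose proof (Rle_0_sqr (a - a0)); pose proof (Rle_0_sqr (b - b0)); unfold Rsqr in *.
        nra. }
    rewrite MV, RInt_const_R in L.
    assert (0 < 2 * PI * (e * r ^ 2 / 2)).
    { apply Rmult_lt_0_compat; [lra|]; apply Rdiv_lt_0_compat; [|lra].
      apply Rmult_lt_0_compat; [lra|]; apply pow_lt; lra. }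
    lra. }
  intros z Hz.
  assert (Hm : 0 <= m).
  { apply Rle_trans with (Cmod (f (x0, y0))); [apply Cmod_ge_0|apply Hb].
    split; [split; simpl; lra|simpl; auto]. }
  apply Rsqr_incr_0_var; auto; rewrite !Rsqr_pow2.
  (* T bounds |z| on the rectangle, so the auxiliary term with e = eps / T^2 costs at most eps. *)
  set (T := Rabs x0 + Rabs x1 + Rabs y0 + Rabs y1 + 1).
  assert (HT : 0 < T).
  { unfold T; pose proof (Rabs_pos x0); pose proof (Rabs_pos x1);
      pose proof (Rabs_pos y0); pose proof (Rabs_pos y1); lra. }
  apply le_epsilon; intros eps He.
  destruct (Key (eps / T ^ 2)) as (z0 & B0 & H0).
  { apply Rdiv_lt_0_compat; auto; apply pow_lt; auto. }
  specialize (H0 z Hz); specialize (Hb _ B0).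
  assert (Hz0 : Cmod z0 <= T).
  { destruct B0 as [[B1 B2] _]; eapply Rle_trans; [apply Cmod_le_sum|]; unfold T.
    assert (Rabs (fst z0) <= Rabs x0 + Rabs x1).
    { apply Rabs_le; pose proof (Rle_abs x1); pose proof (Rle_abs (- x0)).
      rewrite Rabs_Ropp in H1; pose proof (Rabs_pos x0); pose proof (Rabs_pos x1); lra. }
    assert (Rabs (snd z0) <= Rabs y0 + Rabs y1).
    { apply Rabs_le; pose proof (Rle_abs y1); pose proof (Rle_abs (- y0)).
      rewrite Rabs_Ropp in H2; pose proof (Rabs_pos y0); pose proof (Rabs_pos y1); lra. }
    lra. }
  assert (HT2 : 0 < T ^ 2) by (apply pow_lt; auto).
  assert (eps / T ^ 2 * Cmod z0 ^ 2 <= eps).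
  { replace eps with (eps / T ^ 2 * T ^ 2) at 2 by (field; lra).
    apply Rmult_le_compat_l; [left; now apply Rdiv_lt_0_compat|].
    apply pow_incr; split; auto; apply Cmod_ge_0. }
  assert (0 <= eps / T ^ 2 * Cmod z ^ 2).
  { apply Rmult_le_pos; [left; now apply Rdiv_lt_0_compat|apply pow2_ge_0]. }
  assert (Cmod (f z0) ^ 2 <= m ^ 2) by (apply pow_incr; split; auto; apply Cmod_ge_0).
  lra.
Qed.

(** * Consequences of the maximum principle *)

Definition clamp1 (lo hi x : R) : R := Rmax lo (Rmin hi x).

Definition clamp (x0 x1 y0 y1 : R) (z : C) : C := (clamp1 x0 x1 (fst z), clamp1 y0 y1 (snd z)).

Lemma clamp_in x0 x1 y0 y1 z : x0 <= x1 -> y0 <= y1 -> in_rect x0 x1 y0 y1 (clamp x0 x1 y0 y1 z).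
Proof.
  intros; unfold clamp, clamp1; split; simpl; unfold Rmax, Rmin; repeat destruct Rle_dec; lra.
Qed.

Lemma clamp_id x0 x1 y0 y1 z : in_rect x0 x1 y0 y1 z -> clamp x0 x1 y0 y1 z = z.
Proof.
  intros [H1 H2]; apply injective_projections; unfold clamp, clamp1; simpl;
    unfold Rmax, Rmin; repeat destruct Rle_dec; lra.
Qed.

Lemma clamp1_lip lo hi x y : Rabs (clamp1 lo hi x - clamp1 lo hi y) <= Rabs (x - y).
Proof.
  unfold clamp1, Rmax, Rmin; repeat destruct Rle_dec; unfold Rabs; repeat destruct Rcase_abs; lra.
Qed.

Lemma clamp_lip x0 x1 y0 y1 z w :
  Cmod (clamp x0 x1 y0 y1 z - clamp x0 x1 y0 y1 w) <= 2 * Cmod (z - w).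
Proof.
  eapply Rle_trans; [apply Cmod_le_sum|]; simpl.
  pose proof (clamp1_lip x0 x1 (fst z) (fst w)); pose proof (clamp1_lip y0 y1 (snd z) (snd w)).
  pose proof (fst_le_Cmod (z - w)%C); pose proof (snd_le_Cmod (z - w)%C).
  simpl in *; unfold Rminus in *; lra.
Qed.

Lemma ccont_clamp f x0 x1 y0 y1 :
  x0 <= x1 -> y0 <= y1 -> cont_on (in_rect x0 x1 y0 y1) f ->
  ccont (fun z => f (clamp x0 x1 y0 y1 z)).
Proof.
  intros Hx Hy Hf z eps He.
  destruct (Hf _ (clamp_in x0 x1 y0 y1 z Hx Hy) eps He) as (d & Hd & H).
  exists (d / 2); split; [lra|]; intros w Hw.
  rewrite <- Cnorm_Cmod; apply H; [now apply clamp_in|].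
  rewrite Cnorm_Cmod; eapply Rle_lt_trans; [apply clamp_lip|]; lra.
Qed.

Lemma open_rect x0 x1 y0 y1 z :
  x0 < fst z < x1 -> y0 < snd z < y1 ->
  exists d, 0 < d /\ forall w, Cmod (w - z) < d -> x0 < fst w < x1 /\ y0 < snd w < y1.
Proof.
  intros H1 H2.
  exists (Rmin (Rmin (fst z - x0) (x1 - fst z)) (Rmin (snd z - y0) (y1 - snd z))); split.
  { repeat apply Rmin_pos; lra. }
  intros w Hw.
  pose proof (fst_le_Cmod (w - z)%C) as K1; pose proof (snd_le_Cmod (w - z)%C) as K2.
  simpl in K1, K2; apply Rabs_le_between in K1; apply Rabs_le_between in K2.
  revert Hw; unfold Rmin; repeat destruct Rle_dec; lra.
Qed.

Lemma holo_clamp f x0 x1 y0 y1 z :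
  x0 < fst z < x1 -> y0 < snd z < y1 -> holo_at f z ->
  holo_at (fun z => f (clamp x0 x1 y0 y1 z)) z.
Proof.
  intros H1 H2; apply holo_ext.
  destruct (open_rect _ _ _ _ _ H1 H2) as (d & Hd & H); exists d; split; auto.
  intros w Hw; rewrite clamp_id; auto; specialize (H w Hw); split; lra.
Qed.

Lemma Copen_Cmod (U : C -> Prop) z : Copen U -> U z ->
  exists r, 0 < r /\ forall w, Cmod (w - z) < r -> U w.
Proof.
  intros HU Hz; destruct (HU z Hz) as (r & Hr & H); exists r; split; auto.
  intros w Hw; apply H; rewrite Cnorm_Cmod; exact Hw.
Qed.

Lemma holo_on_at (U : C -> Prop) f z : Copen U -> holo_on U f -> U z -> holo_at f z.
Proof.
  intros HU Hf Hz; destruct (Hf z Hz) as [l Hl]; exists l; intros eps He.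
  destruct (Hl eps He) as (d & Hd & H).
  destruct (Copen_Cmod U z HU Hz) as (r & Hr & HH).
  exists (Rmin d r); split; [now apply Rmin_pos|]; intros h Hh.
  assert (Q1 := Rmin_l d r); assert (Q2 := Rmin_r d r).
  rewrite <- !Cnorm_Cmod; apply H; [rewrite Cnorm_Cmod; lra|].
  apply HH; replace (Cadd z h - z)%C with h; [lra|]; change (Cadd z h) with (z + h)%C; ring.
Qed.

Lemma holo_at_on (U : C -> Prop) f : (forall z, U z -> holo_at f z) -> holo_on U f.
Proof.
  intros H z Hz; destruct (H z Hz) as [l Hl]; exists l; intros eps He.
  destruct (Hl eps He) as (d & Hd & HH); exists d; split; auto; intros h Hh _.
  rewrite Cnorm_Cmod in Hh |- *; rewrite Cnorm_Cmod; apply HH; auto.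
Qed.

Lemma ccont_at_cont_on (D : C -> Prop) f : (forall z, D z -> ccont_at f z) -> cont_on D f.
Proof.
  intros H z Hz eps He; destruct (H z Hz eps He) as (d & Hd & HH); exists d; split; auto.
  intros w _ Hw; rewrite Cnorm_Cmod in Hw |- *; apply HH; auto.
Qed.

Lemma border_closed x0 x1 y0 y1 : Copen (fun z => ~ on_border x0 x1 y0 y1 z).
Proof.
  intros z Hz; destruct (classic (in_rect x0 x1 y0 y1 z)) as [Hin|Hin].
  - assert (I1 : x0 < fst z < x1).
    { apply NNPP; intros N; apply Hz; split; auto; destruct Hin; lra. }
    assert (I2 : y0 < snd z < y1).
    { apply NNPP; intros N; apply Hz; split; auto; destruct Hin; lra. }
    destruct (open_rect _ _ _ _ _ I1 I2) as (d & Hd & H); exists d; split; auto.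
    intros w Hw [_ B]; rewrite Cnorm_Cmod in Hw; specialize (H w Hw); lra.
  - destruct (in_rect_closed _ _ _ _ _ Hin) as (d & Hd & H); exists d; split; auto.
    intros w Hw [B _]; apply (H w); auto.
Qed.

(** * Squares and the open mapping theorem *)

Definition in_square (c : C) (s : R) : C -> Prop :=
  in_rect (fst c - s) (fst c + s) (snd c - s) (snd c + s).

Lemma in_square_Cmod c s z : in_square c s z -> Cmod (z - c) <= 2 * s.
Proof.
  intros [H1 H2]; eapply Rle_trans; [apply Cmod_le_sum|]; simpl.
  assert (Rabs (fst z + - fst c) <= s) by (apply Rabs_le; lra).
  assert (Rabs (snd z + - snd c) <= s) by (apply Rabs_le; lra).
  lra.
Qed.

Lemma Cmod_in_square c s z : Cmod (z - c) <= s -> in_square c s z.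
Proof.
  intros H; pose proof (fst_le_Cmod (z - c)%C) as K1; pose proof (snd_le_Cmod (z - c)%C) as K2.
  simpl in K1, K2; apply Rabs_le_between in K1; apply Rabs_le_between in K2; split; lra.
Qed.

(* If c were not a value of F near w0, the maximum principle for 1/(F - c) would be violated. *)
Lemma open_mapping (V : C -> Prop) (F : C -> C) (w0 : C) r :
  Copen V -> holo_on V F -> (forall z w : C, V z -> V w -> F z = F w -> z = w) -> V w0 -> 0 < r ->
  exists d, 0 < d /\ forall c, Cmod (c - F w0) < d ->
    exists w, V w /\ Cmod (w - w0) < r /\ F w = c.
Proof.
  intros HV HF Hinj Hw0 Hr.
  destruct (Copen_Cmod V w0 HV Hw0) as (rV & HrV & HVr).
  set (s := Rmin rV r / 4).
  assert (Hs : 0 < s) by (apply Rdiv_lt_0_compat; [now apply Rmin_pos|lra]).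
  assert (Hsq : forall z, in_square w0 s z -> V z /\ Cmod (z - w0) < r).
  { intros z Hz; apply in_square_Cmod in Hz.
    pose proof (Rmin_l rV r); pose proof (Rmin_r rV r).
    assert (2 * s = Rmin rV r / 2) by (unfold s; field).
    assert (0 < Rmin rV r) by now apply Rmin_pos.
    split; [apply HVr|]; lra. }
  set (x0 := fst w0 - s); set (x1 := fst w0 + s); set (y0 := snd w0 - s); set (y1 := snd w0 + s).
  assert (Hx : x0 < x1) by (unfold x0, x1; lra).
  assert (Hy : y0 < y1) by (unfold y0, y1; lra).
  set (G := fun z => F (clamp x0 x1 y0 y1 z)).
  assert (HG : ccont G).
  { apply ccont_clamp; try lra; apply ccont_at_cont_on; intros z Hz.
    apply holo_ccont, (holo_on_at V); auto; now apply Hsq. }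
  assert (HGF : forall z, in_rect x0 x1 y0 y1 z -> G z = F z)
    by (intros z Hz; unfold G; now rewrite clamp_id).
  assert (Hw0in : in_rect x0 x1 y0 y1 w0) by (split; unfold x0, x1, y0, y1; lra).
  destruct (max_attained (on_border x0 x1 y0 y1) (fun z => - Cmod (G z - F w0) ^ 2) x0 x1 y0 y1)
    as (b & Hb & Hmin); auto.
  { intros z [H _]; exact H. }
  { apply border_closed. }
  { exists (x0, y0); split; [split; simpl; lra|simpl; auto]. }
  { intros z _ eps He.
    destruct (rcont_Cmod2 (fun z => G z - F w0)%C z) with (eps := eps) as (d & Hd & H); auto.
    { apply ccont_at_minus; [apply HG|apply ccont_at_const]. }
    exists d; split; auto; intros w Hw; specialize (H w Hw).
    rewrite <- Rabs_Ropp.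
    replace (- (- Cmod (G w - F w0) ^ 2 - - Cmod (G z - F w0) ^ 2))
      with (Cmod (G w - F w0) ^ 2 - Cmod (G z - F w0) ^ 2) by ring; auto. }
  set (m := Cmod (G b - F w0)) in *.
  assert (Hm : 0 < m).
  { apply Cmod_gt_0; intros E.
    assert (E' : F b = F w0).
    { destruct Hb as [Hb _]; rewrite <- (HGF b Hb).
      replace (F w0) with (RtoC 0 + F w0)%C by ring; rewrite <- E; ring. }
    apply Hinj in E'; [|now apply Hsq, Hb|auto].
    subst b; destruct Hb as [_ Hb]; unfold x0, x1, y0, y1 in Hb; lra. }
  assert (Hmb : forall z, on_border x0 x1 y0 y1 z -> m <= Cmod (G z - F w0)).
  { intros z Hz; specialize (Hmin z Hz); pose proof (Cmod_ge_0 (G z - F w0)).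
    apply Rsqr_incr_0_var; auto; rewrite !Rsqr_pow2; lra. }
  (* By injectivity, the minimum m of |F - F w0| on the border is positive. For c within m/2 of F
     w0, |F - c| is at least m/2 on the border but smaller than m/2 at w0. *)
  exists (m / 2); split; [lra|]; intros c Hc.
  apply NNPP; intros N.
  assert (Hne : forall z, (G z - c)%C <> RtoC 0).
  { intros z E; apply N; exists (clamp x0 x1 y0 y1 z).
    assert (Hz := clamp_in x0 x1 y0 y1 z ltac:(lra) ltac:(lra)).
    destruct (Hsq _ Hz); repeat split; auto.
    change (G z = c); replace c with (RtoC 0 + c)%C by ring; rewrite <- E; ring. }
  assert (MP : Cmod (/ (G w0 - c)) <= 2 / m).
  { apply (max_principle (fun z => / (G z - c))%C x0 x1 y0 y1); auto.
    - intros z; apply (ccont_at_comp Cinv (fun z => G z - c)%C).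
      + apply ccont_at_minus; [apply HG|apply ccont_at_const].
      + apply ccont_at_inv, Hne.
    - intros z Hz1 Hz2; destruct (open_rect _ _ _ _ _ Hz1 Hz2) as (d & Hd & H).
      exists d; split; auto; intros w [_ Hw]; specialize (H w Hw).
      apply holo_inv; [|apply Hne]; apply holo_minus; [|apply holo_const].
      apply holo_clamp; try tauto; apply (holo_on_at V); auto; apply Hsq; split; unfold x0, x1, y0, y1 in *; lra.
    - intros z Hz; rewrite Cmod_inv by apply Hne.
      specialize (Hmb z Hz).
      pose proof (Cmod_sub_triangle (G z) c (F w0)).
      replace (2 / m) with (/ (m / 2)) by (field; lra).
      apply Rinv_le_contravar; lra. }
  rewrite Cmod_inv in MP by apply Hne.
  rewrite (HGF w0 Hw0in) in MP.
  rewrite Cmod_sub_sym in Hc.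
  replace (2 / m) with (/ (m / 2)) in MP by (field; lra).
  assert (0 < Cmod (F w0 - c)) by (apply Cmod_gt_0; rewrite <- (HGF w0 Hw0in); apply Hne).
  apply Rinv_lt_contravar in Hc; [lra|]; apply Rmult_lt_0_compat; lra.
Qed.

(** * Gaussian kernels and the two-constants estimate *)

(** The entire function exp(-N z^2 + i xi (z + s)). On the real axis it is a Gaussian window at 0
    carrying the frequency xi; s only adjusts the phase and does not affect the modulus. *)
Definition kern (N xi s : R) (z : C) : C :=
  cexp (RtoC (- N) * (z * z) + (RtoC xi * Ci) * (z + RtoC s))%C.

Lemma Cmod_kern N xi s z :
  Cmod (kern N xi s z) = exp (- (N * (fst z ^ 2 - snd z ^ 2) + xi * snd z)).
Proof. unfold kern; rewrite Cmod_cexp; f_equal; simpl; ring. Qed.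

Lemma holo_kern N xi s z : holo_at (kern N xi s) z.
Proof.
  apply (holo_comp cexp); [|apply holo_cexp].
  apply holo_plus; apply holo_mult; try apply holo_const.
  - apply holo_mult; apply holo_id.
  - apply holo_plus; [apply holo_id|apply holo_const].
Qed.

Lemma ccont_kern N xi s : ccont (kern N xi s).
Proof. intros z; apply holo_ccont, holo_kern. Qed.

Lemma exp_le x y : x <= y -> exp x <= exp y.
Proof. intros [H| ->]; [left; now apply exp_increasing|right; auto]. Qed.

(** Everything reduces to x^2 - y^2 + y/2 >= rho^2 on the vertical sides and the top. The top side y
    = rho requires rho/2 >= 2 rho^2, which is the origin of the bound 1/4 on rho. *)
Lemma kern_sides N xi s rho z :
  0 <= N -> N / 2 <= xi -> 0 < rho <= / 4 ->
  on_border (- rho) rho 0 rho z -> snd z <> 0 \/ fst z = - rho \/ fst z = rho ->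
  Cmod (kern N xi s z) <= exp (- (N * rho ^ 2)).
Proof.
  intros HN Hxi Hr [[H1 H2] HB] H3; rewrite Cmod_kern; apply exp_le.
  apply Ropp_le_contravar.
  assert (K : rho ^ 2 <= fst z ^ 2 - snd z ^ 2 + snd z / 2).
  { destruct HB as [E|[E|[E|E]]]; destruct H3 as [E'|[E'|E']]; try lra; rewrite ?E, ?E'; nra. }
  apply Rle_trans with (N * (fst z ^ 2 - snd z ^ 2 + snd z / 2)).
  - apply Rmult_le_compat_l; auto.
  - assert (N / 2 * snd z <= xi * snd z) by (apply Rmult_le_compat_r; lra). lra.
Qed.

(** The maximum principle is applied to f times the kernel with xi = N. With E = exp(-N rho^2 / 2),
    the kernel is at most 1 on the axis, at most E^2 on the other sides, and at least E on the inner
    box, since there x^2 - y^2 + y <= rho^2 / 2; this dictates the height rho^2 / 4. The resulting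
    eps is independent of f. *)
Lemma two_constants rho M eta :
  0 < rho <= / 4 -> 0 < M -> 0 < eta ->
  exists eps, 0 < eps /\ forall f, ccont f ->
    (forall z, - rho < fst z < rho -> 0 < snd z < rho -> holo_at f z) ->
    (forall z, in_rect (- rho) rho 0 rho z -> Cmod (f z) <= M) ->
    (forall x, - rho <= x <= rho -> Cmod (f (x, 0)) <= eps) ->
    forall z, in_rect (- rho / 2) (rho / 2) 0 (rho ^ 2 / 4) z -> Cmod (f z) <= eta.
Proof.
  intros Hr HM Heta.
  assert (Hr2 : 0 < rho ^ 2) by nra.
  (* Then N rho^2 / 2 = M / eta, and exp(x) > x gives M E <= eta. *)
  set (N := 2 * M / (eta * rho ^ 2)).
  assert (HN : 0 < N) by (unfold N; apply Rdiv_lt_0_compat; [lra|]; apply Rmult_lt_0_compat; lra).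
  set (E := exp (- (N * rho ^ 2 / 2))).
  assert (HE : 0 < E) by apply exp_pos.
  assert (HME : M * E <= eta).
  { assert (T : N * rho ^ 2 / 2 = M / eta) by (unfold N; field; lra).
    unfold E; rewrite T.
    assert (P : 0 < M / eta) by (apply Rdiv_lt_0_compat; lra).
    pose proof (exp_ineq1 (M / eta) ltac:(lra)).
    rewrite exp_Ropp; apply (Rmult_le_reg_r (exp (M / eta))); [apply exp_pos|].
    rewrite Rmult_assoc, Rinv_l, Rmult_1_r by (pose proof (exp_pos (M / eta)); lra).
    apply Rle_trans with (eta * (M / eta)); [right; field; lra|].
    apply Rmult_le_compat_l; lra. }
  exists (eta * E); split; [now apply Rmult_lt_0_compat|].
  intros f Hf Hh HfM Hf0 z Hz.
  assert (EE : exp (- (N * rho ^ 2)) = E * E) by (unfold E; rewrite <- exp_plus; f_equal; field).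
  assert (Hin : in_rect (- rho) rho 0 rho z) by (destruct Hz; split; nra).
  assert (MP : Cmod (f z * kern N N 0 z) <= eta * E).
  { apply (max_principle (fun z => f z * kern N N 0 z)%C (- rho) rho 0 rho); try lra; auto.
    - intros w; apply ccont_at_mult; [apply Hf|apply ccont_kern].
    - intros w H1 H2; destruct (open_rect _ _ _ _ _ H1 H2) as (d & Hd & H).
      exists d; split; auto; intros v [_ Hv]; specialize (H v Hv).
      apply holo_mult; [apply Hh; tauto|apply holo_kern].
    - intros w Hw; rewrite Cmod_mult.
      destruct (classic (snd w = 0)) as [E0|E0].
      + destruct w as [x y]; simpl in E0; subst y.
        rewrite Cmod_kern; simpl.
        apply Rle_trans with (eta * E * 1); [|lra].
        apply Rmult_le_compat; [apply Cmod_ge_0|left; apply exp_pos| |].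
        * apply Hf0; destruct Hw as [[H _] _]; simpl in H; lra.
        * apply Rle_trans with (exp 0); [apply exp_le; nra|rewrite exp_0; lra].
      + apply Rle_trans with (M * (E * E)).
        * rewrite <- EE; apply Rmult_le_compat; try apply Cmod_ge_0; [apply HfM, Hw|].
          apply kern_sides; auto; lra.
        * rewrite <- Rmult_assoc; apply Rmult_le_compat_r; lra. }
  rewrite Cmod_mult, Cmod_kern in MP.
  destruct Hz as [Hz1 Hz2].
  assert (L : E <= exp (- (N * (fst z ^ 2 - snd z ^ 2) + N * snd z))).
  { unfold E; apply exp_le; apply Ropp_le_contravar.
    assert (fst z ^ 2 - snd z ^ 2 + snd z <= rho ^ 2 / 2) by nra.
    apply (Rmult_le_compat_l N) in H; lra. }
  apply (Rmult_le_reg_r E); auto.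
  eapply Rle_trans; [|exact MP]; apply Rmult_le_compat_l; [apply Cmod_ge_0|auto].
Qed.

(* The difference quotient at w0 is holomorphic off w0 and continuous, so the maximum
   principle bounds it by its values on the border of the square. *)
Lemma slope_bound D w0 s beta l :
  0 < s -> (forall z, in_square w0 s z -> holo_at D z /\ Cmod (D z) <= beta) ->
  cdiff_at D w0 l ->
  Cmod l <= 2 * beta / s /\
  forall z, in_square w0 s z -> Cmod (D z - D w0) <= 2 * beta / s * Cmod (z - w0).
Proof.
  intros Hs HD Hl.
  set (x0 := fst w0 - s); set (x1 := fst w0 + s); set (y0 := snd w0 - s); set (y1 := snd w0 + s).
  assert (Hx : x0 < x1) by (unfold x0, x1; lra).
  assert (Hy : y0 < y1) by (unfold y0, y1; lra).
  set (G := fun z => D (clamp x0 x1 y0 y1 z)).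
  assert (HG : ccont G).
  { apply ccont_clamp; try lra; apply ccont_at_cont_on; intros z Hz.
    apply holo_ccont; now apply HD. }
  assert (HGD : forall z, in_rect x0 x1 y0 y1 z -> G z = D z)
    by (intros z Hz; unfold G; now rewrite clamp_id).
  assert (Hw0in : in_rect x0 x1 y0 y1 w0) by (split; unfold x0, x1, y0, y1; lra).
  assert (Hw0 : x0 < fst w0 < x1 /\ y0 < snd w0 < y1) by (unfold x0, x1, y0, y1; lra).
  destruct (open_rect _ _ _ _ _ (proj1 Hw0) (proj2 Hw0)) as (d0 & Hd0 & Hop).
  assert (HGl : cdiff_at G w0 l).
  { revert Hl; apply cdiff_ext; exists d0; split; auto; intros w Hw; symmetry; apply HGD.
    specialize (Hop w Hw); split; lra. }
  (* The value l makes q continuous at w0, which is just differentiability of D. Holomorphy of q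
     there is never established: [max_principle] admits the puncture. *)
  set (q := fun z => if excluded_middle_informative (z = w0) then l else ((G z - D w0) / (z - w0))%C).
  assert (HG0 : G w0 = D w0) by now apply HGD.
  assert (Hne : forall z, z <> w0 -> (z - w0)%C <> RtoC 0).
  { intros z N E; apply N; replace z with ((z - w0) + w0)%C by ring; rewrite E; ring. }
  assert (Hq0 : q w0 = l) by (unfold q; destruct excluded_middle_informative; tauto).
  assert (Hq1 : forall z, z <> w0 -> q z = ((G z - D w0) / (z - w0))%C)
    by (intros; unfold q; destruct excluded_middle_informative; tauto).
  assert (Hqloc : forall z, z <> w0 -> exists d, 0 < d /\ forall w, Cmod (w - z) < d ->
     ((G w - D w0) * / (w - w0))%C = q w).
  { intros z N; exists (Cmod (z - w0)); split; [now apply Cmod_gt_0, Hne|].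
    intros w Hw; rewrite Hq1; [reflexivity|]; intros ->; rewrite Cmod_sub_sym in Hw; lra. }
  assert (Hq : ccont q).
  { intros z; destruct (classic (z = w0)) as [->|N].
    - intros eps He; destruct (HGl (eps / 2)) as (d & Hd & H); [lra|].
      exists d; split; auto; intros w Hw.
      destruct (classic (w = w0)) as [->|N].
      + replace (q w0 - q w0)%C with (RtoC 0) by ring; rewrite Cmod_0; auto.
      + rewrite Hq0, Hq1 by auto; specialize (H (w - w0)%C Hw).
        replace (w0 + (w - w0))%C with w in H by ring; rewrite HG0 in H.
        assert (Hp : 0 < Cmod (w - w0)) by (apply Cmod_gt_0; auto).
        apply Rle_lt_trans with (eps / 2); [|lra].
        replace ((G w - D w0) / (w - w0) - l)%C
          with ((G w - D w0 - l * (w - w0)) / (w - w0))%C by (field; auto).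
        rewrite Cmod_div by auto; apply (Rmult_le_reg_r (Cmod (w - w0))); auto.
        unfold Rdiv; rewrite Rmult_assoc, Rinv_l, Rmult_1_r by lra; exact H.
    - destruct (Hqloc z N) as (d & Hd & H).
      assert (HH : ccont_at (fun w => (G w - D w0) * / (w - w0))%C z).
      { apply ccont_at_mult; [apply ccont_at_minus; [apply HG|apply ccont_at_const]|].
        apply (ccont_at_comp Cinv (fun w => w - w0)%C); [|apply ccont_at_inv; auto].
        apply ccont_at_minus; [apply ccont_at_id|apply ccont_at_const]. }
      intros eps He; destruct (HH eps He) as (d' & Hd' & H').
      exists (Rmin d d'); split; [now apply Rmin_pos|]; intros w Hw.
      pose proof (Rmin_l d d'); pose proof (Rmin_r d d').
      rewrite <- !H; [apply H'; lra| |lra].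
      replace (z - z)%C with (RtoC 0) by ring; rewrite Cmod_0; auto. }
  assert (Hqh : forall z, x0 < fst z < x1 -> y0 < snd z < y1 -> z <> w0 -> holo_at q z).
  { intros z H1 H2 N; apply (holo_ext (fun w => (G w - D w0) * / (w - w0))%C); auto.
    apply holo_mult.
    - apply holo_minus; [|apply holo_const]; apply holo_clamp; auto.
      apply HD; split; unfold x0, x1, y0, y1 in *; lra.
    - apply holo_inv; [|auto]; apply holo_minus; [apply holo_id|apply holo_const]. }
  assert (MP : forall z, in_rect x0 x1 y0 y1 z -> Cmod (q z) <= 2 * beta / s).
  { apply max_principle; auto.
    - intros z H1 H2.
      destruct (open_rect _ _ _ _ _ H1 H2) as (d & Hd & H).
      destruct (classic (z = w0)) as [->|N].
      + exists d; split; auto; intros w [Hw1 Hw2]; specialize (H w Hw2).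
        apply Hqh; try tauto; intros ->; rewrite Cminus_diag, Cmod_0 in Hw1; lra.
      + exists (Rmin d (Cmod (z - w0))); split.
        { apply Rmin_pos; auto; apply Cmod_gt_0; auto. }
        intros w [_ Hw]; pose proof (Rmin_l d (Cmod (z - w0))); pose proof (Rmin_r d (Cmod (z - w0))).
        specialize (H w ltac:(lra)).
        apply Hqh; try tauto; intros ->; rewrite Cmod_sub_sym in Hw; lra.
    - intros z Hz.
      assert (Hdist : s <= Cmod (z - w0)).
      { pose proof (fst_le_Cmod (z - w0)%C) as K1; pose proof (snd_le_Cmod (z - w0)%C) as K2.
        simpl in K1, K2; apply Rabs_le_between in K1; apply Rabs_le_between in K2.
        destruct Hz as [_ Hz]; unfold x0, x1, y0, y1 in Hz; lra. }
      assert (N : z <> w0) by (intros ->; rewrite Cminus_diag, Cmod_0 in Hdist; lra).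
      rewrite Hq1, Cmod_div by auto.
      destruct Hz as [Hz _].
      assert (Cmod (G z - D w0) <= 2 * beta).
      { rewrite (HGD z Hz); destruct (HD z Hz) as [_ B1]; destruct (HD w0 Hw0in) as [_ B2].
        pose proof (Cmod_triangle_sub (D z) (D w0)); lra. }
      unfold Rdiv; apply Rmult_le_compat; auto; [apply Cmod_ge_0| |].
      + left; apply Rinv_0_lt_compat; lra.
      + apply Rinv_le_contravar; lra. }
  split; [rewrite <- Hq0; now apply MP|].
  intros z Hz; destruct (classic (z = w0)) as [->|N].
  - rewrite !Cminus_diag, Cmod_0; lra.
  - specialize (MP z Hz); rewrite Hq1 in MP by auto.
    rewrite <- (HGD z Hz).
    replace (G z - D w0)%C with ((G z - D w0) / (z - w0) * (z - w0))%C by (field; auto).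
    rewrite Cmod_mult; apply Rmult_le_compat_r; [apply Cmod_ge_0|auto].
Qed.

(** * Uniform limits of holomorphic functions *)

Lemma C_complete (u : nat -> C) :
  (forall eps, 0 < eps -> exists N, forall n m, (N <= n)%nat -> (N <= m)%nat ->
     Cmod (u n - u m) <= eps) ->
  exists l, forall eps, 0 < eps -> exists N, forall n, (N <= n)%nat -> Cmod (u n - l) <= eps.
Proof.
  intros H.
  destruct (Rcomplete.R_complete (fun n : nat => fst (u n))) as [a Ha].
  { intros eps He; destruct (H (eps / 2)) as [N HN]; [lra|]; exists N; intros n m Hn Hm.
    unfold Rdist; eapply Rle_lt_trans; [exact (fst_le_Cmod (u n - u m)%C)|].
    specialize (HN n m Hn Hm); lra. }
  destruct (Rcomplete.R_complete (fun n : nat => snd (u n))) as [b Hb].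
  { intros eps He; destruct (H (eps / 2)) as [N HN]; [lra|]; exists N; intros n m Hn Hm.
    unfold Rdist; eapply Rle_lt_trans; [exact (snd_le_Cmod (u n - u m)%C)|].
    specialize (HN n m Hn Hm); lra. }
  exists (a, b); intros eps He.
  destruct (Ha (eps / 2)) as [N1 H1]; [lra|]; destruct (Hb (eps / 2)) as [N2 H2]; [lra|].
  exists (max N1 N2); intros n Hn.
  specialize (H1 n ltac:(lia)); specialize (H2 n ltac:(lia)); unfold Rdist, Rminus in *.
  eapply Rle_trans; [apply Cmod_le_sum|]; simpl; lra.
Qed.

Lemma inv_INR_small eps : 0 < eps -> exists N, forall n, (N <= n)%nat -> / (INR n + 1) <= eps.
Proof.
  intros He; destruct (INR_unbounded (/ eps)) as [N HN]; exists N; intros n Hn.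
  apply le_INR in Hn; rewrite <- (Rinv_inv eps).
  apply Rinv_le_contravar; [now apply Rinv_0_lt_compat|lra].
Qed.

Lemma inv_INR_pos n : 0 < / (INR n + 1).
Proof. apply Rinv_0_lt_compat; pose proof (pos_INR n); lra. Qed.

(** [slope_bound], applied to differences of approximants, controls both their derivatives at w0 and
    their difference quotients by the sup norm. The derivatives are therefore Cauchy, and a
    three-term estimate carries differentiability to f. *)
Lemma weierstrass f w0 s :
  0 < s ->
  (forall eps, 0 < eps -> exists g, forall z, in_square w0 s z ->
     holo_at g z /\ Cmod (f z - g z) <= eps) ->
  holo_at f w0.
Proof.
  intros Hs Happ.
  assert (Hw0 : in_square w0 s w0) by (split; lra).
  assert (Hch : forall n : nat, exists p : (C -> C) * C, cdiff_at (fst p) w0 (snd p) /\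
    forall z, in_square w0 s z -> holo_at (fst p) z /\ Cmod (f z - fst p z) <= / (INR n + 1)).
  { intros n; destruct (Happ _ (inv_INR_pos n)) as [g Hg].
    destruct (proj1 (Hg w0 Hw0)) as [l Hl]; exists (g, l); auto. }
  apply choice in Hch; destruct Hch as [p Hp].
  set (g := fun n => fst (p n)); set (l := fun n => snd (p n)).
  set (e := fun n => / (INR n + 1)).
  assert (Hsl : forall n m, Cmod (l n - l m) <= 2 * (e n + e m) / s /\ forall z, in_square w0 s z ->
    Cmod ((g n z - g m z) - (g n w0 - g m w0)) <= 2 * (e n + e m) / s * Cmod (z - w0)).
  { intros n m; apply (slope_bound (fun z => g n z - g m z)%C); auto.
    - intros z Hz; destruct (Hp n) as [_ Hn]; destruct (Hp m) as [_ Hm].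
      destruct (Hn z Hz) as [Hn1 Hn2]; destruct (Hm z Hz) as [Hm1 Hm2].
      split; [apply holo_minus; auto|].
      eapply Rle_trans; [apply (Cmod_sub_triangle _ (f z))|].
      rewrite Cmod_sub_sym; apply Rplus_le_compat; auto.
    - destruct (Hp n) as [Hn _]; destruct (Hp m) as [Hm _].
      assert (K := cdiff_plus _ _ _ _ _ Hn (cdiff_scal (-1) _ _ _ Hm)).
      replace (l n - l m)%C with (l n + (-1) * l m)%C by ring.
      revert K; apply cdiff_ext; exists 1; split; [lra|]; intros; unfold g; ring. }
  assert (He : forall n, 0 < e n) by apply inv_INR_pos.
  assert (Hsmall : forall eps, 0 < eps -> exists N, forall n, (N <= n)%nat -> e n <= eps)
    by apply inv_INR_small.
  destruct (C_complete l) as [L HL].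
  { intros eps Heps; destruct (Hsmall (eps * s / 4)) as [N HN].
    { apply Rdiv_lt_0_compat; [|lra]; now apply Rmult_lt_0_compat. }
    exists N; intros n m Hn Hm; eapply Rle_trans; [apply Hsl|].
    specialize (HN n Hn) as K1; specialize (HN m Hm) as K2.
    apply (Rmult_le_reg_r s); auto; unfold Rdiv; rewrite Rmult_assoc, Rinv_l, Rmult_1_r by lra; lra. }
  exists L; intros eps Heps.
  destruct (HL (eps / 3)) as [N1 HN1]; [lra|].
  destruct (Hsmall (eps * s / 6)) as [N2 HN2].
  { apply Rdiv_lt_0_compat; [|lra]; now apply Rmult_lt_0_compat. }
  set (n := max N1 N2).
  specialize (HN1 n ltac:(lia)); specialize (HN2 n ltac:(lia)).
  destruct (Hp n) as [Hn Hn'].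
  destruct (Hn (eps / 3)) as (d & Hd & H); [lra|].
  exists (Rmin d s); split; [now apply Rmin_pos|]; intros h Hh.
  pose proof (Rmin_l d s); pose proof (Rmin_r d s).
  specialize (H h ltac:(lra)); fold (g n) (l n) in H.
  assert (Hin : in_square w0 s (w0 + h)%C).
  { apply Cmod_in_square; replace (w0 + h - w0)%C with h by ring; lra. }
  (* The slope estimate for g_m - g_n is passed to the limit in m. [K0] collects the coefficients of
     e_m: 2 |h| / s from the slope and 2 from approximating f at two points. *)
  assert (K : Cmod ((f (w0 + h)%C - g n (w0 + h)%C) - (f w0 - g n w0)) <= 2 * e n / s * Cmod h).
  { apply le_epsilon; intros eps' He'.
    pose proof (Cmod_ge_0 h) as Ph.
    set (K0 := 2 / s * Cmod h + 2).
    assert (HK0 : 0 < K0).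
    { unfold K0; assert (0 <= 2 / s * Cmod h); [|lra].
      apply Rmult_le_pos; auto; left; apply Rdiv_lt_0_compat; lra. }
    destruct (Hsmall (eps' / K0)) as [N3 HN3]; [now apply Rdiv_lt_0_compat|].
    specialize (HN3 N3 (le_n _)).
    destruct (Hp N3) as [_ H3].
    destruct (H3 _ Hin) as [_ A1]; destruct (H3 _ Hw0) as [_ A2].
    fold (g N3) (e N3) in A1, A2.
    destruct (Hsl N3 n) as [_ A3]; specialize (A3 _ Hin).
    replace (w0 + h - w0)%C with h in A3 by ring.
    replace ((f (w0 + h)%C - g n (w0 + h)%C) - (f w0 - g n w0))%C
      with (((f (w0 + h)%C - g N3 (w0 + h)%C) - (f w0 - g N3 w0))
            + ((g N3 (w0 + h)%C - g n (w0 + h)%C) - (g N3 w0 - g n w0)))%C by ring.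
    eapply Rle_trans; [apply Cmod_triangle|].
    pose proof (Cmod_triangle_sub (f (w0 + h)%C - g N3 (w0 + h)%C) (f w0 - g N3 w0)).
    apply (Rmult_le_compat_r K0) in HN3; [|lra].
    unfold Rdiv in HN3 at 1; rewrite Rmult_assoc, Rinv_l, Rmult_1_r in HN3 by lra.
    replace (2 * (e N3 + e n) / s * Cmod h)
      with (e N3 * (2 / s * Cmod h) + 2 * e n / s * Cmod h) in A3 by (field; lra).
    unfold K0 in HN3; lra. }
  replace (f (w0 + h)%C - f w0 - L * h)%C
    with (((f (w0 + h)%C - g n (w0 + h)%C) - (f w0 - g n w0))
          + ((g n (w0 + h)%C - g n w0 - l n * h) + (l n - L) * h))%C by ring.
  eapply Rle_trans; [apply Cmod_triangle|].
  eapply Rle_trans; [apply Rplus_le_compat_l, Cmod_triangle|].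
  rewrite (Cmod_mult (l n - L)).
  pose proof (Cmod_ge_0 h) as Ph.
  assert (2 * e n / s * Cmod h <= eps / 3 * Cmod h).
  { apply Rmult_le_compat_r; auto; apply (Rmult_le_reg_r s); auto.
    unfold Rdiv; rewrite Rmult_assoc, Rinv_l, Rmult_1_r by lra; lra. }
  assert (Cmod (l n - L) * Cmod h <= eps / 3 * Cmod h) by (apply Rmult_le_compat_r; auto).
  lra.
Qed.

(** * The lacunary function *)

Definition lac_coef (n : nat) : R := exp (- 2 ^ n).

(** The derivative of order l of the sum of [lac_coef n] cos(4^n t): differentiating a cosine shifts
    its phase by PI/2, so one formula covers all orders. *)
Definition lac (l : nat) (t : R) : R :=
  Series (fun n => lac_coef n * (4 ^ n) ^ l * cos (4 ^ n * t + INR l * (PI / 2))).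

Definition lac_sum (l : nat) : R := Series (fun n => lac_coef n * (4 ^ n) ^ l).

Lemma lac_coef_pos n : 0 < lac_coef n.
Proof. apply exp_pos. Qed.

(** This squaring drives both the ratio test and the smallness of the tail behind a given term. *)
Lemma lac_coef_S n : lac_coef (S n) = lac_coef n * lac_coef n.
Proof. unfold lac_coef; rewrite <- exp_plus; f_equal; simpl; ring. Qed.

Lemma lac_coef_le n : lac_coef n <= (/ 2) ^ n.
Proof.
  unfold lac_coef; rewrite exp_Ropp, pow_inv.
  assert (0 < 2 ^ n) by (apply pow_lt; lra).
  apply Rinv_le_contravar; auto; left.
  pose proof (exp_ineq1 (2 ^ n) ltac:(lra)); lra.
Qed.

(** The ratio of consecutive terms is [lac_coef n * 4 ^ l], which tends to 0 for every l; hence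
    derivatives of all orders converge. *)
Lemma ex_series_lac_sum l : ex_series (fun n => lac_coef n * (4 ^ n) ^ l).
Proof.
  assert (P : forall n, 0 < lac_coef n * (4 ^ n) ^ l).
  { intros n; apply Rmult_lt_0_compat; [apply lac_coef_pos|]; apply pow_lt, pow_lt; lra. }
  apply (ex_series_ext (fun n => Rabs (lac_coef n * (4 ^ n) ^ l))).
  { intros n; apply Rabs_pos_eq; left; apply P. }
  apply (ex_series_DAlembert _ 0); [lra|intros n; specialize (P n); lra|].
  apply (is_lim_seq_ext (fun n => lac_coef n * 4 ^ l)).
  { intros n; rewrite Rabs_pos_eq by (left; apply Rdiv_lt_0_compat; apply P).
    rewrite lac_coef_S; simpl; rewrite Rpow_mult_distr; field.
    split; apply Rgt_not_eq; [apply pow_lt, pow_lt; lra|apply lac_coef_pos]. }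
  replace (Finite 0) with (Rbar_mult 0 (4 ^ l)) by (simpl; f_equal; ring).
  apply (is_lim_seq_scal_r _ _ (Finite 0)).
  apply (is_lim_seq_le_le (fun _ => 0) _ (fun n => (/ 2) ^ n)).
  - intros n; split; [left; apply lac_coef_pos|apply lac_coef_le].
  - apply is_lim_seq_const.
  - apply is_lim_seq_geom; rewrite Rabs_pos_eq; lra.
Qed.

Lemma Series_abs_le (a b : nat -> R) :
  (forall n, Rabs (a n) <= b n) -> ex_series b -> Rabs (Series a) <= Series b.
Proof.
  intros H Hb.
  assert (Ha : ex_series (fun n => Rabs (a n))).
  { apply (ex_series_le (K := R_AbsRing) (V := R_CompleteNormedModule) _ b); auto.
    intros n; unfold norm; simpl; unfold abs; simpl; rewrite Rabs_Rabsolu; auto. }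
  eapply Rle_trans; [now apply Series_Rabs|].
  apply Series_le; auto; intros n; split; auto; apply Rabs_pos.
Qed.

Lemma ex_series_lac l t :
  ex_series (fun n => lac_coef n * (4 ^ n) ^ l * cos (4 ^ n * t + INR l * (PI / 2))).
Proof.
  apply (ex_series_le (K := R_AbsRing) (V := R_CompleteNormedModule) _
           (fun n => lac_coef n * (4 ^ n) ^ l)); [|apply ex_series_lac_sum].
  intros n; unfold norm; simpl; unfold abs; simpl.
  assert (0 < lac_coef n * (4 ^ n) ^ l).
  { apply Rmult_lt_0_compat; [apply lac_coef_pos|]; apply pow_lt, pow_lt; lra. }
  rewrite Rabs_mult, (Rabs_pos_eq (lac_coef n * _)) by lra.
  assert (Rabs (cos (4 ^ n * t + INR l * (PI / 2))) <= 1)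
    by (apply Rabs_le; pose proof (COS_bound (4 ^ n * t + INR l * (PI / 2))); lra).
  nra.
Qed.

Lemma lac_bound l t : Rabs (lac l t) <= lac_sum l.
Proof.
  apply Series_abs_le; [|apply ex_series_lac_sum]; intros n.
  assert (0 < lac_coef n * (4 ^ n) ^ l).
  { apply Rmult_lt_0_compat; [apply lac_coef_pos|]; apply pow_lt, pow_lt; lra. }
  rewrite Rabs_mult, (Rabs_pos_eq (lac_coef n * _)) by lra.
  assert (Rabs (cos (4 ^ n * t + INR l * (PI / 2))) <= 1)
    by (apply Rabs_le; pose proof (COS_bound (4 ^ n * t + INR l * (PI / 2))); lra).
  nra.
Qed.

Lemma lac_sum_nonneg l : 0 <= lac_sum l.
Proof. exact (Rle_trans _ _ _ (Rabs_pos _) (lac_bound l 0)). Qed.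

Lemma sin_lip x y : Rabs (sin x - sin y) <= Rabs (x - y).
Proof.
  destruct (MVT_gen sin y x cos) as (c & _ & E).
  - intros; apply is_derive_Reals, derivable_pt_lim_sin.
  - intros; apply derivable_continuous_pt, derivable_pt_sin.
  - rewrite E, Rabs_mult.
    assert (Rabs (cos c) <= 1) by (apply Rabs_le; pose proof (COS_bound c); lra).
    pose proof (Rabs_pos (x - y)); nra.
Qed.

Lemma cos_second_order x d : Rabs (cos (x + d) - cos x + d * sin x) <= d ^ 2.
Proof.
  destruct (MVT_gen cos x (x + d) (fun y => - sin y)) as (c & Hc & E).
  - intros; apply is_derive_Reals, derivable_pt_lim_cos.
  - intros; apply derivable_continuous_pt, derivable_pt_cos.
  - replace (cos (x + d) - cos x + d * sin x) with (- d * (sin c - sin x)) by (rewrite E; ring).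
    rewrite Rabs_mult, Rabs_Ropp.
    pose proof (sin_lip c x).
    assert (Rabs (c - x) <= Rabs d).
    { revert Hc; unfold Rmin, Rmax; destruct Rle_dec; unfold Rabs; repeat destruct Rcase_abs; lra. }
    rewrite <- (pow2_abs d); pose proof (Rabs_pos d); nra.
Qed.

(** The second-order estimate for the cosine is summed term by term; the factor (4^n)^2 from the
    remainder raises the order of the majorant by two. The bound is uniform in t and gives
    differentiability and continuity at every order. *)
Lemma lac_derive l s t :
  Rabs (lac l s - lac l t - (s - t) * lac (S l) t) <= lac_sum (S (S l)) * (s - t) ^ 2.
Proof.
  unfold lac, lac_sum.
  rewrite <- Series_scal_l, <- Series_minus, <- Series_minus, <- Series_scal_r;
    try apply ex_series_lac.
  - apply Series_abs_le.
    + intros n.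
      set (x := 4 ^ n * t + INR l * (PI / 2)); set (d := 4 ^ n * (s - t)).
      replace (4 ^ n * s + INR l * (PI / 2)) with (x + d) by (unfold x, d; ring).
      replace (4 ^ n * t + INR (S l) * (PI / 2)) with (x + PI / 2)
        by (rewrite S_INR; unfold x; ring).
      rewrite (cos_plus x (PI / 2)), cos_PI2, sin_PI2, Rmult_0_r, Rmult_1_r.
      assert (P : 0 < lac_coef n * (4 ^ n) ^ l).
      { apply Rmult_lt_0_compat; [apply lac_coef_pos|]; apply pow_lt, pow_lt; lra. }
      replace (lac_coef n * (4 ^ n) ^ l * cos (x + d) - lac_coef n * (4 ^ n) ^ l * cos x -
        (s - t) * (lac_coef n * (4 ^ n) ^ S l * (0 - sin x)))
        with (lac_coef n * (4 ^ n) ^ l * (cos (x + d) - cos x + d * sin x))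
        by (unfold d; simpl; ring).
      rewrite Rabs_mult, Rabs_pos_eq by lra.
      replace (lac_coef n * (4 ^ n) ^ S (S l) * (s - t) ^ 2)
        with (lac_coef n * (4 ^ n) ^ l * d ^ 2) by (unfold d; simpl; ring).
      apply Rmult_le_compat_l; [lra|apply cos_second_order].
    + apply (ex_series_scal_r), ex_series_lac_sum.
  - apply (ex_series_minus (K := R_AbsRing) (V := R_NormedModule)); apply ex_series_lac.
  - apply (ex_series_scal_l (K := R_AbsRing) (V := R_NormedModule)), ex_series_lac.
Qed.

(** Needed on the lower side of the curve, where the change of variable reverses the parameter. *)
Lemma lac_even t : lac 0 (- t) = lac 0 t.
Proof.
  unfold lac; apply Series_ext; intros n; simpl.
  rewrite <- (cos_neg (4 ^ n * t + 0 * (PI / 2))); do 2 f_equal; ring.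
Qed.

(** The coefficients after index m are squared successively and are at most 1/2, so the tail is
    dominated by a geometric series of ratio 1/2. *)
Lemma lac_head_tail m t :
  Rabs (lac 0 t - sum_f_R0 (fun n => lac_coef n * cos (4 ^ n * t)) m) <= 2 * lac_coef (S m).
Proof.
  set (a := fun n => lac_coef n * cos (4 ^ n * t)).
  assert (E : lac 0 t = Series a).
  { unfold lac, a; apply Series_ext; intros n; simpl. rewrite Rmult_1_r; do 2 f_equal; ring. }
  assert (Ha : ex_series a).
  { apply (ex_series_ext (fun n => lac_coef n * (4 ^ n) ^ 0 * cos (4 ^ n * t + INR 0 * (PI / 2))));
      [|apply ex_series_lac].
    intros n; unfold a; simpl; rewrite Rmult_1_r; do 2 f_equal; ring. }
  rewrite E, (Series_incr_n a (S m)) by (auto; lia); simpl pred.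
  replace (_ + _ - _) with (Series (fun k => a (S m + k)%nat)) by ring.
  assert (G : ex_series (fun k => lac_coef (S m) * (/ 2) ^ k)).
  { apply (ex_series_scal_l (K := R_AbsRing) (V := R_NormedModule)), ex_series_geom; rewrite Rabs_pos_eq; lra. }
  eapply Rle_trans; [apply (Series_abs_le _ (fun k => lac_coef (S m) * (/ 2) ^ k)); auto|].
  - intros k; unfold a; rewrite Rabs_mult, (Rabs_pos_eq (lac_coef _)) by (left; apply lac_coef_pos).
    assert (Rabs (cos (4 ^ (S m + k) * t)) <= 1)
      by (apply Rabs_le; pose proof (COS_bound (4 ^ (S m + k) * t)); lra).
    pose proof (lac_coef_pos (S m + k)).
    assert (lac_coef (S m + k) <= lac_coef (S m) * (/ 2) ^ k).
    { clear - k; induction k as [|k IH]; [rewrite Nat.add_0_r; simpl; lra|].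
      rewrite Nat.add_succ_r, lac_coef_S.
      assert (lac_coef (S m + k) <= / 2).
      { eapply Rle_trans; [apply lac_coef_le|].
        replace (/ 2) with ((/ 2) ^ 1) at 2 by ring.
        rewrite !pow_inv; apply Rinv_le_contravar; [apply pow_lt; lra|].
        apply Rle_pow; [lra|lia]. }
      pose proof (lac_coef_pos (S m + k)); simpl pow.
      rewrite <- Rmult_assoc, (Rmult_comm (lac_coef (S m))), Rmult_assoc.
      apply Rmult_le_compat; lra. }
    nra.
  - rewrite Series_scal_l, Series_geom by (rewrite Rabs_pos_eq; lra).
    right; field.
Qed.

(** * Contour shift and frequency windows *)

Lemma kern_real N xi s t :
  kern N xi s (t, 0) =
    (exp (- (N * t ^ 2)) * cos (xi * (s + t)), exp (- (N * t ^ 2)) * sin (xi * (s + t))).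
Proof.
  unfold kern, cexp; simpl; f_equal; f_equal; f_equal; ring.
Qed.

(* Contour shift: by Goursat the integral along the real axis equals the one along the other
   three sides, where the kernel is exponentially small. *)
Lemma kern_integral_bound f rho M N xi s :
  0 < rho <= / 4 -> 0 <= N -> N / 2 <= xi -> ccont f ->
  (forall z, - rho <= fst z <= rho -> 0 < snd z <= rho -> holo_at f z) ->
  (forall z, in_rect (- rho) rho 0 rho z -> Cmod (f z) <= M) ->
  Rabs (RInt (fun t => fst (f (t, 0) * kern N xi s (t, 0))%C) (- rho) rho)
    <= 4 * rho * (M * exp (- (N * rho ^ 2))).
Proof.
  intros Hr HN Hxi Hf Hh HM.
  set (E := M * exp (- (N * rho ^ 2))).
  (* The factor i turns the wanted real part into an imaginary part, the component that the form
     Im(g dz) integrates along horizontal sides. *)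
  set (g := fun z => (Ci * (f z * kern N xi s z))%C).
  assert (Hg : ccont g).
  { intros z; apply ccont_at_mult; [apply ccont_at_const|].
    apply ccont_at_mult; [apply Hf|apply ccont_kern]. }
  assert (Hgh : forall z, - rho <= fst z <= rho -> 0 < snd z <= rho -> holo_at g z).
  { intros z H1 H2; apply holo_mult; [apply holo_const|].
    apply holo_mult; [auto|apply holo_kern]. }
  assert (HgE : forall z, on_border (- rho) rho 0 rho z ->
    snd z <> 0 \/ fst z = - rho \/ fst z = rho -> Cmod (g z) <= E).
  { intros z Hz1 Hz2; unfold g; rewrite !Cmod_mult, Cmod_Ci, Rmult_1_l.
    apply Rmult_le_compat; try apply Cmod_ge_0; [apply HM, Hz1|now apply kern_sides]. }
  set (P := fun x y => snd (g (x, y))); set (Q := fun x y => fst (g (x, y))).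
  assert (HP : cont2 P) by (apply ccont_snd, Hg); assert (HQ : cont2 Q) by (apply ccont_fst, Hg).
  assert (CP : forall y x, continuous (fun t => P t y) x) by (intros; now apply cont2_h).
  assert (CQ : forall x y, continuous (fun t => Q x t) y) by (intros; now apply cont2_v).
  assert (HE : 0 <= E).
  { apply Rle_trans with (Cmod (g (rho, rho))); [apply Cmod_ge_0|].
    apply HgE; [split; [split; simpl; lra|simpl; auto]|simpl; lra]. }
  replace (RInt _ _ _) with (RInt (fun t => P t 0) (- rho) rho).
  2: { apply RInt_ext; intros t _; unfold P, g; simpl; ring. }
  (* f is holomorphic only above the axis, so Goursat is applied above height eta; uniform
     continuity then lets eta tend to 0. The top contributes 2 rho E and the two vertical sides at
     most 2 rho E. *)
  assert (Heta : forall eta, 0 < eta < rho -> Rabs (RInt (fun t => P t eta) (- rho) rho) <= 4 * rho * E).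
  { intros eta Heta.
    assert (G := goursat P Q (- rho) rho eta rho ltac:(lra) ltac:(lra) HP HQ).
    specialize (G ltac:(intros x y Hx Hy; apply holo_closed_at, Hgh; simpl; lra)).
    unfold contour in G; rewrite RInt_minus_R in G by auto.
    assert (B1 : Rabs (RInt (fun t => P t rho) (- rho) rho) <= (rho - - rho) * E).
    { apply RInt_bound; [lra|auto|]; intros t Ht.
      eapply Rle_trans; [apply snd_le_Cmod|]; apply HgE;
        [split; [split; simpl; lra|simpl; auto]|simpl; lra]. }
    assert (B2 : Rabs (RInt (fun t => Q rho t - Q (- rho) t) eta rho) <= (rho - eta) * (E + E)).
    { apply RInt_bound; [lra| |].
      - intros; apply (continuous_minus (V := R_NormedModule)); auto.
      - intros t Ht; eapply Rle_trans; [apply Rabs_triang|]; rewrite Rabs_Ropp.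
        apply Rplus_le_compat; (eapply Rle_trans; [apply fst_le_Cmod|]; apply HgE;
          [split; [split; simpl; lra|simpl; auto]|simpl; auto]). }
    apply Rabs_le_between in B1; apply Rabs_le_between in B2; apply Rabs_le.
    assert ((rho - eta) * (E + E) <= rho * (E + E)) by (apply Rmult_le_compat_r; lra).
    lra. }
  apply le_epsilon; intros eps He.
  assert (He' : 0 < eps / (2 * rho)) by (apply Rdiv_lt_0_compat; lra).
  destruct (uniform_continuity_2d_1d P (- rho) rho 0) with (eps := mkposreal _ He') as [d Hd].
  { intros; apply HP. }
  set (eta := Rmin d rho / 2).
  assert (0 < Rmin d rho) by (apply Rmin_pos; [apply cond_pos|lra]).
  pose proof (Rmin_l d rho); pose proof (Rmin_r d rho); pose proof (cond_pos d).
  specialize (Heta eta ltac:(unfold eta; lra)).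
  assert (B : Rabs (RInt (fun t => P t 0 - P t eta) (- rho) rho) <= (rho - - rho) * (eps / (2 * rho))).
  { apply RInt_bound; [lra| |].
    - intros; apply (continuous_minus (V := R_NormedModule)); auto.
    - intros t Ht; left; apply (Hd t eta t 0); try lra; unfold eta; try lra.
      rewrite Rminus_diag, Rabs_R0; lra. }
  rewrite RInt_minus_R in B by auto.
  replace ((rho - - rho) * (eps / (2 * rho))) with eps in B by (field; lra).
  apply Rabs_le_between in B; apply Rabs_le_between in Heta; apply Rabs_le; lra.
Qed.

(** The constant function 1 extends everywhere, so the contour shift bounds the Fourier integral of
    the truncated Gaussian itself. *)
Lemma gauss_cos_bound rho N xi s :
  0 < rho <= / 4 -> 0 <= N -> N / 2 <= xi ->
  Rabs (RInt (fun t => exp (- (N * t ^ 2)) * cos (xi * (s + t))) (- rho) rho)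
    <= 4 * rho * exp (- (N * rho ^ 2)).
Proof.
  intros Hr HN Hxi.
  assert (K := kern_integral_bound (fun _ => 1) rho 1 N xi s Hr HN Hxi).
  rewrite Rmult_1_l in K.
  rewrite (RInt_ext _ (fun t => fst (1 * kern N xi s (t, 0))%C)).
  - apply K.
    + intros z; apply ccont_at_const.
    + intros; apply holo_const.
    + intros; rewrite Cmod_1; lra.
  - intros t _; rewrite kern_real; simpl; Rring.
Qed.

Lemma continuous_cos_lin a b x : continuous (fun t => cos (a * (b + t))) x.
Proof.
  apply (continuous_comp (fun t => a * (b + t)) cos).
  - apply (continuous_mult (K := R_AbsRing)); [apply continuous_const|].
    apply (continuous_plus (V := R_NormedModule)); [apply continuous_const|apply continuous_id].
  - apply continuity_pt_filterlim, derivable_continuous_pt, derivable_pt_cos.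
Qed.

Lemma continuous_gauss N x : continuous (fun t => exp (- (N * t ^ 2))) x.
Proof.
  apply (continuous_ext (fun t => exp ((- N) * (t * t)))); [intros; f_equal; ring|].
  apply (continuous_comp (fun t => (- N) * (t * t)) exp).
  - repeat (apply (continuous_mult (K := R_AbsRing));
      try apply continuous_const; try apply continuous_id).
  - apply continuity_pt_filterlim, derivable_continuous_pt, derivable_pt_exp.
Qed.

Lemma continuous_Rmult (f g : R -> R) x :
  continuous f x -> continuous g x -> continuous (fun t => f t * g t) x.
Proof. apply (continuous_mult (K := R_AbsRing)). Qed.

Lemma continuous_Rplus (f g : R -> R) x :
  continuous f x -> continuous g x -> continuous (fun t => f t + g t) x.
Proof. apply (continuous_plus (V := R_NormedModule)). Qed.

Lemma continuous_Rminus (f g : R -> R) x :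
  continuous f x -> continuous g x -> continuous (fun t => f t - g t) x.
Proof. apply (continuous_minus (V := R_NormedModule)). Qed.

Lemma RInt_scal_R (f : R -> R) k a b :
  (forall x, continuous f x) -> RInt (fun t => k * f t) a b = k * RInt f a b.
Proof. intros H; apply (RInt_scal (V := R_CompleteNormedModule)); now apply ex_RInt_cont. Qed.

Lemma RInt_plus_R (f g : R -> R) a b :
  (forall x, continuous f x) -> (forall x, continuous g x) ->
  RInt (fun x => f x + g x) a b = RInt f a b + RInt g a b.
Proof. intros; apply (RInt_plus (V := R_CompleteNormedModule)); now apply ex_RInt_cont. Qed.

(* Integration against the window picks out the frequency N. *)
Definition window (N s t : R) : R := exp (- (N * t ^ 2)) * cos (N * (s + t)).

Lemma continuous_window N s x : continuous (window N s) x.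
Proof. apply continuous_Rmult; [apply continuous_gauss|apply continuous_cos_lin]. Qed.

Lemma window_le N s t : 0 <= N -> Rabs (window N s t) <= 1.
Proof.
  intros HN; unfold window; rewrite Rabs_mult, (Rabs_pos_eq (exp _)) by (left; apply exp_pos).
  assert (Rabs (cos (N * (s + t))) <= 1) by (apply Rabs_le; pose proof (COS_bound (N * (s + t))); lra).
  assert (exp (- (N * t ^ 2)) <= 1).
  { rewrite <- exp_0; apply exp_le; pose proof (pow2_ge_0 t); nra. }
  pose proof (exp_pos (- (N * t ^ 2))); pose proof (Rabs_pos (cos (N * (s + t)))); nra.
Qed.

Lemma cos_mult_cos a b : cos a * cos b = (cos (a + b) + cos (a - b)) / 2.
Proof. rewrite cos_plus, cos_minus; field. Qed.

Lemma window_cos N s xi rho :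
  RInt (fun t => cos (xi * (s + t)) * window N s t) (- rho) rho =
  (RInt (fun t => exp (- (N * t ^ 2)) * cos ((N + xi) * (s + t))) (- rho) rho +
   RInt (fun t => exp (- (N * t ^ 2)) * cos ((N - xi) * (s + t))) (- rho) rho) / 2.
Proof.
  assert (C : forall k x, continuous (fun t => exp (- (N * t ^ 2)) * cos (k * (s + t))) x)
    by (intros; apply continuous_Rmult; [apply continuous_gauss|apply continuous_cos_lin]).
  rewrite <- RInt_plus_R by auto.
  unfold Rdiv; rewrite Rmult_comm, <- RInt_scal_R by (intros; apply continuous_Rplus; auto).
  apply RInt_ext; intros t _; unfold window.
  transitivity (exp (- (N * t ^ 2)) * (cos (N * (s + t)) * cos (xi * (s + t)))); [Rring|].
  rewrite cos_mult_cos, <- Rmult_plus_distr_r, <- Rmult_minus_distr_r.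
  lazymatch goal with |- @eq _ ?a ?b => change (@eq R a b) end; field.
Qed.

(** Both N + xi and N - xi are at least N/2, the threshold of the contour shift. *)
Lemma window_low_freq N s xi rho :
  0 < rho <= / 4 -> 0 <= xi -> xi <= N / 2 ->
  Rabs (RInt (fun t => cos (xi * (s + t)) * window N s t) (- rho) rho)
    <= 4 * rho * exp (- (N * rho ^ 2)).
Proof.
  intros Hr H0 H1; rewrite window_cos.
  assert (K1 := gauss_cos_bound rho N (N + xi) s Hr ltac:(lra) ltac:(lra)).
  assert (K2 := gauss_cos_bound rho N (N - xi) s Hr ltac:(lra) ltac:(lra)).
  apply Rabs_le_between in K1; apply Rabs_le_between in K2; apply Rabs_le; lra.
Qed.

(** At xi = N the difference frequency is 0 and leaves a pure Gaussian, at least exp(-1) on [0, 1/X]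
    because N = X^2. The halving comes from the product-to-sum formula. *)
Lemma window_peak X s rho :
  0 < rho <= / 4 -> 0 < X -> / X <= rho ->
  exp (- 1) / X / 2 - 4 * rho * exp (- (X ^ 2 * rho ^ 2)) <=
  RInt (fun t => cos (X ^ 2 * (s + t)) * window (X ^ 2) s t) (- rho) rho.
Proof.
  intros Hr HX HXr; rewrite window_cos.
  assert (HiX : 0 < / X) by now apply Rinv_0_lt_compat.
  assert (K1 := gauss_cos_bound rho (X ^ 2) (X ^ 2 + X ^ 2) s Hr ltac:(nra) ltac:(nra)).
  set (f := fun t => exp (- (X ^ 2 * t ^ 2)) * cos ((X ^ 2 - X ^ 2) * (s + t))).
  assert (Ef : forall t, f t = exp (- (X ^ 2 * t ^ 2))).
  { intros t; unfold f; rewrite Rminus_diag, Rmult_0_l, cos_0; ring. }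
  assert (Cf : forall x, continuous f x)
    by (intros; apply continuous_Rmult; [apply continuous_gauss|apply continuous_cos_lin]).
  assert (L : exp (- 1) / X <= RInt f (- rho) rho).
  { rewrite (RInt_split f (- rho) 0 rho), (RInt_split f 0 (/ X) rho) by auto.
    assert (pos : forall a b, a <= b -> 0 <= RInt f a b).
    { intros a b Hab; replace 0 with (RInt (fun _ : R => 0) a b) by (rewrite RInt_const_R; Rring).
      apply RInt_le; auto; try (apply ex_RInt_cont; auto; intros; apply continuous_const).
      intros x _; rewrite Ef; left; apply exp_pos. }
    assert (RInt (fun _ : R => exp (- 1)) 0 (/ X) <= RInt f 0 (/ X)).
    { apply RInt_le; try (apply ex_RInt_cont; auto; intros; apply continuous_const); [lra|].
      intros x Hx; rewrite Ef; apply exp_le; enough (X ^ 2 * x ^ 2 <= 1) by lra.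
      assert (X * x <= 1).
      { apply Rle_trans with (X * / X); [apply Rmult_le_compat_l; lra|right; field; lra]. }
      assert (0 <= X * x) by (apply Rmult_le_pos; lra).
      replace (X ^ 2 * x ^ 2) with ((X * x) * (X * x)) by ring.
      apply Rle_trans with (1 * 1); [apply Rmult_le_compat; lra|lra]. }
    rewrite RInt_const_R in H.
    specialize (pos (- rho) 0 ltac:(lra)) as P1; specialize (pos (/ X) rho HXr) as P2.
    unfold Rdiv; lra. }
  apply Rabs_le_between in K1.
  unfold Rdiv in *; pose proof (exp_pos (- (X ^ 2 * rho ^ 2))).
  assert (0 <= 4 * rho * exp (- (X ^ 2 * rho ^ 2))) by (apply Rmult_le_pos; lra).
  fold f; lra.
Qed.

Lemma RInt_sum_bound (a : nat -> R -> R) (w : R -> R) B lo hi p :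
  (forall n x, continuous (a n) x) -> (forall x, continuous w x) ->
  (forall n, (n <= p)%nat -> Rabs (RInt (fun t => a n t * w t) lo hi) <= B) ->
  (forall x, continuous (fun t => sum_f_R0 (fun n => a n t) p) x) /\
  Rabs (RInt (fun t => sum_f_R0 (fun n => a n t) p * w t) lo hi) <= (INR p + 1) * B.
Proof.
  intros Ha Hw; induction p as [|p IH]; intros HB.
  - split; [intros; apply Ha|]. simpl INR; rewrite Rplus_0_l, Rmult_1_l; apply HB; auto.
  - destruct IH as [C IH]; [intros; apply HB; lia|]; split.
    + intros x; apply continuous_Rplus; [apply C|apply Ha].
    + rewrite (RInt_ext _ (fun t => sum_f_R0 (fun n => a n t) p * w t + a (S p) t * w t))
        by (intros; simpl; Rring).
      rewrite RInt_plus_R; try (intros; apply continuous_Rmult; auto).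
      eapply Rle_trans; [apply Rabs_triang|].
      specialize (HB (S p) (le_n _)); rewrite S_INR; lra.
Qed.

Lemma INR_le_pow2 m : INR m + 1 <= 2 ^ m.
Proof.
  induction m as [|m IH]; [simpl; lra|].
  rewrite S_INR; simpl pow; pose proof (pos_INR m); lra.
Qed.

Lemma pow4_pow2 m : 4 ^ m = (2 ^ m) ^ 2.
Proof. rewrite <- pow_mult, Nat.mul_comm, pow_mult; f_equal; ring. Qed.

(** The series is cut at N = 4^(m+1). Lower frequencies are at most N/4 and nearly invisible to the
    window, the term at N produces the peak, and the tail is at most 2 c^2 pointwise with c its
    coefficient, hence at most c^2 after integration. Throughout, 4 rho <= 1 absorbs the interval
    length. *)
Lemma lac_window_lower m s rho (h : R -> R) :
  0 < rho <= / 4 -> / 2 ^ S m <= rho -> (forall x, continuous h x) ->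
  (forall t, h t = lac 0 (s + t)) ->
  lac_coef (S m) * (exp (- 1) / 2 ^ S m / 2) <=
    Rabs (RInt (fun t => h t * window (4 ^ S m) s t) (- rho) rho) +
    (2 ^ S m + 1) * exp (- (4 ^ S m * rho ^ 2)) + lac_coef (S m) * lac_coef (S m).
Proof.
  intros Hr HX Ch Hh.
  set (X := 2 ^ S m) in *; set (N := 4 ^ S m).
  assert (HN : N = X ^ 2) by apply pow4_pow2.
  assert (HXp : 0 < X) by (apply pow_lt; lra).
  set (E := exp (- (N * rho ^ 2))).
  assert (HE : 0 < E) by apply exp_pos.
  set (c := lac_coef (S m)).
  assert (Hc : 0 < c) by apply lac_coef_pos.
  assert (Hc1 : forall n, lac_coef n <= 1).
  { intros n; unfold lac_coef; rewrite <- exp_0; apply exp_le.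
    assert (0 < 2 ^ n) by (apply pow_lt; lra); lra. }
  set (a := fun n t => lac_coef n * cos (4 ^ n * (s + t))).
  assert (Ca : forall n x, continuous (a n) x).
  { intros; apply continuous_Rmult; [apply continuous_const|apply continuous_cos_lin]. }
  set (w := window N s).
  assert (Cw : forall x, continuous w x) by apply continuous_window.
  assert (Hp : forall n k, 0 < k -> 0 < k ^ n) by (intros; apply pow_lt; auto).
  destruct (RInt_sum_bound a w (4 * rho * E) (- rho) rho m Ca Cw) as [Cs Bs].
  { intros n Hn.
    rewrite (RInt_ext _ (fun t => lac_coef n * (cos (4 ^ n * (s + t)) * w t)))
      by (intros; unfold a; Rring).
    rewrite RInt_scal_R by (intros; apply continuous_Rmult; auto; apply continuous_cos_lin).
    rewrite Rabs_mult, Rabs_pos_eq by (left; apply lac_coef_pos).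
    assert (W : Rabs (RInt (fun t => cos (4 ^ n * (s + t)) * w t) (- rho) rho)
                <= 4 * rho * E).
    { apply window_low_freq; auto; [left; apply Hp; lra|].
      assert (4 ^ n <= 4 ^ m) by (apply Rle_pow; [lra|auto]).
      assert (0 < 4 ^ m) by (apply Hp; lra).
      unfold N; simpl pow; lra. }
    specialize (Hc1 n); pose proof (lac_coef_pos n).
    pose proof (Rabs_pos (RInt (fun t => cos (4 ^ n * (s + t)) * w t) (- rho) rho)).
    nra. }
  set (S0 := fun t => sum_f_R0 (fun n => a n t) m) in *.
  set (T := fun t => h t - (S0 t + a (S m) t)).
  assert (CT : forall x, continuous T x).
  { intros; apply continuous_Rminus; auto; apply continuous_Rplus; auto. }
  assert (HT : forall t, Rabs (T t) <= 2 * (c * c)).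
  { intros t; unfold T; rewrite Hh.
    assert (K := lac_head_tail (S m) (s + t)); rewrite lac_coef_S in K; exact K. }
  assert (BT : Rabs (RInt (fun t => T t * w t) (- rho) rho) <= (rho - - rho) * (2 * (c * c))).
  { apply RInt_bound; [lra|intros; apply continuous_Rmult; auto|].
    intros t _; rewrite Rabs_mult.
    assert (W : Rabs (w t) <= 1) by (apply window_le; left; apply Hp; lra).
    specialize (HT t); pose proof (Rabs_pos (w t)); pose proof (Rabs_pos (T t)); nra. }
  assert (Peak := window_peak X s rho Hr HXp HX); rewrite <- HN in Peak; fold E w in Peak.
  assert (Split : @eq R (RInt (fun t => h t * w t) (- rho) rho) (
    RInt (fun t => S0 t * w t) (- rho) rho +
    c * RInt (fun t => cos (N * (s + t)) * w t) (- rho) rho +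
    RInt (fun t => T t * w t) (- rho) rho)).
  { assert (Cc : forall x, continuous (fun t => cos (N * (s + t)) * w t) x)
      by (intros; apply continuous_Rmult; auto; apply continuous_cos_lin).
    rewrite <- RInt_scal_R by auto.
    rewrite <- RInt_plus_R.
    2: { intros; apply continuous_Rmult; auto. }
    2: { intros; apply continuous_Rmult; auto; apply continuous_const. }
    rewrite <- RInt_plus_R.
    2: { intros; apply continuous_Rplus; apply continuous_Rmult; auto; apply continuous_const. }
    2: { intros; apply continuous_Rmult; auto. }
    apply RInt_ext; intros t _; unfold T, a, c, N; Rring. }
  fold N w.
  set (I := RInt (fun t => h t * w t) (- rho) rho : R) in *.
  change (Rabs (RInt (fun t => S0 t * w t) (- rho) rho) <= (INR m + 1) * (4 * rho * E)) in Bs.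
  apply Rabs_le_between in Bs; apply Rabs_le_between in BT.
  pose proof (Rle_abs I).
  assert (Hm : INR m + 1 <= X).
  { pose proof (INR_le_pow2 m); pose proof (Hp m 2 ltac:(lra)); unfold X; simpl pow; lra. }
  assert (P1 : (INR m + 1) * (4 * rho * E) <= X * E).
  { apply Rmult_le_compat; try lra; [pose proof (pos_INR m); lra|nra|nra]. }
  assert (P2 : c * (4 * rho * E) <= 1 * E).
  { apply Rmult_le_compat; try lra; [nra|apply Hc1|nra]. }
  assert (P3 : (rho - - rho) * (2 * (c * c)) <= c * c) by nra.
  apply (Rmult_le_compat_l c) in Peak; [|lra].
  lra.
Qed.

Lemma X_exp_bound X : 0 < X -> X * exp (- X) <= 4 / X.
Proof.
  intros HX.
  assert (H : X / 2 <= exp (X / 2)) by (pose proof (exp_ineq1 (X / 2) ltac:(lra)); lra).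
  assert (H2 : X * X / 4 <= exp X).
  { replace X with (X / 2 + X / 2) at 3 by field; rewrite exp_plus; nra. }
  rewrite exp_Ropp; pose proof (exp_pos X).
  apply (Rmult_le_reg_r (exp X)); auto.
  rewrite Rmult_assoc, Rinv_l, Rmult_1_r by lra.
  apply Rle_trans with (4 / X * (X * X / 4)); [right; field; lra|].
  apply Rmult_le_compat_l; auto; left; apply Rdiv_lt_0_compat; lra.
Qed.

(** With X = 2^(m+1) and c = exp(-X), the contour shift bounds the window integral by M exp(-X^2
    rho^2), eventually below M c^3, whereas the peak is of order c / X. A bound M is available
    because mu is continuous on a closed rectangle. *)
Lemma lacunary_no_extension rho0 s mu :
  0 < rho0 -> ccont mu ->
  (forall z, - rho0 < fst z < rho0 -> 0 < snd z < rho0 -> holo_at mu z) ->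
  (forall t, - rho0 <= t <= rho0 -> mu (t, 0) = (lac 0 (s + t), 0)) ->
  (forall x, continuous (fun t => lac 0 (s + t)) x) ->
  False.
Proof.
  intros Hr0 Cmu Hmu Hb Clac.
  (* Halving puts the three outer sides where mu is holomorphic; 1/4 is the limit set by
     [kern_sides]. *)
  set (rho := Rmin (rho0 / 2) (/ 4)).
  assert (Hr : 0 < rho <= / 4) by (split; [apply Rmin_pos; lra|apply Rmin_r]).
  assert (Hrr : rho <= rho0 / 2) by apply Rmin_l.
  destruct (max_attained (in_rect (- rho) rho 0 rho) (fun z => Cmod (mu z) ^ 2) (- rho) rho 0 rho)
    as (zm & _ & Hmax); try lra; auto.
  { apply in_rect_closed. }
  { exists (0, 0); split; simpl; lra. }
  { intros z _; apply rcont_Cmod2, Cmu. }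
  set (M := Cmod (mu zm)).
  assert (HM : forall z, in_rect (- rho) rho 0 rho z -> Cmod (mu z) <= M).
  { intros z Hz; specialize (Hmax z Hz); pose proof (Cmod_ge_0 (mu zm)).
    apply Rsqr_incr_0_var; auto; rewrite !Rsqr_pow2; exact Hmax. }
  assert (HM0 : 0 <= M) by apply Cmod_ge_0.
  assert (Hrho2 : 0 < rho ^ 2) by (apply pow_lt; lra).
  (* Each summand serves one demand on X: X > 1, X rho^2 >= 3 so that E <= c^3, 1/X <= rho for the
     peak, and 4 (M + 3) / X < 1/6 for the final contradiction. *)
  destruct (INR_unbounded (1 + 3 / rho ^ 2 + / rho + 24 * (M + 3))) as [m Hm].
  set (X := 2 ^ S m).
  assert (HmX : INR m < X).
  { pose proof (INR_le_pow2 m); unfold X; simpl pow; pose proof (pos_INR m); lra. }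
  assert (Q1 : 0 < 3 / rho ^ 2) by (apply Rdiv_lt_0_compat; lra).
  assert (Q2 : 0 < / rho) by (apply Rinv_0_lt_compat; lra).
  assert (HX1 : 1 < X) by lra.
  assert (HXr : / X <= rho).
  { rewrite <- (Rinv_inv rho); apply Rinv_le_contravar; lra. }
  assert (L := lac_window_lower m s rho _ Hr HXr Clac (fun t => eq_refl)).
  assert (U := kern_integral_bound mu rho M (4 ^ S m) (4 ^ S m) s Hr).
  assert (HN : 0 <= 4 ^ S m) by (left; apply pow_lt; lra).
  specialize (U HN ltac:(lra) Cmu).
  specialize (U ltac:(intros z H1 H2; apply Hmu; lra) HM).
  rewrite (RInt_ext _ (fun t => lac 0 (s + t) * window (4 ^ S m) s t)) in U.
  2: { intros t Ht; rewrite Rmin_left, Rmax_right in Ht by lra.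
       rewrite Hb, kern_real by lra; unfold window; simpl; Rring. }
  fold X in L.
  rewrite pow4_pow2 in L, U; fold X in L, U.
  set (E := exp (- (X ^ 2 * rho ^ 2))) in *.
  set (c := lac_coef (S m)) in *.
  assert (Hc : c = exp (- X)) by reflexivity.
  assert (HE : 0 < E) by apply exp_pos.
  assert (HEX : E <= exp (- X) * (exp (- X) * exp (- X))).
  { rewrite <- !exp_plus; apply exp_le.
    assert (3 <= X * rho ^ 2).
    { apply Rle_trans with (3 / rho ^ 2 * rho ^ 2); [right; field; lra|].
      apply Rmult_le_compat_r; lra. }
    nra. }
  assert (H4 : 4 * rho * (M * E) <= M * E) by (assert (0 <= M * E) by nra; nra).
  assert (L' : c * (exp (- 1) / X / 2) <= (M + X + 1) * E + c * c) by lra.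
  assert (He1 : / 3 <= exp (- 1)).
  { replace (- 1) with (Ropp 1) by ring.
    rewrite exp_Ropp; apply Rinv_le_contravar; [apply exp_pos|apply exp_le_3]. }
  assert (Hc0 : 0 < c) by apply lac_coef_pos.
  assert (HcX : X * c <= 4 / X) by (rewrite Hc; apply X_exp_bound; lra).
  assert (Hcs : c <= 1).
  { rewrite Hc, <- exp_0; apply exp_le; lra. }
  assert (HXc1 : X * c <= 1).
  { rewrite Hc, exp_Ropp; apply (Rmult_le_reg_r (exp X)); [apply exp_pos|].
    rewrite Rmult_assoc, Rinv_l by (pose proof (exp_pos X); lra).
    pose proof (exp_ineq1 X ltac:(lra)); lra. }
  rewrite <- Hc in HEX.
  (* After division by c / X the peak leaves exp(-1) / 2 >= 1/6. The errors become (M + X + 1) X c^2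
     + X c, which is O(1/X) because X c <= 4 / X. *)
  assert (F : / 6 <= (M + 3) * (4 / X)).
  { apply Rle_trans with (exp (- 1) / 2); [lra|].
    apply Rle_trans with ((M + X + 1) * (X * (c * c)) + X * c).
    - apply (Rmult_le_reg_l (c / X)); [apply Rdiv_lt_0_compat; lra|].
      apply Rle_trans with (c * (exp (- 1) / X / 2)); [right; field; lra|].
      apply Rle_trans with ((M + X + 1) * (c * (c * c)) + c * c).
      + assert ((M + X + 1) * E <= (M + X + 1) * (c * (c * c))) by (apply Rmult_le_compat_l; lra).
        lra.
      + right; field; lra.
    - assert (G1 : (M + X + 1) * c <= M + 2).
      { assert (M * c <= M * 1) by (apply Rmult_le_compat_l; lra). lra. }
      assert (G2 : (M + X + 1) * c * (X * c) <= (M + 2) * (4 / X)).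
      { apply Rmult_le_compat; auto; apply Rmult_le_pos; lra. }
      lra. }
  assert (F2 : (M + 3) * (4 / X) < / 6).
  { apply (Rmult_lt_reg_r X); [lra|].
    replace ((M + 3) * (4 / X) * X) with (4 * (M + 3)) by (field; lra). lra. }
  lra.
Qed.

Lemma lac_continuous x : forall s, continuous (fun t => lac 0 (s + t)) x.
Proof.
  intros s; apply continuity_pt_filterlim, continuity_pt_locally; intros eps.
  pose proof (lac_sum_nonneg 1) as K1; pose proof (lac_sum_nonneg 2) as K2.
  set (K := 1 + lac_sum 1 + lac_sum 2).
  assert (HK : 0 < K) by (unfold K; lra).
  assert (Hd : 0 < Rmin 1 (eps / K)).
  { apply Rmin_pos; [lra|]; apply Rdiv_lt_0_compat; [apply cond_pos|auto]. }
  exists (mkposreal _ Hd); intros y Hy.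
  change (Rabs (y - x) < Rmin 1 (eps / K)) in Hy.
  pose proof (Rmin_l 1 (eps / K)); pose proof (Rmin_r 1 (eps / K)).
  assert (D1 := lac_derive 0 (s + y) (s + x)).
  replace (s + y - (s + x)) with (y - x) in D1 by ring.
  pose proof (lac_bound 1 (s + x)) as D2.
  pose proof (Rabs_pos (y - x)).
  apply Rle_lt_trans with (K * Rabs (y - x)).
  - replace (lac 0 (s + y) - lac 0 (s + x))
      with ((lac 0 (s + y) - lac 0 (s + x) - (y - x) * lac 1 (s + x)) + (y - x) * lac 1 (s + x)) by ring.
    eapply Rle_trans; [apply Rabs_triang|]; rewrite Rabs_mult.
    rewrite <- pow2_abs in D1.
    assert (lac_sum 2 * Rabs (y - x) ^ 2 <= lac_sum 2 * Rabs (y - x))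
      by (apply Rmult_le_compat_l; nra).
    assert (Rabs (y - x) * Rabs (lac 1 (s + x)) <= Rabs (y - x) * lac_sum 1)
      by (apply Rmult_le_compat_l; auto).
    unfold K; lra.
  - apply Rlt_le_trans with (K * (eps / K)); [apply Rmult_lt_compat_l; lra|right; field; lra].
Qed.

Lemma lac_tower a b k eps :
  Ck_tower a b k (fun t => (eps * lac 0 t, 0)) (fun l t => (eps * lac l t, 0)).
Proof.
  assert (HD : forall l, has_deriv_ab a b (fun t => (eps * lac l t, 0)) (fun t => (eps * lac (S l) t, 0))).
  { intros l t _ e He.
    set (K := Rabs eps * lac_sum (S (S l)) + 1).
    assert (HK : 0 < K) by (pose proof (Rmult_le_pos _ _ (Rabs_pos eps) (lac_sum_nonneg (S (S l)))); unfold K; lra).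
    exists (e / K); split; [now apply Rdiv_lt_0_compat|]; intros s _ Hs.
    rewrite Cnorm_Cmod; unfold Csub, Cmul, Cof; simpl.
    replace (_ - _ - _, _) with
      (RtoC (eps * (lac l s - lac l t - (s - t) * lac (S l) t))) by (apply injective_projections; simpl; ring).
    rewrite Cmod_R, Rabs_mult.
    pose proof (lac_derive l s t) as D; rewrite <- pow2_abs in D.
    pose proof (Rabs_pos (s - t)); pose proof (Rabs_pos eps).
    apply Rle_trans with (K * Rabs (s - t) * Rabs (s - t)).
    - apply Rle_trans with (Rabs eps * (lac_sum (S (S l)) * Rabs (s - t) ^ 2)).
      + apply Rmult_le_compat_l; auto.
      + unfold K; assert (0 <= Rabs (s - t) ^ 2) by apply pow2_ge_0; nra.
    - apply Rmult_le_compat_r; auto.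
      apply Rle_trans with (K * (e / K)); [apply Rmult_le_compat_l; lra|right; field; lra]. }
  split; [reflexivity|split; [intros; apply HD|]].
  intros l _ t Ht e He.
  destruct (HD l t Ht 1 Rlt_0_1) as (d & Hd & H).
  set (K := 2 + Rabs (eps * lac (S l) t)).
  assert (HK : 0 < K) by (unfold K; pose proof (Rabs_pos (eps * lac (S l) t)); lra).
  exists (Rmin d (e / K)); split; [apply Rmin_pos; auto; now apply Rdiv_lt_0_compat|].
  intros s Hs Hst; pose proof (Rmin_l d (e / K)); pose proof (Rmin_r d (e / K)).
  specialize (H s Hs ltac:(lra)).
  rewrite Cnorm_Cmod in H |- *.
  set (u := Csub (eps * lac l s, 0) (eps * lac l t, 0)) in *.
  set (v := Cmul (Cof (s - t)) (eps * lac (S l) t, 0)) in *.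
  change (Cmod (u - v)%C <= 1 * Rabs (s - t)) in H.
  pose proof (Cmod_le_sub u v).
  assert (Hv : Cmod v = Rabs (s - t) * Rabs (eps * lac (S l) t)).
  { unfold v; change (Cmod (RtoC (s - t) * RtoC (eps * lac (S l) t))%C = Rabs (s - t) * Rabs (eps * lac (S l) t)).
    rewrite Cmod_mult, !Cmod_R; reflexivity. }
  pose proof (Rabs_pos (s - t)).
  apply Rle_lt_trans with ((1 + Rabs (eps * lac (S l) t)) * Rabs (s - t)); [lra|].
  apply Rle_lt_trans with ((1 + Rabs (eps * lac (S l) t)) * (e / K)).
  - apply Rmult_le_compat_l; [pose proof (Rabs_pos (eps * lac (S l) t)); lra|lra].
  - apply Rlt_le_trans with (K * (e / K)); [|right; field; lra].
    apply Rmult_lt_compat_r; [now apply Rdiv_lt_0_compat|unfold K; lra].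
Qed.

(** * One-sided extensions *)

(* sg = 1 gives Kplus, sg = -1 gives Kminus. *)
Definition side (V : C -> Prop) (F : C -> C) (sg : R) (z : C) : Prop :=
  exists w, V w /\ 0 < sg * snd w /\ F w = z.

Lemma side_Kplus V F : side V F 1 = Kplus V F.
Proof.
  apply functional_extensionality; intros z; apply propositional_extensionality.
  unfold side, Kplus, Cim; split; intros (w & H1 & H2 & H3); exists w; repeat split; auto; lra.
Qed.

Lemma side_Kminus V F : side V F (-1) = Kminus V F.
Proof.
  apply functional_extensionality; intros z; apply propositional_extensionality.
  unfold side, Kminus, Cim; split; intros (w & H1 & H2 & H3); exists w; repeat split; auto; lra.
Qed.

Lemma Copen_disk z0 r : Copen (disk z0 r).
Proof.
  intros z Hz; unfold disk in *; rewrite Cnorm_Cmod in Hz.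
  change (Cmod (z - z0)%C < r) in Hz.
  exists (r - Cmod (z - z0)%C); split; [lra|]; intros w Hw.
  rewrite Cnorm_Cmod in Hw |- *.
  change (Cmod (w - z)%C < r - Cmod (z - z0)%C) in Hw; change (Cmod (w - z0)%C < r).
  pose proof (Cmod_sub_triangle w z z0); lra.
Qed.

Lemma disk_Cmod (z0 : C) r (z : C) : disk z0 r z <-> Cmod (z - z0) < r.
Proof. unfold disk; rewrite Cnorm_Cmod; reflexivity. Qed.

Lemma Copen_and (U W : C -> Prop) : Copen U -> Copen W -> Copen (fun z => U z /\ W z).
Proof.
  intros HU HW z [H1 H2]; destruct (HU z H1) as (r1 & R1 & K1); destruct (HW z H2) as (r2 & R2 & K2).
  exists (Rmin r1 r2); split; [now apply Rmin_pos|]; intros w Hw.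
  pose proof (Rmin_l r1 r2); pose proof (Rmin_r r1 r2); split; [apply K1|apply K2]; lra.
Qed.

(** One-sided extensions are required on connected open sets, and discs are the ones supplied. A
    separation is refuted at the supremum of the parameters in A along a segment from A to B. *)
Lemma disk_connected (z0 : C) r : 0 < r -> Cconnected (disk z0 r).
Proof.
  intros Hr; exists z0; split.
  { apply disk_Cmod; rewrite Cminus_diag, Cmod_0; auto. }
  intros (A & B & HA & HB & Hcov & Hdis & (p & Wp & Ap) & (q & Wq & Bq)).
  set (path := fun t : R => (p + RtoC t * (q - p))%C).
  assert (Hpath : forall t, 0 <= t <= 1 -> disk z0 r (path t)).
  { intros t Ht; apply disk_Cmod in Wp; apply disk_Cmod in Wq; apply disk_Cmod.
    replace (path t - z0)%C with (RtoC (1 - t) * (p - z0) + RtoC t * (q - z0))%C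
      by (unfold path; rewrite RtoC_minus; ring).
    eapply Rle_lt_trans; [apply Cmod_triangle|].
    rewrite !Cmod_mult, !Cmod_R, !Rabs_pos_eq by lra.
    destruct (Req_dec t 0) as [->|N]; [lra|]; nra. }
  assert (Hlip : forall s t, Cmod (path s - path t) <= Rabs (s - t) * (Cmod (q - p) + 1)).
  { intros s t; replace (path s - path t)%C with (RtoC (s - t) * (q - p))%C
      by (unfold path; rewrite RtoC_minus; ring).
    rewrite Cmod_mult, Cmod_R; pose proof (Rabs_pos (s - t)); nra. }
  pose proof (Cmod_ge_0 (q - p)) as Pqp.
  assert (H0 : path 0 = p) by (unfold path; ring).
  assert (H1 : path 1 = q) by (unfold path; ring).
  destruct (completeness (fun t => 0 <= t <= 1 /\ A (path t))) as [T [HT1 HT2]].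
  { exists 1; intros t [Ht _]; lra. }
  { exists 0; split; [lra|]; now rewrite H0. }
  assert (T0 : 0 <= T) by (apply HT1; split; [lra|now rewrite H0]).
  assert (T1 : T <= 1) by (apply HT2; intros t [Ht _]; lra).
  assert (near : forall U : C -> Prop, Copen U -> U (path T) -> exists d, 0 < d /\
    forall s, Rabs (s - T) < d -> U (path s)).
  { intros U HU HT; destruct (Copen_Cmod U _ HU HT) as (e & He & K).
    exists (e / (Cmod (q - p) + 1)); split; [apply Rdiv_lt_0_compat; lra|].
    intros s Hs; apply K; eapply Rle_lt_trans; [apply Hlip|].
    apply Rlt_le_trans with (e / (Cmod (q - p) + 1) * (Cmod (q - p) + 1)); [|right; field; lra].
    apply Rmult_lt_compat_r; lra. }
  destruct (Hcov (path T)) as [AT|BT]; [apply Hpath; lra| |].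
  - destruct (near A HA AT) as (d & Hd & K).
    destruct (Req_dec T 1) as [E|N].
    + apply (Hdis q); auto; rewrite <- H1, <- E; auto.
    + set (s := T + Rmin (d / 2) (1 - T)).
      assert (0 < Rmin (d / 2) (1 - T)) by (apply Rmin_pos; lra).
      pose proof (Rmin_l (d / 2) (1 - T)); pose proof (Rmin_r (d / 2) (1 - T)).
      assert (s <= T); [|unfold s in *; lra].
      apply HT1; split; [unfold s; lra|]; apply K; unfold s; rewrite Rabs_pos_eq; lra.
  - destruct (near B HB BT) as (d & Hd & K).
    assert (T <= T - Rmin d 1); [|assert (0 < Rmin d 1) by (apply Rmin_pos; lra); lra].
    apply HT2; intros t [Ht At]; apply Rnot_lt_le; intros L.
    assert (t <= T) by (apply HT1; auto).
    apply (Hdis (path t)); auto; apply K; rewrite Rabs_left1 by lra.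
    pose proof (Rmin_l d 1); lra.
Qed.

(* Affine change of variable sending the upper half-plane to the side sg of the real axis. *)
Definition flip (t1 sg : R) (z : C) : C := (RtoC t1 + RtoC sg * z)%C.

Lemma flip_eq t1 sg z : flip t1 sg z = (t1 + sg * fst z, sg * snd z).
Proof. apply injective_projections; simpl; ring. Qed.

Lemma holo_flip t1 sg z : holo_at (flip t1 sg) z.
Proof. apply holo_plus; [apply holo_const|]; apply holo_mult; [apply holo_const|apply holo_id]. Qed.

(** The open mapping theorem and injectivity together. It prevents remote parts of the curve, or of
    its sides, from coming back close to F w0. *)
Lemma inverse_continuity a b gamma (V : C -> Prop) (F : C -> C) (w0 : C) r :
  analytic_curve_data a b gamma V F -> V w0 -> 0 < r ->
  exists d, 0 < d /\ forall w, V w -> Cmod (F w - F w0) < d -> Cmod (w - w0) < r.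
Proof.
  intros (_ & HV & _ & HF & Hinj & _) Hw Hr.
  destruct (open_mapping V F w0 r HV HF Hinj Hw Hr) as (d & Hd & H).
  exists d; split; auto; intros w Vw Hlt.
  destruct (H _ Hlt) as (w' & V' & L & E); apply Hinj in E; auto; now subst.
Qed.

Lemma side_open a b gamma V F sg :
  analytic_curve_data a b gamma V F -> Copen (side V F sg).
Proof.
  intros (_ & HV & _ & HF & Hinj & _) z (w & Vw & Hw & <-).
  (* A parameter closer to w than |Im w| stays on the same side of the real axis. *)
  set (r := Rabs (snd w)).
  assert (Hr : 0 < r) by (apply Rabs_pos_lt; intros E; rewrite E in Hw; lra).
  destruct (open_mapping V F w r HV HF Hinj Vw Hr) as (d & Hd & H).
  exists d; split; auto; intros z' Hz'; rewrite Cnorm_Cmod in Hz'.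
  destruct (H _ Hz') as (w' & V' & L & E); exists w'; repeat split; auto.
  pose proof (snd_le_Cmod (w' - w)%C) as K; simpl in K.
  assert (K' : Rabs (snd w' + - snd w) < Rabs (snd w)) by (unfold r in L; lra).
  revert K' Hw; unfold Rabs; repeat destruct Rcase_abs; intros; nra.
Qed.

Lemma curve_eq a b gamma V F t :
  analytic_curve_data a b gamma V F -> a <= t <= b -> gamma t = F (t, 0) /\ V (t, 0).
Proof.
  intros (_ & _ & H1 & _ & _ & H2 & _) Ht; split; [symmetry; apply (H2 t Ht)|apply (H1 t Ht)].
Qed.

(** The centre is moved from t towards the middle of [a, b], so that a full real diameter of the
    square lies in [a, b] even when t is an endpoint. *)
Lemma chart a b gamma V F t r :
  analytic_curve_data a b gamma V F -> a <= t <= b -> 0 < r ->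
  exists t1 rho, a <= t1 <= b /\ 0 < rho <= / 4 /\ forall z, in_square (t1, 0) rho z ->
    V z /\ disk (gamma t) r (F z) /\ a <= fst z <= b.
Proof.
  intros HD Ht Hr.
  destruct (curve_eq _ _ _ _ _ _ HD Ht) as [E Vt].
  destruct HD as (Hab & HV & _ & HF & _).
  destruct (Copen_Cmod V _ HV Vt) as (d1 & Hd1 & K1).
  destruct (holo_ccont _ _ (holo_on_at V F _ HV HF Vt) r Hr) as (d2 & Hd2 & K2).
  (* The square has half-side d/2 and its centre is at distance d from t, so it stays within 2 d of
     t; 1/2 ensures rho <= 1/4, and (b - a)/4 leaves room for the displacement. *)
  set (d := Rmin (/ 2) (Rmin (Rmin d1 d2 / 4) ((b - a) / 4))).
  assert (Hd : 0 < d).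
  { unfold d; repeat apply Rmin_pos; try lra.
    apply Rdiv_lt_0_compat; [now apply Rmin_pos|lra]. }
  assert (D0 : d <= / 2) by apply Rmin_l.
  assert (D1 : d <= Rmin d1 d2 / 4)
    by (eapply Rle_trans; [apply Rmin_r|apply Rmin_l]).
  assert (D2 : d <= (b - a) / 4)
    by (eapply Rle_trans; [apply Rmin_r|apply Rmin_r]).
  pose proof (Rmin_l d1 d2); pose proof (Rmin_r d1 d2).
  set (t1 := if Rle_dec t ((a + b) / 2) then t + d else t - d).
  assert (Ht1 : Rabs (t1 - t) = d /\ a <= t1 - d / 2 /\ t1 + d / 2 <= b).
  { unfold t1; destruct Rle_dec.
    - replace (t + d - t) with d by ring; rewrite Rabs_pos_eq; lra.
    - replace (t - d - t) with (- d) by ring; rewrite Rabs_Ropp, Rabs_pos_eq; lra. }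
  exists t1, (d / 2); split; [lra|split; [lra|]]; intros z Hz.
  assert (Hz' := in_square_Cmod _ _ _ Hz).
  assert (L : Cmod (z - (t, 0)) <= 2 * d).
  { eapply Rle_trans; [apply (Cmod_sub_triangle _ (t1, 0))|].
    assert (Cmod ((t1, 0) - (t, 0)) <= d); [|lra].
    eapply Rle_trans; [apply Cmod_le_sum|]; simpl.
    replace (0 + - 0) with 0 by ring; rewrite Rabs_R0; unfold Rminus in Ht1; lra. }
  split; [apply K1; lra|split].
  - rewrite E; apply disk_Cmod, K2; lra.
  - destruct Hz as [Hz _]; simpl in Hz; lra.
Qed.

(** A local, quantitative form of [extends_to_side]: continuity is asked only inside W and a bound
    is part of the data, so that countably many pairs of W and M exhaust all extensions. *)
Definition extension_on (a b : R) (gamma : R -> CC) (V : C -> Prop) (F : C -> C) (sg : R)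
    (W : C -> Prop) (M : R) (v lam : C -> C) : Prop :=
  cont_on (fun z => W z /\ (curve_img a b gamma z \/ side V F sg z)) lam /\
  holo_on (fun z => W z /\ side V F sg z) lam /\
  (forall z, W z -> curve_img a b gamma z -> lam z = v z) /\
  (forall z, W z -> side V F sg z -> Cmod (lam z) <= M).

(** Composition with F and [flip] brings either side to the upper half of a rectangle, with the
    curve on the real axis; clamping makes the result continuous on the plane, as the integral and
    maximum estimates require. *)
Lemma pullback a b gamma V F sg W M v lam t1 rho :
  analytic_curve_data a b gamma V F -> sg = 1 \/ sg = -1 -> Copen W -> 0 < rho ->
  (forall z, in_square (t1, 0) rho z -> V z /\ W (F z) /\ a <= fst z <= b) ->
  extension_on a b gamma V F sg W M v lam ->
  exists mu, ccont mu /\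
    (forall z, - rho < fst z < rho -> 0 < snd z < rho -> holo_at mu z) /\
    (forall z, in_rect (- rho) rho 0 rho z -> mu z = lam (F (flip t1 sg z))) /\
    (forall z, in_rect (- rho) rho 0 rho z -> 0 < snd z -> Cmod (mu z) <= M) /\
    (forall t, - rho <= t <= rho -> mu (t, 0) = v (gamma (t1 + sg * t))).
Proof.
  intros HD Hsg HW Hr Hsq (Hc & Hh & Hv & HM).
  set (m := fun z => lam (F (flip t1 sg z))).
  assert (Hin : forall z, in_rect (- rho) rho 0 rho z -> in_square (t1, 0) rho (flip t1 sg z)).
  { intros z [H1 H2]; rewrite flip_eq; unfold in_square; split; simpl;
      destruct Hsg as [-> | ->]; lra. }
  assert (Hreal : forall z, in_rect (- rho) rho 0 rho z -> snd z = 0 ->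
    a <= t1 + sg * fst z <= b /\ F (flip t1 sg z) = gamma (t1 + sg * fst z)).
  { intros z Hz E; destruct (Hsq _ (Hin z Hz)) as (_ & _ & Hab).
    rewrite flip_eq in Hab |- *; simpl in Hab; split; auto.
    rewrite E, Rmult_0_r; symmetry; exact (proj1 (curve_eq _ _ _ _ _ _ HD Hab)). }
  assert (Hside : forall z, in_rect (- rho) rho 0 rho z -> 0 < snd z ->
    side V F sg (F (flip t1 sg z))).
  { intros z Hz P; exists (flip t1 sg z); split; [now apply Hsq, Hin|split; auto].
    rewrite flip_eq; simpl; destruct Hsg as [-> | ->]; lra. }
  assert (Hdom : forall z, in_rect (- rho) rho 0 rho z ->
    W (F (flip t1 sg z)) /\
    (curve_img a b gamma (F (flip t1 sg z)) \/ side V F sg (F (flip t1 sg z)))).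
  { intros z Hz; split; [now apply Hsq, Hin|]; destruct (Req_dec (snd z) 0) as [E|N].
    - left; exists (t1 + sg * fst z); destruct (Hreal z Hz E); auto.
    - right; apply Hside; auto; destruct Hz as [_ Hz]; lra. }
  assert (HFh : forall z, in_rect (- rho) rho 0 rho z -> holo_at (fun z => F (flip t1 sg z)) z).
  { intros z Hz; apply (holo_comp F); [apply holo_flip|].
    pose proof HD as (_ & HV & _ & HF & _).
    apply (holo_on_at V); auto; now apply Hsq, Hin. }
  exists (fun z => m (clamp (- rho) rho 0 rho z)).
  assert (Hm : forall z, in_rect (- rho) rho 0 rho z -> m (clamp (- rho) rho 0 rho z) = m z)
    by (intros z Hz; now rewrite clamp_id).
  split; [|split; [|split; [|split]]].
  - apply ccont_clamp; try lra; intros z Hz eps He.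
    destruct (Hc _ (Hdom z Hz) eps He) as (d & Hd & K).
    destruct (holo_ccont _ _ (HFh z Hz) d Hd) as (d' & Hd' & K').
    exists d'; split; auto; intros w Hw Hlt; apply K; [now apply Hdom|].
    rewrite Cnorm_Cmod in Hlt |- *; apply K'; auto.
  - intros z H1 H2; apply holo_clamp; auto.
    assert (Hz : in_rect (- rho) rho 0 rho z) by (split; lra).
    apply (holo_comp lam); [now apply HFh|].
    apply (holo_on_at (fun z => W z /\ side V F sg z)); auto.
    + apply Copen_and; auto; eapply side_open; eauto.
    + split; [now apply Hsq, Hin|]; apply Hside; auto; lra.
  - exact Hm.
  - intros z Hz P; rewrite Hm by auto; apply HM; [now apply Hsq, Hin|now apply Hside].
  - intros t Ht.
    assert (Hz : in_rect (- rho) rho 0 rho (t, 0)) by (split; simpl; lra).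
    rewrite Hm by auto; unfold m; destruct (Hreal _ Hz eq_refl) as [Hab E].
    rewrite E; simpl; apply Hv; [|now exists (t1 + sg * t)].
    simpl in E; rewrite <- E; now apply Hsq, Hin.
Qed.

(** Regularity is defined through the parameter; continuity in the plane also needs the parameter to
    depend continuously on the point, which is [inverse_continuity]. *)
Lemma Ck_curve_cont_on a b gamma V F k u :
  analytic_curve_data a b gamma V F -> Ck_curve a b gamma k u -> cont_on (curve_img a b gamma) u.
Proof.
  intros HD (D & H0 & _ & Hc) z (t & Ht & <-) eps He.
  assert (Hk : le_k 0 k) by (destruct k; simpl; auto; lia).
  destruct (Hc O Hk t Ht eps He) as (d & Hd & K).
  destruct (curve_eq _ _ _ _ _ _ HD Ht) as [E Vt].
  destruct (inverse_continuity _ _ _ _ _ _ _ HD Vt Hd) as (d' & Hd' & K').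
  exists d'; split; auto; intros w (s & Hs & <-) Hw.
  destruct (curve_eq _ _ _ _ _ _ HD Hs) as [Es Vs].
  rewrite Cnorm_Cmod in Hw; rewrite Es, E in Hw.
  specialize (K' _ Vs Hw).
  specialize (K s Hs); rewrite !H0 in K by auto; apply K.
  pose proof (fst_le_Cmod ((s, 0) - (t, 0))%C) as L; simpl in L.
  unfold Rminus; lra.
Qed.

(** [extends_to_side] demands continuity on the whole curve, not only inside W. The local extension
    is therefore glued to u on the rest of the curve. *)
Lemma extends_from_local a b gamma V F sg k (u lam : C -> C) (W : C -> Prop) z1 :
  analytic_curve_data a b gamma V F -> Ck_curve a b gamma k u ->
  Copen W -> W z1 -> curve_img a b gamma z1 ->
  cont_on (fun z => W z /\ (curve_img a b gamma z \/ side V F sg z)) lam ->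
  (forall z, W z -> side V F sg z -> holo_at lam z) ->
  (forall z, W z -> curve_img a b gamma z -> lam z = u z) ->
  extends_to_side a b gamma (side V F sg) u.
Proof.
  intros HD Hu HW Wz1 Cz1 Hc Hh Hlu.
  destruct (Copen_Cmod W z1 HW Wz1) as (r2 & Hr2 & HrW).
  (* With half the radius, a curve point outside W is at distance at least r from the new disc, so
     near it the domain consists of curve points only and continuity of u suffices. *)
  set (r := r2 / 2); assert (Hr : 0 < r) by (unfold r; lra).
  assert (HrW' : forall z, disk z1 r z -> W z).
  { intros z Hz; apply disk_Cmod in Hz; apply HrW; unfold r in Hz; lra. }
  assert (Hz1 : disk z1 r z1) by (apply disk_Cmod; rewrite Cminus_diag, Cmod_0; auto).
  exists (disk z1 r); split; [apply Copen_disk|split; [now apply disk_connected|split]].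
  { exists z1; auto. }
  set (l := fun z => if excluded_middle_informative (curve_img a b gamma z) then u z else lam z).
  assert (Hl1 : forall z, curve_img a b gamma z -> l z = u z)
    by (intros; unfold l; destruct excluded_middle_informative; tauto).
  assert (Hl2 : forall z, W z -> l z = lam z).
  { intros z Hz; unfold l; destruct excluded_middle_informative; auto; symmetry; auto. }
  exists l; split; [|split; [|auto]].
  - intros z Hz eps He.
    destruct (classic (W z)) as [Wz|Wz].
    + destruct (Hc z) with (eps := eps) as (d & Hd & K); [tauto|auto|].
      destruct (Copen_Cmod W z HW Wz) as (d' & Hd' & K').
      exists (Rmin d d'); split; [now apply Rmin_pos|]; intros w Hw Hlt.
      pose proof (Rmin_l d d'); pose proof (Rmin_r d d').
      rewrite Cnorm_Cmod in Hlt.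
      assert (Ww : W w) by (apply K'; change (Cmod (Csub w z) < d'); lra).
      rewrite !Hl2 by auto; apply K; [tauto|rewrite Cnorm_Cmod; lra].
    + assert (Cz : curve_img a b gamma z).
      { destruct Hz as [Hz|[Hz _]]; auto; exfalso; auto. }
      destruct (Ck_curve_cont_on _ _ _ _ _ _ _ HD Hu z Cz eps He) as (d & Hd & K).
      exists (Rmin d r); split; [now apply Rmin_pos|]; intros w Hw Hlt.
      pose proof (Rmin_l d r); pose proof (Rmin_r d r).
      assert (Cw : curve_img a b gamma w).
      { destruct Hw as [Hw|[Hw _]]; auto; exfalso; apply Wz, HrW.
        apply disk_Cmod in Hw; rewrite Cnorm_Cmod in Hlt.
        change (Cmod (w - z)%C < Rmin d r) in Hlt; rewrite Cmod_sub_sym in Hlt.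
        pose proof (Cmod_sub_triangle z w z1); unfold r in *; lra. }
      rewrite !Hl1 by auto; apply K; auto; lra.
  - apply holo_at_on; intros z [Hz Sz].
    apply (holo_ext lam); [|apply Hh; auto].
    destruct (Copen_Cmod W z HW (HrW' z Hz)) as (d & Hd & K).
    exists d; split; auto; intros w Hw; symmetry; apply Hl2; auto.
Qed.

(** * A countable family of discs and bounds *)

(** Truncating i keeps every pair of naturals admissible, so the family can be indexed by all of
    nat. *)
Definition grid (a b : R) (i m : nat) : R := a + (b - a) * (INR (Nat.min i (S m)) / INR (S m)).

Lemma grid_in a b i m : a < b -> a <= grid a b i m <= b.
Proof.
  intros Hab; unfold grid.
  assert (0 < INR (S m)) by (apply lt_0_INR; lia).
  assert (H1 : INR (Nat.min i (S m)) <= INR (S m)) by (apply le_INR; lia).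
  assert (0 <= INR (Nat.min i (S m)) / INR (S m)).
  { apply Rmult_le_pos; [apply pos_INR|left; now apply Rinv_0_lt_compat]. }
  assert (INR (Nat.min i (S m)) / INR (S m) <= 1).
  { apply (Rmult_le_reg_r (INR (S m))); auto.
    unfold Rdiv; rewrite Rmult_assoc, Rinv_l, Rmult_1_r by lra; lra. }
  split; nra.
Qed.

Lemma grid_dense a b t m : a < b -> a <= t <= b ->
  exists i, Rabs (grid a b i m - t) <= (b - a) * / (INR m + 1).
Proof.
  intros Hab Ht.
  assert (Hm : 0 < INR (S m)) by (apply lt_0_INR; lia).
  set (x := (t - a) / (b - a) * INR (S m)).
  assert (Hx0 : 0 <= x).
  { apply Rmult_le_pos; [|lra]; apply Rmult_le_pos; [lra|left; apply Rinv_0_lt_compat; lra]. }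
  assert (Hx1 : x <= INR (S m)).
  { unfold x; rewrite <- (Rmult_1_l (INR (S m))) at 2; apply Rmult_le_compat_r; [lra|].
    apply (Rmult_le_reg_r (b - a)); [lra|].
    unfold Rdiv; rewrite Rmult_assoc, Rinv_l; lra. }
  destruct (nfloor_ex x Hx0) as [i [Hi1 Hi2]].
  exists i; unfold grid.
  rewrite Nat.min_l by (apply INR_le; lra).
  rewrite <- S_INR.
  replace (a + (b - a) * (INR i / INR (S m)) - t)
    with ((b - a) * / INR (S m) * (INR i - x)) by (unfold x; field; lra).
  assert (0 < (b - a) * / INR (S m)).
  { apply Rmult_lt_0_compat; [lra|now apply Rinv_0_lt_compat]. }
  rewrite Rabs_mult, Rabs_pos_eq by lra.
  assert (Rabs (INR i - x) <= 1) by (apply Rabs_le; lra).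
  nra.
Qed.

(** A single m, decoded from n, fixes the mesh, the radius 1/(m+1) and, in [cell_bound], the bound
    m+1. *)
Definition cell (a b : R) (gamma : R -> CC) (n : nat) : C -> Prop :=
  let (i, m) := Cantor.of_nat n in disk (gamma (grid a b i m)) (/ (INR m + 1)).

Definition cell_bound (n : nat) : R := let (i, m) := Cantor.of_nat n in INR m + 1.

Lemma cell_open a b gamma n : Copen (cell a b gamma n).
Proof. unfold cell; destruct (of_nat n); apply Copen_disk. Qed.

Lemma cell_center a b gamma n : a < b -> exists t r, a <= t <= b /\ 0 < r /\
  cell a b gamma n = disk (gamma t) r.
Proof.
  intros Hab; unfold cell; destruct (of_nat n) as [i m].
  exists (grid a b i m), (/ (INR m + 1)); split; [now apply grid_in|split; auto].
  apply inv_INR_pos.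
Qed.

Lemma cell_bound_pos n : 0 < cell_bound n.
Proof. unfold cell_bound; destruct (of_nat n) as [i m]; pose proof (pos_INR m); lra. Qed.

(** One large m meets all demands at once: fine mesh, small radius, large bound. The cell need not
    contain z; it is enough that it is centred on the curve and lies in W. *)
Lemma cell_inside a b gamma V F (W : C -> Prop) z M :
  analytic_curve_data a b gamma V F -> Copen W -> W z -> curve_img a b gamma z ->
  exists n, (forall w, cell a b gamma n w -> W w) /\ M <= cell_bound n.
Proof.
  intros HD HW Wz (t & Ht & E).
  destruct (curve_eq _ _ _ _ _ _ HD Ht) as [Et Vt].
  destruct (Copen_Cmod W z HW Wz) as (r & Hr & K).
  pose proof HD as (Hab & HV & _ & HF & _).
  destruct (holo_ccont _ _ (holo_on_at V F _ HV HF Vt) (r / 2) ltac:(lra)) as (d & Hd & Kd).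
  destruct (inv_INR_small (Rmin (r / 2) (d / (2 * (b - a))))) as [N1 HN1].
  { apply Rmin_pos; [lra|]; apply Rdiv_lt_0_compat; lra. }
  destruct (INR_unbounded M) as [N2 HN2].
  set (m := max N1 N2).
  specialize (HN1 m ltac:(lia)).
  pose proof (Rmin_l (r / 2) (d / (2 * (b - a)))); pose proof (Rmin_r (r / 2) (d / (2 * (b - a)))).
  destruct (grid_dense a b t m Hab Ht) as [i Hi].
  exists (Cantor.to_nat (i, m)); unfold cell, cell_bound; rewrite cancel_of_to; split.
  - intros w Hw; apply disk_Cmod in Hw; apply K.
    assert (Hg := grid_in a b i m Hab).
    destruct (curve_eq _ _ _ _ _ _ HD Hg) as [Eg Vg].
    eapply Rle_lt_trans; [apply (Cmod_sub_triangle w (gamma (grid a b i m)) z)|].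
    assert (Cmod (gamma (grid a b i m) - z)%C < r / 2); [|lra].
    rewrite Eg, <- E, Et; apply Kd.
    eapply Rle_lt_trans; [apply Cmod_le_sum|]; simpl.
    replace (0 + - 0) with 0 by ring; rewrite Rabs_R0, Rplus_0_r.
    apply Rle_lt_trans with (d / 2); [|lra].
    eapply Rle_trans; [exact Hi|].
    apply Rle_trans with ((b - a) * (d / (2 * (b - a)))); [|right; field; lra].
    apply Rmult_le_compat_l; lra.
  - assert (INR N2 <= INR m) by (apply le_INR; lia); lra.
Qed.

(** * Stability of extensions and density *)

(** [two_constants] is applied to the difference of the two pullbacks. The eps obtained depends on
    the chart, M and eta only, which turns sup-norm convergence on the curve into uniform
    convergence of extensions near t1. *)
Lemma extension_stability a b gamma V F sg W M t1 rho eta :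
  analytic_curve_data a b gamma V F -> sg = 1 \/ sg = -1 -> Copen W ->
  0 < rho <= / 4 ->
  (forall z, in_square (t1, 0) rho z -> V z /\ W (F z) /\ a <= fst z <= b) ->
  0 < M -> 0 < eta ->
  exists eps, 0 < eps /\ forall v1 v2 l1 l2,
    extension_on a b gamma V F sg W M v1 l1 -> extension_on a b gamma V F sg W M v2 l2 ->
    (forall t, a <= t <= b -> Cmod (v1 (gamma t) - v2 (gamma t)) <= eps) ->
    forall w, Cmod (w - (t1, 0)) < rho ^ 2 / 4 -> 0 <= sg * snd w ->
      Cmod (l1 (F w) - l2 (F w)) <= eta.
Proof.
  intros HD Hsg HW Hr Hsq HM Heta.
  (* 2 M bounds the difference above the axis. On the axis [extension_on] imposes no bound, and the
     values differ by at most 1 because eps is cut at 1. *)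
  destruct (two_constants rho (2 * M + 1) eta Hr ltac:(lra) Heta) as (eps & He & K).
  exists (Rmin eps 1); split; [apply Rmin_pos; lra|].
  intros v1 v2 l1 l2 E1 E2 Hv w Hw Hsw.
  pose proof (Rmin_l eps 1) as Q1; pose proof (Rmin_r eps 1) as Q2.
  destruct (pullback _ _ _ _ _ _ _ _ _ _ t1 rho HD Hsg HW ltac:(lra) Hsq E1)
    as (m1 & C1 & H1 & P1 & B1 & R1).
  destruct (pullback _ _ _ _ _ _ _ _ _ _ t1 rho HD Hsg HW ltac:(lra) Hsq E2)
    as (m2 & C2 & H2 & P2 & B2 & R2).
  assert (Hbot : forall x, - rho <= x <= rho -> Cmod (m1 (x, 0) - m2 (x, 0)) <= Rmin eps 1).
  { intros x Hx; rewrite R1, R2 by auto; apply Hv.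
    destruct (Hsq (t1 + sg * x, 0)) as (_ & _ & L); [|exact L].
    split; simpl; destruct Hsg as [-> | ->]; lra. }
  set (z := (sg * (fst w - t1), sg * snd w) : C).
  pose proof (fst_le_Cmod (w - (t1, 0))%C) as L1; pose proof (snd_le_Cmod (w - (t1, 0))%C) as L2.
  simpl in L1, L2; apply Rabs_le_between in L1; apply Rabs_le_between in L2.
  assert (Hz : in_rect (- rho / 2) (rho / 2) 0 (rho ^ 2 / 4) z).
  { assert (rho ^ 2 / 4 <= rho / 2) by nra.
    split; simpl; destruct Hsg as [-> | ->]; lra. }
  assert (Hz' : in_rect (- rho) rho 0 rho z) by (destruct Hz; split; nra).
  assert (Ew : flip t1 sg z = w).
  { rewrite flip_eq; apply injective_projections; simpl; destruct Hsg as [-> | ->]; ring. }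
  rewrite <- Ew, <- P1, <- P2 by auto.
  apply (K (fun z => m1 z - m2 z)%C); auto.
  - intros x; apply ccont_at_minus; [apply C1|apply C2].
  - intros x X1 X2; apply holo_minus; auto.
  - intros x Hx; destruct (Req_dec (snd x) 0) as [E0|N0].
    + destruct x as [x y]; simpl in E0; subst y.
      assert (Cmod (m1 (x, 0) - m2 (x, 0)) <= Rmin eps 1); [|lra].
      apply Hbot; destruct Hx as [Hx _]; exact Hx.
    + assert (Px : 0 < snd x) by (destruct Hx; lra).
      pose proof (Cmod_triangle_sub (m1 x) (m2 x)).
      specialize (B1 x Hx Px); specialize (B2 x Hx Px); lra.
  - intros x Hx; specialize (Hbot x Hx); lra.
Qed.

(** * Limits of one-sided extensions *)

Definition unif_cauchy (S : C -> Prop) (f : nat -> C -> C) : Prop :=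
  forall eps, 0 < eps -> exists N, forall i j, (N <= i)%nat -> (N <= j)%nat ->
    forall z, S z -> Cmod (f i z - f j z) <= eps.

Lemma unif_cauchy_limit S f : unif_cauchy S f ->
  exists l, forall eps, 0 < eps -> exists N, forall i, (N <= i)%nat ->
    forall z, S z -> Cmod (f i z - l z) <= eps.
Proof.
  intros H.
  assert (L : forall z, exists l, S z -> forall eps, 0 < eps -> exists N, forall n, (N <= n)%nat ->
    Cmod (f n z - l) <= eps).
  { intros z; destruct (classic (S z)) as [Sz|Nz]; [|exists (RtoC 0); tauto].
    destruct (C_complete (fun n => f n z)) as [l Hl].
    - intros eps He; destruct (H eps He) as [N HN]; exists N; auto.
    - exists l; auto. }
  apply choice in L; destruct L as [l Hl]; exists l; intros eps He.
  destruct (H (eps / 2)) as [N HN]; [lra|]; exists N; intros i Hi z Sz.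
  destruct (Hl z Sz (eps / 2)) as [N2 HN2]; [lra|].
  eapply Rle_trans; [apply (Cmod_sub_triangle _ (f (max N N2) z))|].
  specialize (HN i (max N N2) Hi ltac:(lia) z Sz).
  specialize (HN2 (max N N2) ltac:(lia)); lra.
Qed.

Lemma unif_limit_cont (S : C -> Prop) (f : nat -> C -> C) l :
  (forall n, cont_on S (f n)) ->
  (forall eps, 0 < eps -> exists N, forall i, (N <= i)%nat ->
     forall z, S z -> Cmod (f i z - l z) <= eps) ->
  cont_on S l.
Proof.
  intros Hc Hu z Sz eps He.
  destruct (Hu (eps / 4)) as [N HN]; [lra|]; specialize (HN N (le_n _)).
  destruct (Hc N z Sz (eps / 4)) as (d & Hd & K); [lra|].
  exists d; split; auto; intros w Sw Hw; specialize (K w Sw Hw).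
  rewrite Cnorm_Cmod in K |- *.
  change (Cmod (f N w - f N z)%C < eps / 4) in K; change (Cmod (l w - l z)%C < eps).
  pose proof (HN w Sw) as K1; pose proof (HN z Sz) as K2; rewrite Cmod_sub_sym in K1.
  pose proof (Cmod_sub_triangle (l w) (f N w) (l z)).
  pose proof (Cmod_sub_triangle (f N w) (f N z) (l z)); lra.
Qed.

Lemma unif_limit_holo (U : C -> Prop) (f : nat -> C -> C) l :
  Copen U -> (forall n z, U z -> holo_at (f n) z) ->
  (forall eps, 0 < eps -> exists N, forall i, (N <= i)%nat ->
     forall z, U z -> Cmod (f i z - l z) <= eps) ->
  forall z, U z -> holo_at l z.
Proof.
  intros HU Hh Hu z Uz; destruct (Copen_Cmod U z HU Uz) as (r & Hr & K).
  assert (Ksq : forall w, in_square z (r / 4) w -> U w).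
  { intros w Hw; apply in_square_Cmod in Hw; apply K; lra. }
  apply (weierstrass l z (r / 4)); [lra|]; intros eps He.
  destruct (Hu eps He) as [N HN]; exists (f N); intros w Hw; split; [auto|].
  rewrite Cmod_sub_sym; apply (HN N); auto.
Qed.

Lemma cont_on_subset (D D' : C -> Prop) f : (forall z, D' z -> D z) -> cont_on D f -> cont_on D' f.
Proof.
  intros H Hc z Hz eps He; destruct (Hc z (H z Hz) eps He) as (d & Hd & K); exists d; split; auto.
Qed.

Definition sup_close (a b : R) (gamma : R -> CC) (u v : C -> C) (eps : R) : Prop :=
  forall t, a <= t <= b -> Cmod (u (gamma t) - v (gamma t)) <= eps.

(** Closure in the sup norm, which is coarser than the topology of C^k: its complement is open
    already for the seminorm of order 0, so one argument covers every k. *)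
Definition sup_closure (a b : R) (gamma : R -> CC) (B : (C -> C) -> Prop) (u : C -> C) : Prop :=
  forall eps, 0 < eps -> exists v, B v /\ sup_close a b gamma u v eps.

Lemma sup_close_seq a b gamma u (v : nat -> C -> C) :
  (forall n, sup_close a b gamma u (v n) (/ (INR n + 1))) ->
  forall eps, 0 < eps -> exists N, forall i j, (N <= i)%nat -> (N <= j)%nat ->
    forall t, a <= t <= b -> Cmod (v i (gamma t) - v j (gamma t)) <= eps.
Proof.
  intros Hv eps He; destruct (inv_INR_small (eps / 2)) as [N HN]; [lra|].
  exists N; intros i j Hi Hj t Ht.
  pose proof (HN i Hi); pose proof (HN j Hj).
  pose proof (Hv i t Ht) as K1; pose proof (Hv j t Ht) as K2.
  rewrite Cmod_sub_sym in K1.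
  pose proof (Cmod_sub_triangle (v i (gamma t)) (u (gamma t)) (v j (gamma t))); lra.
Qed.

Lemma sup_close_limit a b gamma u (v lam : nat -> C -> C) l (S : C -> Prop) z :
  (forall n, sup_close a b gamma u (v n) (/ (INR n + 1))) ->
  (forall eps, 0 < eps -> exists N, forall i, (N <= i)%nat ->
     forall z, S z -> Cmod (lam i z - l z) <= eps) ->
  S z -> curve_img a b gamma z -> (forall n, lam n z = v n z) -> l z = u z.
Proof.
  intros Hv Hl Sz (t & Ht & <-) E; apply Cmod_zero_eq, le_epsilon; intros eps He; rewrite Rplus_0_l.
  destruct (Hl (eps / 2)) as [N1 H1]; [lra|].
  destruct (inv_INR_small (eps / 2)) as [N2 H2]; [lra|].
  set (n := max N1 N2).
  specialize (H1 n ltac:(lia) _ Sz); specialize (H2 n ltac:(lia)); specialize (Hv n t Ht).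
  rewrite E, Cmod_sub_sym in H1; rewrite Cmod_sub_sym in Hv.
  pose proof (Cmod_sub_triangle (l (gamma t)) (v n (gamma t)) (u (gamma t))); lra.
Qed.

(** The approximants all extend to the same cell with the same bound, so by stability their
    extensions are uniformly Cauchy near an interior point of the curve; the limit is continuous,
    holomorphic on the side and equal to u on the curve. *)
Lemma closure_extends a b gamma V F sg k n u :
  analytic_curve_data a b gamma V F -> sg = 1 \/ sg = -1 -> Ck_curve a b gamma k u ->
  sup_closure a b gamma (fun v => exists lam,
    extension_on a b gamma V F sg (cell a b gamma n) (cell_bound n) v lam) u ->
  extends_to_side a b gamma (side V F sg) u.
Proof.
  intros HD Hsg Hu Hcl.
  set (W := cell a b gamma n) in *; set (M := cell_bound n) in *.
  destruct (cell_center a b gamma n (proj1 HD)) as (t & r & Ht & Hr & EW); fold W in EW.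
  assert (HW : Copen W) by apply cell_open.
  destruct (chart _ _ _ _ _ _ _ HD Ht Hr) as (t1 & rho & Ht1 & Hrho & Hsq).
  rewrite <- EW in Hsq.
  assert (Hseq : forall j : nat, exists p : (C -> C) * (C -> C),
    extension_on a b gamma V F sg W M (fst p) (snd p) /\
    sup_close a b gamma u (fst p) (/ (INR j + 1))).
  { intros j; destruct (Hcl _ (inv_INR_pos j)) as (v & (lam & Hlam) & Hv); exists (v, lam); auto. }
  apply choice in Hseq; destruct Hseq as [p Hp].
  set (v := fun j => fst (p j)); set (lam := fun j => snd (p j)).
  assert (Hext : forall j, extension_on a b gamma V F sg W M (v j) (lam j)) by apply Hp.
  assert (Hv : forall j, sup_close a b gamma u (v j) (/ (INR j + 1))) by apply Hp.
  assert (Hrho2 : 0 < rho ^ 2 / 4) by nra.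
  destruct (curve_eq _ _ _ _ _ _ HD Ht1) as [E1 V1].
  (* Within distance d of [gamma t1], all points of the curve and of the side have parameters in the
     region controlled by [extension_stability]. *)
  destruct (inverse_continuity _ _ _ _ _ _ _ HD V1 Hrho2) as (d & Hd & Hinv).
  set (W' := disk (gamma t1) d).
  assert (HW' : Copen W') by apply Copen_disk.
  set (S := fun z => W' z /\ (curve_img a b gamma z \/ side V F sg z)).
  assert (HS : forall z, S z -> exists w, V w /\ z = F w /\ Cmod (w - (t1, 0)) < rho ^ 2 / 4 /\
    0 <= sg * snd w).
  { intros z [Wz Sz].
    assert (Hw : exists w, V w /\ z = F w /\ 0 <= sg * snd w).
    { destruct Sz as [(s & Hs & <-)|(w & Vw & P & <-)].
      - destruct (curve_eq _ _ _ _ _ _ HD Hs); exists (s, 0); repeat split; auto; simpl; lra.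
      - exists w; repeat split; auto; lra. }
    destruct Hw as (w & Vw & -> & P); exists w; repeat split; auto.
    apply Hinv; auto; rewrite <- E1; apply disk_Cmod; exact Wz. }
  assert (HSW : forall z, S z -> W z).
  { intros z Hz; destruct (HS z Hz) as (w & _ & -> & L & _); apply Hsq, Cmod_in_square; nra. }
  assert (HC : unif_cauchy S lam).
  { intros eta Heta.
    destruct (extension_stability _ _ _ _ _ _ _ _ _ _ _ HD Hsg HW Hrho Hsq (cell_bound_pos n) Heta)
      as (eps & He & K).
    destruct (sup_close_seq _ _ _ _ _ Hv eps He) as [N HN].
    exists N; intros i j Hi Hj z Sz; destruct (HS z Sz) as (w & _ & -> & L & P).
    apply (K _ _ _ _ (Hext i) (Hext j)); auto. }
  destruct (unif_cauchy_limit _ _ HC) as [l Hl].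
  apply (extends_from_local _ _ _ _ _ _ k u l W' (gamma t1)); auto.
  - apply disk_Cmod; rewrite Cminus_diag, Cmod_0; auto.
  - exists t1; auto.
  - apply (unif_limit_cont S lam); auto; intros j.
    destruct (Hext j) as (Hc & _); revert Hc; apply cont_on_subset.
    intros z Sz; split; [auto|apply Sz].
  - intros z Wz Sz; apply (unif_limit_holo (fun z => W' z /\ side V F sg z) lam); auto.
    + apply Copen_and; auto; eapply side_open; eauto.
    + intros j x [Wx Sx]; destruct (Hext j) as (_ & Hh & _).
      apply (holo_on_at (fun z => W z /\ side V F sg z)); auto.
      * apply Copen_and; auto; eapply side_open; eauto.
      * split; auto; apply HSW; split; auto.
    + intros eps He; destruct (Hl eps He) as [N HN]; exists N; intros i Hi x [Wx Sx].
      apply HN; auto; split; auto.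
  - intros z Wz Cz; assert (Sz : S z) by (split; auto).
    apply (sup_close_limit a b gamma u v lam l S); auto.
    intros j; destruct (Hext j) as (_ & _ & Hlv & _); apply Hlv; auto.
Qed.

(** Continuity at a curve point bounds the extension by |lam z| + 1 nearby, so a small cell with a
    large enough bound captures it. *)
Lemma extends_cell a b gamma V F sg u :
  analytic_curve_data a b gamma V F -> extends_to_side a b gamma (side V F sg) u ->
  exists n lam, extension_on a b gamma V F sg (cell a b gamma n) (cell_bound n) u lam.
Proof.
  intros HD (W & HW & _ & (z & Wz & Cz) & lam & Hc & Hh & Hlu).
  destruct (Hc z (or_introl Cz) 1 Rlt_0_1) as (d & Hd & K).
  destruct (cell_inside a b gamma V F (fun w => W w /\ disk z d w) z (Cmod (lam z) + 1))
    as (n & Hn & HM); auto.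
  { apply Copen_and; auto; apply Copen_disk. }
  { split; auto; apply disk_Cmod; rewrite Cminus_diag, Cmod_0; auto. }
  exists n, lam; repeat split.
  - revert Hc; apply cont_on_subset; intros w [Hw [Cw|Sw]]; auto; right; split; auto; now apply Hn.
  - apply holo_at_on; intros w [Hw Sw]; apply (holo_on_at (fun z => W z /\ side V F sg z)); auto.
    + apply Copen_and; auto; eapply side_open; eauto.
    + split; auto; now apply Hn.
  - intros w Hw Cw; apply Hlu; auto; now apply Hn.
  - intros w Hw Sw; destruct (Hn w Hw) as [Ww Dw].
    specialize (K w (or_intror (conj Ww Sw)) Dw); rewrite Cnorm_Cmod in K.
    change (Cmod (lam w - lam z)%C < 1) in K.
    pose proof (Cmod_le_sub (lam w) (lam z)); lra.
Qed.

(** * Extensions to full discs *)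

Definition extends_to_disk (a b : R) (gamma : R -> CC) (u : C -> C) : Prop :=
  exists z0 r f, curve_img a b gamma z0 /\ 0 < r /\ holo_on (disk z0 r) f /\
    forall z, disk z0 r z -> curve_img a b gamma z -> f z = u z.

Definition disk_extension_on (a b : R) (gamma : R -> CC) (W : C -> Prop) (M : R)
    (v f : C -> C) : Prop :=
  holo_on W f /\ (forall z, W z -> curve_img a b gamma z -> f z = v z) /\
  (forall z, W z -> Cmod (f z) <= M).

Lemma disk_extension_side a b gamma V F sg W M v f :
  Copen W -> disk_extension_on a b gamma W M v f -> extension_on a b gamma V F sg W M v f.
Proof.
  intros HW (Hh & Hv & HM); repeat split; auto.
  - apply ccont_at_cont_on; intros z [Wz _]; apply holo_ccont, (holo_on_at W); auto.
  - apply holo_at_on; intros z [Wz _]; apply (holo_on_at W); auto.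
Qed.

(** A function holomorphic on the disc is an extension to each side, so stability is used for both
    signs. Here the open mapping theorem must show that every point of the smaller disc has a
    parameter near t1, on either side or on the axis. *)
Lemma closure_extends_disk a b gamma V F n u :
  analytic_curve_data a b gamma V F ->
  sup_closure a b gamma (fun v => exists f,
    disk_extension_on a b gamma (cell a b gamma n) (cell_bound n) v f) u ->
  extends_to_disk a b gamma u.
Proof.
  intros HD Hcl.
  set (W := cell a b gamma n) in *; set (M := cell_bound n) in *.
  destruct (cell_center a b gamma n (proj1 HD)) as (t & r & Ht & Hr & EW); fold W in EW.
  assert (HW : Copen W) by apply cell_open.
  destruct (chart _ _ _ _ _ _ _ HD Ht Hr) as (t1 & rho & Ht1 & Hrho & Hsq).
  rewrite <- EW in Hsq.
  assert (Hseq : forall j : nat, exists p : (C -> C) * (C -> C),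
    disk_extension_on a b gamma W M (fst p) (snd p) /\
    sup_close a b gamma u (fst p) (/ (INR j + 1))).
  { intros j; destruct (Hcl _ (inv_INR_pos j)) as (v & (lam & Hlam) & Hv); exists (v, lam); auto. }
  apply choice in Hseq; destruct Hseq as [p Hp].
  set (v := fun j => fst (p j)); set (lam := fun j => snd (p j)).
  assert (Hext : forall j, disk_extension_on a b gamma W M (v j) (lam j)) by apply Hp.
  assert (Hv : forall j, sup_close a b gamma u (v j) (/ (INR j + 1))) by apply Hp.
  assert (Hrho2 : 0 < rho ^ 2 / 4) by nra.
  destruct (curve_eq _ _ _ _ _ _ HD Ht1) as [E1 V1].
  pose proof HD as (_ & HV & _ & HF & Hinj & _).
  destruct (open_mapping V F (t1, 0) _ HV HF Hinj V1 Hrho2) as (d & Hd & Hop).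
  set (W' := disk (gamma t1) d).
  assert (HW' : Copen W') by apply Copen_disk.
  assert (HS : forall z, W' z -> exists w, z = F w /\ Cmod (w - (t1, 0)) < rho ^ 2 / 4).
  { intros z Wz; apply disk_Cmod in Wz; rewrite E1 in Wz.
    destruct (Hop z Wz) as (w & _ & L & E); exists w; auto. }
  assert (HSW : forall z, W' z -> W z).
  { intros z Hz; destruct (HS z Hz) as (w & -> & L); apply Hsq, Cmod_in_square; nra. }
  assert (HC : unif_cauchy W' lam).
  { intros eta Heta.
    destruct (extension_stability _ _ _ _ _ _ _ _ _ _ _ HD (or_introl eq_refl) HW Hrho Hsq
      (cell_bound_pos n) Heta) as (eps1 & He1 & K1).
    destruct (extension_stability _ _ _ _ _ _ _ _ _ _ _ HD (or_intror eq_refl) HW Hrho Hsq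
      (cell_bound_pos n) Heta) as (eps2 & He2 & K2).
    destruct (sup_close_seq _ _ _ _ _ Hv (Rmin eps1 eps2)) as [N HN]; [now apply Rmin_pos|].
    pose proof (Rmin_l eps1 eps2); pose proof (Rmin_r eps1 eps2).
    exists N; intros i j Hi Hj z Sz; destruct (HS z Sz) as (w & -> & L).
    specialize (HN i j Hi Hj).
    destruct (Rle_dec 0 (snd w)).
    - apply (K1 (v i) (v j)); auto using disk_extension_side; try lra.
      intros s Hs; specialize (HN s Hs); lra.
    - apply (K2 (v i) (v j)); auto using disk_extension_side; try lra.
      intros s Hs; specialize (HN s Hs); lra. }
  destruct (unif_cauchy_limit _ _ HC) as [l Hl].
  exists (gamma t1), d, l; repeat split; auto.
  - exists t1; auto.
  - apply holo_at_on; apply (unif_limit_holo W' lam); auto.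
    intros j x Wx; destruct (Hext j) as (Hh & _); apply (holo_on_at W); auto.
  - intros z Wz Cz.
    apply (sup_close_limit a b gamma u v lam l W'); auto.
    intros j; destruct (Hext j) as (_ & Hlv & _); apply Hlv; auto; now apply HSW.
Qed.

Lemma extends_disk_cell a b gamma V F u :
  analytic_curve_data a b gamma V F -> extends_to_disk a b gamma u ->
  exists n f, disk_extension_on a b gamma (cell a b gamma n) (cell_bound n) u f.
Proof.
  intros HD (z & r & f & Cz & Hr & Hh & Hu).
  assert (Dz : disk z r z) by (apply disk_Cmod; rewrite Cminus_diag, Cmod_0; auto).
  destruct (holo_ccont _ _ (holo_on_at _ _ _ (Copen_disk z r) Hh Dz) 1 Rlt_0_1) as (d & Hd & K).
  destruct (cell_inside a b gamma V F (fun w => disk z r w /\ disk z d w) z (Cmod (f z) + 1))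
    as (n & Hn & HM); auto.
  { apply Copen_and; apply Copen_disk. }
  { split; auto; apply disk_Cmod; rewrite Cminus_diag, Cmod_0; auto. }
  exists n, f; repeat split.
  - apply holo_at_on; intros w Hw; apply (holo_on_at (disk z r)); auto using Copen_disk; now apply Hn.
  - intros w Hw Cw; apply Hu; auto; now apply Hn.
  - intros w Hw; destruct (Hn w Hw) as [Ww Dw]; apply disk_Cmod in Dw; specialize (K w Dw).
    pose proof (Cmod_le_sub (f w) (f z)); lra.
Qed.

(** By contraposition [U2] is contained in [U5], so the density of [U5] is inherited from [U4]. *)
Lemma extends_disk_side a b gamma V F sg k u :
  analytic_curve_data a b gamma V F -> Ck_curve a b gamma k u ->
  extends_to_disk a b gamma u -> extends_to_side a b gamma (side V F sg) u.
Proof.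
  intros HD Hu (z & r & f & Cz & Hr & Hh & Hfu).
  apply (extends_from_local _ _ _ _ _ _ k u f (disk z r) z); auto.
  - apply Copen_disk.
  - apply disk_Cmod; rewrite Cminus_diag, Cmod_0; auto.
  - apply ccont_at_cont_on; intros w [Hw _]; apply holo_ccont, (holo_on_at (disk z r));
      auto using Copen_disk.
  - intros w Hw _; apply (holo_on_at (disk z r)); auto using Copen_disk.
Qed.

(** * The G_delta property *)

(** Inside C^k the two hypotheses squeeze [Ext] into the union of the closures of the [B n]. The
    sets [B n] need not be closed, which is what permits the limit to extend to a smaller disc
    only. *)
Lemma Gdelta_complement a b gamma k (Ext : (C -> C) -> Prop) (B : nat -> (C -> C) -> Prop) :
  (forall u, Ext u -> exists n, B n u) ->
  (forall n u, Ck_curve a b gamma k u -> sup_closure a b gamma (B n) u -> Ext u) ->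
  Ck_Gdelta a b gamma k (fun u => Ck_curve a b gamma k u /\ ~ Ext u).
Proof.
  intros H1 H2; split; [tauto|].
  exists (fun n u => ~ sup_closure a b gamma (B n) u); split.
  - intros n u Hu Ou.
    assert (He : exists eps, 0 < eps /\ forall v, B n v -> ~ sup_close a b gamma u v eps).
    { apply NNPP; intros N; apply Ou; intros eps He; apply NNPP; intros N2; apply N.
      exists eps; split; auto; intros v Bv Hv; apply N2; exists v; auto. }
    destruct He as (eps & He & HB).
    exists O, (eps / 2); split; [destruct k; simpl; auto; lia|split; [lra|]].
    intros v Hv (D & (HD0 & _) & HD) Cv.
    destruct (Cv (eps / 2)) as (w & Bw & Hw); [lra|].
    apply (HB w Bw); intros t Ht.
    specialize (HD O (le_n _) t Ht); rewrite HD0, Cnorm_Cmod in HD by auto.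
    change (Cmod (v (gamma t) - u (gamma t))%C <= eps / 2) in HD.
    specialize (Hw t Ht); rewrite Cmod_sub_sym in HD.
    pose proof (Cmod_sub_triangle (u (gamma t)) (v (gamma t)) (w (gamma t))); lra.
  - intros u Hu; split.
    + intros [_ N] n C; apply N; eauto.
    + intros HO; split; auto; intros HE; destruct (H1 u HE) as [n Bn].
      apply (HO n); intros eps He; exists u; split; auto; intros t _.
      rewrite Cminus_diag, Cmod_0; lra.
Qed.

Lemma Gdelta_and a b gamma k S1 S2 :
  Ck_Gdelta a b gamma k S1 -> Ck_Gdelta a b gamma k S2 ->
  Ck_Gdelta a b gamma k (fun u => S1 u /\ S2 u).
Proof.
  intros [C1 (O1 & HO1 & E1)] [C2 (O2 & HO2 & E2)]; split; [intros u [H _]; auto|].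
  exists (fun n u => O1 n u /\ O2 n u); split.
  - intros n u Hu [K1 K2].
    destruct (HO1 n u Hu K1) as (N1 & e1 & L1 & P1 & Q1).
    destruct (HO2 n u Hu K2) as (N2 & e2 & L2 & P2 & Q2).
    exists (max N1 N2), (Rmin e1 e2); split; [|split; [now apply Rmin_pos|]].
    { destruct k; simpl in *; auto; lia. }
    pose proof (Rmin_l e1 e2); pose proof (Rmin_r e1 e2).
    intros v Hv (D & HD & HDb); split; [apply Q1|apply Q2]; auto; exists D; split; auto;
      intros l Hl t Ht; specialize (HDb l ltac:(lia) t Ht); lra.
  - intros u Hu; rewrite E1, E2 by auto; split.
    + intros [A1 A2] n; auto.
    + intros A; split; intros n; apply A.
Qed.

(** * Density by perturbation *)

Lemma dense_subset a b gamma k (S S' : (CC -> CC) -> Prop) :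
  (forall u, S u -> S' u) -> Ck_dense a b gamma k S -> Ck_dense a b gamma k S'.
Proof. intros H HS O HO Hu; destruct (HS O HO Hu) as (v & Sv & Ov); exists v; auto. Qed.

Lemma Ck_tower_plus a b k g1 g2 D1 D2 :
  Ck_tower a b k g1 D1 -> Ck_tower a b k g2 D2 ->
  Ck_tower a b k (fun t => Cadd (g1 t) (g2 t)) (fun l t => Cadd (D1 l t) (D2 l t)).
Proof.
  intros (A1 & B1 & C1) (A2 & B2 & C2); split; [|split].
  - intros t Ht; rewrite A1, A2; auto.
  - intros l Hl t Ht eps He.
    destruct (B1 l Hl t Ht (eps / 2)) as (d1 & Hd1 & K1); [lra|].
    destruct (B2 l Hl t Ht (eps / 2)) as (d2 & Hd2 & K2); [lra|].
    exists (Rmin d1 d2); split; [now apply Rmin_pos|]; intros s Hs Hst.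
    pose proof (Rmin_l d1 d2); pose proof (Rmin_r d1 d2).
    specialize (K1 s Hs ltac:(lra)); specialize (K2 s Hs ltac:(lra)).
    rewrite Cnorm_Cmod in *.
    change (Cmod (D1 l s + D2 l s - (D1 l t + D2 l t) - RtoC (s - t) * (D1 (S l) t + D2 (S l) t))%C
      <= eps * Rabs (s - t)).
    replace (D1 l s + D2 l s - (D1 l t + D2 l t) - RtoC (s - t) * (D1 (S l) t + D2 (S l) t))%C
      with ((D1 l s - D1 l t - RtoC (s - t) * D1 (S l) t)
            + (D2 l s - D2 l t - RtoC (s - t) * D2 (S l) t))%C by ring.
    eapply Rle_trans; [apply Cmod_triangle|].
    change (Cmod (D1 l s - D1 l t - RtoC (s - t) * D1 (S l) t)%C <= eps / 2 * Rabs (s - t)) in K1.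
    change (Cmod (D2 l s - D2 l t - RtoC (s - t) * D2 (S l) t)%C <= eps / 2 * Rabs (s - t)) in K2.
    lra.
  - intros l Hl t Ht eps He.
    destruct (C1 l Hl t Ht (eps / 2)) as (d1 & Hd1 & K1); [lra|].
    destruct (C2 l Hl t Ht (eps / 2)) as (d2 & Hd2 & K2); [lra|].
    exists (Rmin d1 d2); split; [now apply Rmin_pos|]; intros s Hs Hst.
    pose proof (Rmin_l d1 d2); pose proof (Rmin_r d1 d2).
    specialize (K1 s Hs ltac:(lra)); specialize (K2 s Hs ltac:(lra)).
    rewrite Cnorm_Cmod in *.
    change (Cmod (D1 l s + D2 l s - (D1 l t + D2 l t))%C < eps).
    replace (D1 l s + D2 l s - (D1 l t + D2 l t))%C
      with ((D1 l s - D1 l t) + (D2 l s - D2 l t))%C by ring.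
    eapply Rle_lt_trans; [apply Cmod_triangle|].
    change (Cmod (D1 l s - D1 l t)%C < eps / 2) in K1.
    change (Cmod (D2 l s - D2 l t)%C < eps / 2) in K2.
    lra.
Qed.

(** Cantor's nested intervals: of two disjoint closed subintervals, the second is free of the only
    possible bad point as soon as the first contains it. Taking fifths keeps them strictly inside,
    so the limit lies in the open interval. *)
Lemma avoid_countable (bad : nat -> R -> Prop) delta :
  (forall n x y, bad n x -> bad n y -> x = y) -> 0 < delta ->
  exists x, 0 < x < delta /\ forall n, ~ bad n x.
Proof.
  intros Hbad Hd.
  assert (Hstep : forall q : nat * (R * R), exists p : R * R, fst (snd q) < snd (snd q) ->
    fst (snd q) < fst p /\ fst p < snd p /\ snd p < snd (snd q) /\
    forall x, fst p <= x <= snd p -> ~ bad (fst q) x).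
  { intros [n [l r]]; simpl.
    destruct (classic (exists x, l + (r - l) / 5 <= x <= l + 2 * (r - l) / 5 /\ bad n x))
      as [(x & Hx & Bx)|N].
    - exists (l + 3 * (r - l) / 5, l + 4 * (r - l) / 5); simpl; intros Hlr.
      repeat split; try lra; intros y Hy By.
      assert (x = y) by eauto; lra.
    - exists (l + (r - l) / 5, l + 2 * (r - l) / 5); simpl; intros Hlr.
      repeat split; try lra; intros y Hy By; apply N; exists y; auto. }
  apply choice in Hstep; destruct Hstep as [f Hf].
  set (J := fix J n := match n with O => (0, delta) | S m => f (m, J m) end).
  assert (HJ : forall n, fst (J n) < snd (J n)).
  { induction n as [|n IH]; [exact Hd|]; destruct (Hf (n, J n) IH) as (_ & H & _); exact H. }
  assert (HJS : forall n, fst (J n) < fst (J (S n)) /\ snd (J (S n)) < snd (J n) /\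
    forall x, fst (J (S n)) <= x <= snd (J (S n)) -> ~ bad n x).
  { intros n; destruct (Hf (n, J n) (HJ n)) as (H1 & _ & H2 & H3); auto. }
  assert (Hmono : forall n m, (n <= m)%nat -> fst (J n) <= fst (J m) /\ snd (J m) <= snd (J n)).
  { intros n m H; induction H as [|m H IH]; [lra|]; destruct (HJS m) as (? & ? & _); lra. }
  assert (Hlt : forall n m, fst (J n) <= snd (J m)).
  { intros n m; pose proof (HJ n); pose proof (HJ m).
    destruct (Nat.le_ge_cases n m) as [H'|H']; destruct (Hmono _ _ H'); lra. }
  destruct (completeness (fun r => exists n, r = fst (J n))) as [x [Hx1 Hx2]].
  { exists delta; intros r [n ->]; exact (Hlt n O). }
  { exists 0, O; reflexivity. }
  assert (Hx : forall n, fst (J n) <= x <= snd (J n)).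
  { intros n; split; [apply Hx1; eauto|]; apply Hx2; intros r [m ->]; auto. }
  exists x; split.
  - specialize (Hx 1%nat); destruct (HJS O) as (A1 & A2 & _); simpl in *; lra.
  - intros n; apply HJS, Hx.
Qed.

(** For distinct e1 and e2, the difference of the extensions divided by e1 - e2 would extend h
    itself, which [lacunary_no_extension] forbids. *)
Lemma perturbation_unique a b gamma V F sg W M t r (u h : C -> C) e1 e2 l1 l2 :
  analytic_curve_data a b gamma V F -> sg = 1 \/ sg = -1 ->
  a <= t <= b -> 0 < r -> W = disk (gamma t) r ->
  (forall s, a <= s <= b -> h (gamma s) = (lac 0 s, 0)) ->
  extension_on a b gamma V F sg W M (fun z => u z + RtoC e1 * h z)%C l1 ->
  extension_on a b gamma V F sg W M (fun z => u z + RtoC e2 * h z)%C l2 ->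
  e1 = e2.
Proof.
  intros HD Hsg Ht Hr EW Hh X1 X2.
  destruct (Req_dec e1 e2) as [|N]; auto; exfalso.
  assert (HW : Copen W) by (subst W; apply Copen_disk).
  destruct (chart _ _ _ _ _ _ _ HD Ht Hr) as (t1 & rho & Ht1 & Hrho & Hsq).
  rewrite <- EW in Hsq.
  destruct (pullback _ _ _ _ _ _ _ _ _ _ t1 rho HD Hsg HW ltac:(lra) Hsq X1)
    as (m1 & C1 & H1 & _ & _ & R1).
  destruct (pullback _ _ _ _ _ _ _ _ _ _ t1 rho HD Hsg HW ltac:(lra) Hsq X2)
    as (m2 & C2 & H2 & _ & _ & R2).
  apply (lacunary_no_extension rho (sg * t1)
    (fun z => RtoC (/ (e1 - e2)) * (m1 z - m2 z))%C); [lra| | | |].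
  - intros z; apply ccont_at_mult; [apply ccont_at_const|]; apply ccont_at_minus; auto.
  - intros z Z1 Z2; apply holo_mult; [apply holo_const|]; apply holo_minus; auto.
  - intros s Hs; rewrite R1, R2 by auto.
    rewrite Hh.
    2: { destruct (Hsq (t1 + sg * s, 0)) as (_ & _ & L); [|exact L].
         split; simpl; destruct Hsg as [-> | ->]; lra. }
    (* For sg = -1 the parameter runs backwards; evenness restores the form s0 + s with s0 = sg
       t1. *)
    assert (E : lac 0 (t1 + sg * s) = lac 0 (sg * t1 + s)).
    { destruct Hsg as [-> | ->]; [f_equal; ring|rewrite <- lac_even; f_equal; ring]. }
    rewrite E; apply injective_projections; simpl; field; lra.
  - intros x; apply lac_continuous.
Qed.

Lemma sum_f_R0_ge_term (f : nat -> R) N l :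
  (forall n, 0 <= f n) -> (l <= N)%nat -> f l <= sum_f_R0 f N.
Proof.
  intros Hf; induction N as [|N IH]; intros Hl; simpl.
  - replace l with O by lia; lra.
  - destruct (Nat.eq_dec l (S N)) as [->|Hne].
    + assert (0 <= sum_f_R0 f N) by (apply cond_pos_sum; auto); lra.
    + pose proof (Hf (S N)); specialize (IH ltac:(lia)); lra.
Qed.

Lemma U4_dense a b gamma V F k :
  analytic_curve_data a b gamma V F -> Ck_dense a b gamma k (U4 a b gamma V F k).
Proof.
  intros HD O HO (u & Hu & Ou).
  destruct (HO u Hu Ou) as (N & eps & HNk & He & Hnear).
  (* h must be a function of the point: injectivity of gamma makes it well defined on the curve, and
     0 is a default value elsewhere. *)
  assert (Hh : forall z : C, exists y : C, forall s, a <= s <= b -> gamma s = z -> y = (lac 0 s, 0)).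
  { intros z; destruct (classic (curve_img a b gamma z)) as [(s & Hs & E)|Nc].
    - exists (lac 0 s, 0); intros s' Hs' E'; do 2 f_equal.
      destruct HD as (_ & _ & _ & _ & _ & _ & Hinj); apply Hinj; auto; now rewrite E, E'.
    - exists (RtoC 0); intros s Hs E; exfalso; apply Nc; exists s; auto. }
  apply choice in Hh; destruct Hh as [h Hh'].
  assert (Hh : forall s, a <= s <= b -> h (gamma s) = (lac 0 s, 0)) by (intros; apply Hh'; auto).
  set (v := fun e z => (u z + RtoC e * h z)%C).
  (* One index encodes a side and a cell: s = 0 stands for the upper side, every other s for the
     lower one. *)
  set (bad := fun n e => let (s, m) := Cantor.of_nat n in
    exists lam, extension_on a b gamma V F (match s with O => 1 | S _ => -1 end)
      (cell a b gamma m) (cell_bound m) (v e) lam).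
  (* K majorizes the derivatives of h of all orders up to N, so e < eps / K keeps the perturbation
     inside the given neighbourhood; the added 1 makes K positive. *)
  set (K := sum_f_R0 lac_sum N + 1).
  assert (HK : 0 < K).
  { unfold K; assert (0 <= sum_f_R0 lac_sum N) by (apply cond_pos_sum, lac_sum_nonneg); lra. }
  destruct (avoid_countable bad (eps / K)) as (e & He' & Hgood).
  { intros n x y; unfold bad; destruct (of_nat n) as [s m]; intros [l1 L1] [l2 L2].
    destruct (cell_center a b gamma m (proj1 HD)) as (t & r & Ht & Hr & EW).
    refine (perturbation_unique _ _ _ _ _ _ _ _ t r u h x y l1 l2 HD _ Ht Hr EW Hh L1 L2).
    destruct s; auto. }
  { now apply Rdiv_lt_0_compat. }
  assert (Hv : Ck_curve a b gamma k (v e)).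
  { destruct Hu as [Du HDu].
    exists (fun l t => Cadd (Du l t) (e * lac l t, 0)).
    destruct (Ck_tower_plus _ _ _ _ _ _ _ HDu (lac_tower a b k e)) as (T0 & T1 & T2).
    split; [|split; auto].
    intros t Ht; rewrite T0 by auto; unfold v; rewrite Hh by auto.
    apply injective_projections; simpl; ring. }
  assert (Hgood' : forall sg, sg = 1 \/ sg = -1 -> ~ extends_to_side a b gamma (side V F sg) (v e)).
  { intros sg Hsg Hext; destruct (extends_cell _ _ _ _ _ _ _ HD Hext) as (n & lam & L).
    destruct Hsg as [-> | ->]; [apply (Hgood (Cantor.to_nat (0, n)%nat))|apply (Hgood (Cantor.to_nat (1, n)%nat))];
      unfold bad; rewrite cancel_of_to; exists lam; exact L. }
  exists (v e); split.
  - split; (split; [exact Hv|]).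
    + rewrite <- side_Kplus; apply Hgood'; auto.
    + rewrite <- side_Kminus; apply Hgood'; auto.
  - apply Hnear; auto; exists (fun l t => (e * lac l t, 0)); split.
    + destruct (lac_tower a b k e) as (T0 & T1 & T2); split; [|split; auto].
      intros t Ht; unfold v; rewrite Hh by auto.
      apply injective_projections; simpl; ring.
    + intros l Hl t Ht; rewrite Cnorm_Cmod.
      change (Cmod (RtoC (e * lac l t)) <= eps); rewrite Cmod_R, Rabs_mult, Rabs_pos_eq by lra.
      apply Rle_trans with (eps / K * K); [|right; field; lra].
      apply Rmult_le_compat; try lra; [apply Rabs_pos|].
      eapply Rle_trans; [apply lac_bound|].
      pose proof (sum_f_R0_ge_term lac_sum N l lac_sum_nonneg Hl); unfold K; lra.
Qed.

Theorem theorem4p35 (a b : R) (gamma : R -> CC) (V : CC -> Prop) (F : CC -> CC) (k : kreg) :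
  analytic_curve_data a b gamma V F ->
  dense_Gdelta a b gamma k (U2 a b gamma V F k) /\
  dense_Gdelta a b gamma k (U3 a b gamma V F k) /\
  dense_Gdelta a b gamma k (U4 a b gamma V F k) /\
  dense_Gdelta a b gamma k (U5 a b gamma k).
Proof.
  intros HD.
  assert (D4 := U4_dense a b gamma V F k HD).
  assert (Gside : forall sg, sg = 1 \/ sg = -1 -> Ck_Gdelta a b gamma k
    (fun u => Ck_curve a b gamma k u /\ ~ extends_to_side a b gamma (side V F sg) u)).
  { intros sg Hsg; apply (Gdelta_complement _ _ _ _ _ (fun n v => exists lam,
      extension_on a b gamma V F sg (cell a b gamma n) (cell_bound n) v lam)).
    - intros u; apply extends_cell; auto.
    - intros n u; apply closure_extends; auto. }
  assert (G2 : Ck_Gdelta a b gamma k (U2 a b gamma V F k)).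
  { assert (G := Gside 1 (or_introl eq_refl)); rewrite side_Kplus in G; exact G. }
  assert (G3 : Ck_Gdelta a b gamma k (U3 a b gamma V F k)).
  { assert (G := Gside (-1) (or_intror eq_refl)); rewrite side_Kminus in G; exact G. }
  split; [|split; [|split]]; split; auto.
  - revert D4; apply dense_subset; intros u [H _]; exact H.
  - revert D4; apply dense_subset; intros u [_ H]; exact H.
  - exact (Gdelta_and _ _ _ _ _ _ G2 G3).
  - revert D4; apply dense_subset; intros u [[Hu H] _]; split; auto.
    intros HE; apply H; rewrite <- side_Kplus.
    exact (extends_disk_side _ _ _ _ _ _ _ _ HD Hu HE).
  - apply (Gdelta_complement _ _ _ _ (extends_to_disk a b gamma) (fun n v => exists f,
      disk_extension_on a b gamma (cell a b gamma n) (cell_bound n) v f)).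
    + intros u; exact (extends_disk_cell a b gamma V F u HD).
    + intros n u _; exact (closure_extends_disk a b gamma V F n u HD).
Qed.
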